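(* Let $E_1,E_2,E_3$ be spectral measures on a Hilbert space $\mathscr H$ (defined on $\sigma$-algebras of subsets of sets $\mathscr X_1,\mathscr X_2,\mathscr X_3$) and let $\Psi\in L^\infty(E_1)\otimes_{\rm h}L^\infty(E_2)\otimes_{\rm h}L^\infty(E_3)$. For bounded linear operators $T,R$ on $\mathscr H$ put $$W=\int_{\mathscr X_1}\int_{\mathscr X_2}\int_{\mathscr X_3}\Psi(x_1,x_2,x_3)\,dE_1(x_1)\,T\,dE_2(x_2)\,R\,dE_3(x_3).$$ Then the following hold. (i) If $p\ge2$, $T$ is a bounded linear operator and $R\in\boldsymbol S_p$, then $W\in\boldsymbol S_p$ and $$\|W\|_{\boldsymbol S_p}\le\|\Psi\|_{L^\infty\otimes_{\rm h}L^\infty\otimes_{\rm h}L^\infty}\,\|T\|\cdot\|R\|_{\boldsymbol S_p}.$$ (ii) If $p\ge2$, $T\in\boldsymbol S_p$ and $R$ is a bounded linear operator, then $W\in\boldsymbol S_p$ and $$\|W\|_{\boldsymbol S_p}\le\|\Psi\|_{L^\infty\otimes_{\rm h}L^\infty\otimes_{\rm h}L^\infty}\,\|T\|_{\boldsymbol S_p}\|R\|.$$ (iii) If $1/p+1/q\le1/2$, $T\in\boldsymbol S_p$ and $R\in\boldsymbol S_q$, then $W\in\boldsymbol S_r$ with $1/r=1/p+1/q$ and $$\|W\|_{\boldsymbol S_r}\le\|\Psi\|_{L^\infty\otimes_{\rm h}L^\infty\otimes_{\rm h}L^\infty}\,\|T\|_{\boldsymbol S_p}\|R\|_{\boldsymbol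 S_q}.$$
   Context: $\boldsymbol S_p$ ($0<p<\infty$) is the Schatten--von Neumann class with its norm; $\|\cdot\|$ is the operator norm. $\mathcal B$ is the space of infinite matrices inducing bounded operators on $\ell^2$, with the operator norm. $L^\infty_{E}(\ell^2)$ (resp. $L^\infty_E(\mathcal B)$) is the set of sequences $\{\alpha_j\}_{j\ge0}$ (resp. matrices $\{\beta_{jk}\}_{j,k\ge0}$) of measurable functions with $\|\{\alpha_j\}\|_{L^\infty(\ell^2)}=E\text{-}\operatorname{ess\,sup}\big(\sum_j|\alpha_j(x)|^2\big)^{1/2}<\infty$ (resp. $\|\{\beta_{jk}\}\|_{L^\infty(\mathcal B)}=E\text{-}\operatorname{ess\,sup}\|\{\beta_{jk}(x)\}\|_{\mathcal B}<\infty$). Throughout, $\sum_{j,k\ge0}$ means $\lim_{M,N\to\infty}\sum_{j=0}^N\sum_{k=0}^M$. The Haagerup tensor product $L^\infty(E_1)\otimes_{\rm h}L^\infty(E_2)\otimes_{\rm h}L^\infty(E_3)$ is the space of functions $\Psi$ of the form $\Psi(x_1,x_2,x_3)=\sum_{j,k\ge0}\alpha_j(x_1)\beta_{jk}(x_2)\gamma_k(x_3)$ with $\{\alpha_j\}\in L^\infty_{E_1}(\ell^2)$, $\{\beta_{jk}\}\in L^\infty_{E_2}(\mathcal B)$, $\{\gamma_k\}\in L^\infty_{E_3}(\ell^2)$. Its norm $\|\Psi\|_{L^\infty\otimes_{\rm h}L^\infty\otimes_{\rm h}L^\infty}$ is the infimum of $\|\{\alpha_j\}\|_{L^\infty(\ell^2)}\|\{\beta_{jk}\}\|_{L^\infty(\mathcal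 B)}\|\{\gamma_k\}\|_{L^\infty(\ell^2)}$ over all such representations. For such $\Psi$ and bounded $T,R$ the triple operator integral is $$\iiint\Psi\,dE_1\,T\,dE_2\,R\,dE_3=\sum_{j,k\ge0}\Big(\int\alpha_j\,dE_1\Big)T\Big(\int\beta_{jk}\,dE_2\Big)R\Big(\int\gamma_k\,dE_3\Big);$$ the series converges in the weak operator topology, and its sum is independent of the representation of $\Psi$. *)

(* Defs.v *)
From HB Require Import structures.
From mathcomp Require Import all_boot all_order all_algebra.
From mathcomp Require Export complex.
From mathcomp Require Export all_classical all_reals all_analysis.

Set Implicit Arguments.
Unset Strict Implicit.
Unset Printing Implicit Defensive.

Import Order.TTheory GRing.Theory Num.Theory.
Import numFieldNormedType.Exports.

Local Open Scope classical_set_scope.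
Local Open Scope ring_scope.
Local Open Scope complex_scope.

(* A complex Hilbert space is given by a complete normed module [H] over
   [R[i]] and a form [dot : {dot H for Num.conj}] (linear in the first argument,
   conjugate-linear in the second) such that [dot u u = `|u| ^+ 2] for all [u].
   The library topology on [R[i]] is attached to its alias [R[i]^o], whence the
   casts below. *)

(* The norms of [H] and of [R[i]] take their values in [R[i]]; [rnorm] is the
   same norm seen in [R]. *)
Definition rnorm (R : realType) (V : normedModType R[i]) (x : V) : R :=
  complex.Re `|x|.

Definition cmod (R : realType) (z : R[i]) : R := complex.Re `|z|.

Section Operators.
Context {R : realType} {H : completeNormedModType R[i]}.

Definition bounded_op (T : H -> H) : Prop :=
  linear T /\ exists M : R, forall u, rnorm (T u) <= M * rnorm u.

(* Meaningful for bounded operators. *)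
Definition opnorm (T : H -> H) : R :=
  inf [set M : R | 0 <= M /\ forall u, rnorm (T u) <= M * rnorm u].

Definition rank_le (n : nat) (K : H -> H) : Prop :=
  exists e : 'I_n -> H, forall u, exists c : 'I_n -> R[i],
    K u = \sum_(i < n) c i *: e i.

Definition singular_value (T : H -> H) (n : nat) : R :=
  inf [set opnorm (fun u => T u - K u) |
       K in [set K | bounded_op K /\ rank_le n K]].

Definition schatten_norm (p : R) (T : H -> H) : \bar R :=
  poweR (\sum_(0 <= n <oo) (singular_value T n `^ p)%:E)%E p^-1.

Definition schatten (p : R) (T : H -> H) : Prop :=
  bounded_op T /\ (schatten_norm p T < +oo)%E.

End Operators.

Section Ell2.
Context {R : realType}.

Definition l2norm (a : nat -> R[i]) : \bar R :=
  poweR (\sum_(0 <= j <oo) (cmod (a j) ^+ 2)%:E)%E 2^-1.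

(* [b] maps every [xi] in l^2 to a sequence in l^2 (the rows converging), with
   norm at most [M]. *)
Definition l2_matrix_bound (b : nat -> nat -> R[i]) (M : R) : Prop :=
  0 <= M /\ forall xi : nat -> R[i], (l2norm xi < +oo)%E ->
    let row j : nat -> R[i]^o := series (fun k => b j k * xi k : R[i]^o) in
    (forall j, cvgn (row j)) /\
    (l2norm (fun j => limn (row j)) <= M%:E * l2norm xi)%E.

(* The norm of the space of matrices inducing bounded operators on l^2; it is
   [+oo] on the other matrices. *)
Definition matrix_norm (b : nat -> nat -> R[i]) : \bar R :=
  ereal_inf [set M%:E | M in l2_matrix_bound b].

(* [\sum_(j, k >= 0) a j k = l] as the limit of the rectangular partial sums,
   the two bounds tending to infinity independently. *)
Definition double_sum_to (a : nat -> nat -> R[i]) (l : R[i]) : Prop :=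
  (\sum_(j < nm.1) \sum_(k < nm.2) a j k : R[i]^o) @[nm --> (\oo, \oo)]
    --> (l : R[i]^o).

End Ell2.

Section SpectralMeasures.
Context {R : realType} {H : completeNormedModType R[i]}.
Variable dot : {dot H for @Num.conj R[i]}.

Definition orthogonal_projection (P : H -> H) : Prop :=
  [/\ linear P, forall u, P (P u) = P u
    & forall u v, dot (P u) v = dot u (P v)].

(* As for library measures, the values on non-measurable sets are
   unconstrained and play no role. *)
Record spectral_measure d (X : measurableType d) := SpectralMeasure {
  spectral_fun :> set X -> H -> H ;
  spectral_projection : forall A, measurable A ->
    orthogonal_projection (spectral_fun A) ;
  spectral_setT : forall u, spectral_fun setT u = u ;
  spectral_sigma_additive : forall F : nat -> set X,
    (forall n, measurable (F n)) -> trivIset setT F -> forall u,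
    \sum_(i < n) spectral_fun (F i) u @[n --> \oo]
      --> spectral_fun (\bigcup_i F i) u }.

End SpectralMeasures.

Section SpectralIntegral.
Context {R : realType} {H : completeNormedModType R[i]}.
Context {dot : {dot H for @Num.conj R[i]}} {d} {X : measurableType d}.
Variable E : spectral_measure dot X.

Definition spectral_null (N : set X) : Prop :=
  measurable N /\ forall u, E N u = 0.

Definition spectral_ae (P : X -> Prop) : Prop :=
  exists2 N, spectral_null N & forall x, ~ N x -> P x.

(* For nonnegative [f]. *)
Definition spectral_ess_sup (f : X -> \bar R) : \bar R :=
  ereal_inf [set M | (0 <= M)%E /\ spectral_ae (fun x => (f x <= M)%E)].

Definition cmeasurable (f : X -> R[i]) : Prop :=
  measurable_fun setT (fun x => complex.Re (f x)) /\
  measurable_fun setT (fun x => complex.Im (f x)).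

(* [\int f dE = A]: up to any [eps], some simple function approximates [f]
   uniformly E-a.e. while its integral approximates [A] in operator norm. *)
Definition is_spectral_integral (f : X -> R[i]) (A : H -> H) : Prop :=
  bounded_op A /\
  forall eps : R, 0 < eps ->
  exists (n : nat) (c : 'I_n -> R[i]) (D : 'I_n -> set X),
    [/\ forall i, measurable (D i),
        spectral_ae (fun x => cmod (f x - \sum_(i < n) c i * \1_(D i) x) <= eps)
      & opnorm (fun u => A u - \sum_(i < n) c i *: E (D i) u) <= eps].

(* The value is unique when it exists, and exists for every measurable
   E-essentially bounded [f]. *)
Definition spectral_integral (f : X -> R[i]) : H -> H :=
  xget (fun=> 0) [set A | is_spectral_integral f A].

Definition Linf_l2_norm (a : nat -> X -> R[i]) : \bar R :=
  spectral_ess_sup (fun x => l2norm (a ^~ x)).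

Definition Linf_l2 (a : nat -> X -> R[i]) : Prop :=
  (forall j, cmeasurable (a j)) /\ (Linf_l2_norm a < +oo)%E.

Definition Linf_matrix_norm (b : nat -> nat -> X -> R[i]) : \bar R :=
  spectral_ess_sup (fun x => matrix_norm (fun j k => b j k x)).

Definition Linf_matrix (b : nat -> nat -> X -> R[i]) : Prop :=
  (forall j k, cmeasurable (b j k)) /\ (Linf_matrix_norm b < +oo)%E.

End SpectralIntegral.

Section TripleOperatorIntegral.
Context {R : realType} {H : completeNormedModType R[i]}.
Context {dot : {dot H for @Num.conj R[i]}}.
Context {d1 d2 d3 : measure_display}.
Context {X1 : measurableType d1} {X2 : measurableType d2}.
Context {X3 : measurableType d3}.
Variables (E1 : spectral_measure dot X1) (E2 : spectral_measure dot X2).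
Variable E3 : spectral_measure dot X3.

(* The coefficients are elements of L^oo(E_i), hence determined up to E_i-null
   sets; accordingly the series has to represent [Psi] for all [x_i] outside
   some E_i-null sets. *)
Definition haagerup_representation (Psi : X1 -> X2 -> X3 -> R[i])
    (a : nat -> X1 -> R[i]) (b : nat -> nat -> X2 -> R[i])
    (c : nat -> X3 -> R[i]) : Prop :=
  [/\ Linf_l2 E1 a, Linf_matrix E2 b, Linf_l2 E3 c
    & exists N1 N2 N3,
      [/\ spectral_null E1 N1, spectral_null E2 N2, spectral_null E3 N3
        & forall x1 x2 x3, ~ N1 x1 -> ~ N2 x2 -> ~ N3 x3 ->
          double_sum_to (fun j k => a j x1 * b j k x2 * c k x3)
                        (Psi x1 x2 x3)]].

Definition haagerup (Psi : X1 -> X2 -> X3 -> R[i]) : Prop :=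
  exists a b c, haagerup_representation Psi a b c.

Definition haagerup_norm (Psi : X1 -> X2 -> X3 -> R[i]) : \bar R :=
  ereal_inf [set M | exists a b c, haagerup_representation Psi a b c /\
    M = (Linf_l2_norm E1 a * Linf_matrix_norm E2 b * Linf_l2_norm E3 c)%E].

(* [W] is the sum of the series attached to some representation of [Psi], in
   the weak operator topology. *)
Definition triple_operator_integral (Psi : X1 -> X2 -> X3 -> R[i])
    (T Q W : H -> H) : Prop :=
  bounded_op W /\
  exists a b c, haagerup_representation Psi a b c /\
    forall u v, double_sum_to
      (fun j k => dot (spectral_integral E1 (a j)
                        (T (spectral_integral E2 (b j k)
                             (Q (spectral_integral E3 (c k) u))))) v)
      (dot (W u) v).

End TripleOperatorIntegral.

(* Main.v *)
(* Only finite sums are used. A bounded [T] has an approximate singular value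
   decomposition: a greedy choice of orthonormal [e_i], [f_i] gives
   [<T e_i, f_i> >= s_i - eps] and
   [|T - \sum_(i < n) s_i <., e_i> f_i| <= s_n + eps].
   Hence [\sum s_i(W)^r] is controlled by the sums [\sum |<W e_i, f_i>|^r] over
   orthonormal families. For a partial sum of the series defining [W], with
   [A_j], [B_jk], [C_k] the spectral integrals of the coefficients, the
   analogue of [|<W e_i, f_i>|] is at most [|beta| x_i y_i], where
   [x_i^2 = \sum_k |Q C_k e_i|^2] and [y_i^2 = \sum_j |T^* A_j^* f_i|^2]. Since
   spectral integrals are normal, both [\sum_k C_k^* C_k] and
   [\sum_k C_k C_k^*] are at most [|gamma|^2]; for [g_m] the right singular
   vectors of [Q], the weights [\sum_k |<C_k e_i, g_m>|^2] are thus doubly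
   substochastic up to the factor [|gamma|^2], and Jensen's inequality (this is
   where [q >= 2] enters) gives [\sum x_i^q <= |gamma|^q \sum s_m(Q)^q]. The
   same holds for [y_i], and Hölder's inequality concludes.

   The operator [W] comes from one representation of [Psi] while the norm is an
   infimum over all of them, so the sum has to be independent of the
   representation: for [T], [Q] of rank one this is dominated convergence in
   each of the three variables, and the general case follows by compressing [T]
   and [Q] to the span of finitely many vectors.

   A finite family of spectral integrals is approximated by sums
   [\sum_i f(x_i) E(P_i)] over a common finite partition with common sample
   points, which reduces estimates on integrals to pointwise ones. *)

Require Import Defs.
From mathcomp Require Import all_boot all_order all_algebra.
From mathcomp Require Import ring lra boolp classical_sets measurable_realfun.
Set Implicit Arguments.
Unset Strict Implicit.
Unset Printing Implicit Defensive.
Import Order.TTheory GRing.Theory Num.Theory.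
Import numFieldNormedType.Exports.
Local Open Scope classical_set_scope.
Local Open Scope ring_scope.
Local Open Scope complex_scope.

(** [W] is not known to be compact and norms need not be attained, so every decomposition carries an
    error. Two uniformities keep the errors harmless. On unit vectors the partial sums are bounded
    by [alpha * beta * gamma * opnorm T * opnorm Q] whatever their length [N]; hence [N] can be
    fixed first, to approximate [W] on finitely many pairs [(e i, f i)], and an operator of a
    Schatten class can then be replaced by one of finite rank, whose adjoint is explicit, at a cost
    independent of [N]. Likewise the tails of a partial sum are controlled by the columns [opC k u]
    and [opA_adj j v] and by upper bounds of [opnorm T] and [opnorm Q], so one cutoff serves the
    operators and all their compressions; this permits the interchange of limits behind independence
    of the representation.

    The bound [beta] for scalar matrices acts on vectors of [H] because a matrix tensored with an
    identity keeps its norm. Norms that are infima are replaced by strict upper bounds, which are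
    positive and hold off a null set; infima return only at the end. Of the double limits only the
    square partial sums are used. *)

Section ComplexModulus.
Context {R : realType}.
Local Notation C := R[i].
Implicit Types (z w : C) (x : R).

Lemma cmodE z : `|z| = (cmod z)%:C.
Proof. by rewrite /cmod RRe_real ?normr_real. Qed.

Lemma cmod_ge0 z : 0 <= cmod z.
Proof. by rewrite -lecR -cmodE rmorph0. Qed.

Lemma cmod_le z x : (cmod z <= x) = (`|z| <= x%:C).
Proof. by rewrite cmodE lecR. Qed.

Lemma cmod0 : cmod (0 : C) = 0.
Proof. by rewrite /cmod normr0. Qed.

Lemma cmod1 : cmod (1 : C) = 1.
Proof. by rewrite /cmod normr1. Qed.

Lemma cmodM z w : cmod (z * w) = cmod z * cmod w.
Proof. by apply: (@complexI R); rewrite rmorphM /= -!cmodE normrM. Qed.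

Lemma cmodD z w : cmod (z + w) <= cmod z + cmod w.
Proof. by rewrite cmod_le rmorphD /= -!cmodE ler_normD. Qed.

Lemma cmodN z : cmod (- z) = cmod z.
Proof. by rewrite /cmod normrN. Qed.

Lemma cmodB z w : cmod (z - w) <= cmod z + cmod w.
Proof. by rewrite -(cmodN w) cmodD. Qed.

Lemma cmod_conj z : cmod (Num.conj z) = cmod z.
Proof. by rewrite /cmod norm_conjC. Qed.

Lemma cmod_eq0 z : (cmod z == 0) = (z == 0).
Proof. by rewrite -(inj_eq (@complexI R)) -cmodE normr_eq0. Qed.

Lemma cmod_sum (I : Type) (r : seq I) (P : pred I) (F : I -> C) :
  cmod (\sum_(i <- r | P i) F i) <= \sum_(i <- r | P i) cmod (F i).
Proof.
elim/big_rec2: _ => [|i x z _ h]; first by rewrite cmod0.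
by apply: le_trans (cmodD _ _) _; rewrite lerD2l.
Qed.

Lemma cmod2 z : ((cmod z) ^+ 2)%:C = z * Num.conj z.
Proof. by rewrite rmorphXn /= -cmodE normCK. Qed.

Lemma cmod2E z : cmod z ^+ 2 = complex.Re z ^+ 2 + complex.Im z ^+ 2.
Proof. by apply: (@complexI R); rewrite rmorphXn /= -cmodE -add_Re2_Im2. Qed.

Lemma cmod_real x : cmod x%:C = `|x|.
Proof.
apply/eqP; rewrite -(@eqrXn2 _ 2) ?cmod_ge0 // cmod2E /= expr0n addr0.
by rewrite real_normK ?num_real.
Qed.

Lemma conj_real x : Num.conj x%:C = x%:C :> C.
Proof. by apply/eqP; rewrite eq_complex /= oppr0 !eqxx. Qed.

Lemma Re_le_cmod z : `|complex.Re z| <= cmod z.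
Proof. by rewrite -lecR -cmodE normc_ge_Re. Qed.

Lemma Im_le_cmod z : `|complex.Im z| <= cmod z.
Proof.
rewrite -(@ler_pXn2r _ 2) ?nnegrE ?cmod_ge0 // real_normK ?num_real //.
by rewrite cmod2E lerDr sqr_ge0.
Qed.

End ComplexModulus.

(** For positive bounds [a], [b], the weighted inequality [x y <= (b/a x^2 + a/b y^2) / 2] sums to
    [a * b]. Bounds that may vanish are first enlarged by a small [d]. *)
Lemma cauchy_schwarz_sum (R : realType) (I : Type) (r : seq I) (P : pred I)
    (x y : I -> R) (A B : R) : 0 <= A -> 0 <= B ->
  \sum_(i <- r | P i) x i ^+ 2 <= A ^+ 2 ->
  \sum_(i <- r | P i) y i ^+ 2 <= B ^+ 2 ->
  \sum_(i <- r | P i) x i * y i <= A * B.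
Proof.
move=> A0 B0 hx hy.
have amgm (a b : R) : 0 < a -> 0 < b ->
    \sum_(i <- r | P i) x i ^+ 2 <= a ^+ 2 ->
    \sum_(i <- r | P i) y i ^+ 2 <= b ^+ 2 ->
    \sum_(i <- r | P i) x i * y i <= a * b.
  move=> a0 b0 hxa hyb.
  have h i : P i -> x i * y i <= (b / a * x i ^+ 2 + a / b * y i ^+ 2) / 2.
    move=> _; have := sqr_ge0 (b * x i - a * y i) => h.
    have -> : (b / a * x i ^+ 2 + a / b * y i ^+ 2) / 2 =
      (b * x i - a * y i) ^+ 2 / (2 * a * b) + x i * y i.
      by field; rewrite !gt_eqF.
    by rewrite lerDr divr_ge0 // !mulr_ge0 // ltW.
  apply: le_trans (ler_sum _ h) _.
  rewrite -mulr_suml big_split /= -!mulr_sumr ler_pdivrMr ?ltr0n //.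
  apply: le_trans (lerD (ler_wpM2l _ hxa) (ler_wpM2l _ hyb)) _;
    rewrite ?divr_ge0 ?(ltW a0) ?(ltW b0) //.
  by rewrite le_eqVlt; apply/orP; left; apply/eqP; field; rewrite !gt_eqF.
apply/ler_addgt0Pr => e e0.
(* Since [d <= 1], the product [(A + d) * (B + d)] is at most [A * B + d * (A + B + 1)], hence at
   most [A * B + e]. *)
set d := Num.min 1 (e / (A + B + 1)).
have AB0 : 0 < A + B + 1 by lra.
have d0 : 0 < d by rewrite lt_min ltr01 divr_gt0.
have d1 : d <= 1 by rewrite ge_min lexx.
have de : d * (A + B + 1) <= e.
  by rewrite -ler_pdivlMr // ge_min lexx orbT.
apply: (@le_trans _ _ ((A + d) * (B + d))).
  apply: amgm; [lra|lra| |].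
  - by apply: le_trans hx _; rewrite ler_pXn2r ?nnegrE //; lra.
  - by apply: le_trans hy _; rewrite ler_pXn2r ?nnegrE //; lra.
nra.
Qed.

(** * Inner products, bounded operators, finite orthonormal families *)

Section InnerProduct.
Context {R : realType} {H : completeNormedModType R[i]}.
Local Notation C := R[i].
Implicit Types (u v w : H) (a : C).

Lemma rnormE u : `|u| = (rnorm u)%:C.
Proof. by rewrite /rnorm RRe_real ?normr_real. Qed.

Lemma rnorm_ge0 u : 0 <= rnorm u.
Proof. by rewrite -lecR -rnormE rmorph0. Qed.

Lemma rnorm0 : rnorm (0 : H) = 0.
Proof. by rewrite /rnorm normr0. Qed.

Lemma rnorm_eq0 u : (rnorm u == 0) = (u == 0).
Proof. by rewrite -(inj_eq (@complexI R)) -rnormE normr_eq0. Qed.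

Lemma rnorm_gt0 u : (0 < rnorm u) = (u != 0).
Proof. by rewrite lt_def rnorm_eq0 rnorm_ge0 andbT. Qed.

Lemma rnorm_le u (x : R) : (rnorm u <= x) = (`|u| <= x%:C).
Proof. by rewrite rnormE lecR. Qed.

Lemma rnormD u v : rnorm (u + v) <= rnorm u + rnorm v.
Proof. by rewrite rnorm_le rmorphD /= -!rnormE ler_normD. Qed.

Lemma rnormN u : rnorm (- u) = rnorm u.
Proof. by rewrite /rnorm normrN. Qed.

Lemma rnormB u v : rnorm (u - v) <= rnorm u + rnorm v.
Proof. by rewrite -(rnormN v) rnormD. Qed.

Lemma rnorm_distC u v : rnorm (u - v) = rnorm (v - u).
Proof. by rewrite -rnormN opprB. Qed.

Lemma rnormZ a u : rnorm (a *: u) = cmod a * rnorm u.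
Proof.
by apply: (@complexI R); rewrite rmorphM /= -!rnormE -cmodE normrZ.
Qed.

Lemma rnorm_sum (I : Type) (r : seq I) (P : pred I) (F : I -> H) :
  rnorm (\sum_(i <- r | P i) F i) <= \sum_(i <- r | P i) rnorm (F i).
Proof.
elim/big_rec2: _ => [|i x z _ h]; first by rewrite rnorm0.
by apply: le_trans (rnormD _ _) _; rewrite lerD2l.
Qed.

Context {dot : {dot H for @Num.conj C}}.

Lemma dot_conj u v : dot u v = Num.conj (dot v u).
Proof. by rewrite (hermC dot) expr0 mul1r. Qed.

Lemma dotDl u v w : dot (u + v) w = dot u w + dot v w.
Proof. exact: linearDl. Qed.

Lemma dotDr u v w : dot u (v + w) = dot u v + dot u w.
Proof. exact: linearDr. Qed.

Lemma dotZl a u v : dot (a *: u) v = a * dot u v.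
Proof. exact: linearZl_LR. Qed.

Lemma dotZr a u v : dot u (a *: v) = Num.conj a * dot u v.
Proof. exact: linearZr_LR. Qed.

Lemma dot0l u : dot 0 u = 0.
Proof. exact: linear0l. Qed.

Lemma dot0r u : dot u 0 = 0.
Proof. exact: linear0r. Qed.

Lemma dotNl u v : dot (- u) v = - dot u v.
Proof. exact: linearNl. Qed.

Lemma dotNr u v : dot u (- v) = - dot u v.
Proof. exact: linearNr. Qed.

Lemma dotBl u v w : dot (u - v) w = dot u w - dot v w.
Proof. by rewrite dotDl dotNl. Qed.

Lemma dotBr u v w : dot u (v - w) = dot u v - dot u w.
Proof. by rewrite dotDr dotNr. Qed.

Lemma dot_suml (I : Type) (r : seq I) (P : pred I) (F : I -> H) v :
  dot (\sum_(i <- r | P i) F i) v = \sum_(i <- r | P i) dot (F i) v.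
Proof. by elim/big_rec2: _ => [|i x z _ <-]; rewrite ?dot0l ?dotDl. Qed.

Lemma dot_sumr (I : Type) (r : seq I) (P : pred I) (F : I -> H) v :
  dot v (\sum_(i <- r | P i) F i) = \sum_(i <- r | P i) dot v (F i).
Proof. by elim/big_rec2: _ => [|i x z _ <-]; rewrite ?dot0r ?dotDr. Qed.

Hypothesis dot_norm : forall u : H, dot u u = `|u| ^+ 2.

Lemma rnorm2 u : ((rnorm u) ^+ 2)%:C = dot u u.
Proof. by rewrite dot_norm rnormE rmorphXn. Qed.

Lemma rnorm2D u v :
  rnorm (u + v) ^+ 2 = rnorm u ^+ 2 + rnorm v ^+ 2 + 2 * complex.Re (dot u v).
Proof.
have e : (2 * complex.Re (dot u v))%:C = dot u v + dot v u.
  by rewrite rmorphM rmorph_nat (dot_conj v u) -addcJ.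
apply: (@complexI R); rewrite rnorm2 !rmorphD [in RHS]/= e !rnorm2 dotDl !dotDr.
by rewrite -!addrA; congr (_ + _); rewrite addrA addrC.
Qed.

Lemma rnorm2D_orth u v : dot u v = 0 ->
  rnorm (u + v) ^+ 2 = rnorm u ^+ 2 + rnorm v ^+ 2.
Proof. by move=> uv; rewrite rnorm2D uv mulr0 addr0. Qed.

Lemma rnorm2_sum_orth (I : finType) (F : I -> H) :
  (forall i j, i != j -> dot (F i) (F j) = 0) ->
  rnorm (\sum_i F i) ^+ 2 = \sum_i rnorm (F i) ^+ 2.
Proof.
move=> orth; apply: (@complexI R); rewrite rnorm2 rmorph_sum /= dot_suml.
apply: eq_bigr => i _; rewrite dot_sumr (bigD1 i) //= big1 ?addr0 ?rnorm2 //.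
by move=> j ji; rewrite orth // eq_sym.
Qed.

Lemma dot_le u v : cmod (dot u v) <= rnorm u * rnorm v.
Proof.
have [->|v0] := eqVneq v 0; first by rewrite dot0r cmod0 rnorm0 mulr0.
have nv : 0 < rnorm v by rewrite rnorm_gt0.
have vv : dot v v != 0.
  by rewrite -rnorm2 -(rmorph0 (real_complex R)) (inj_eq (@complexI R)) gt_eqF ?exprn_gt0.
(* [a *: v] is the projection of [u] on the line of [v]; by Pythagoras its norm,
   [cmod (dot u v) / rnorm v], is at most that of [u]. *)
set a := dot u v / dot v v.
have h : rnorm u ^+ 2 = rnorm (u - a *: v) ^+ 2 + rnorm (a *: v) ^+ 2.
  rewrite -rnorm2D_orth ?subrK // dotZr dotBl dotZl divfK // subrr mulr0 //.
rewrite -(@ler_pXn2r _ 2) ?nnegrE ?cmod_ge0 ?mulr_ge0 ?rnorm_ge0 //.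
rewrite exprMn h mulrDl -(exprMn 2 (rnorm (a *: v))) rnormZ.
have -> : cmod a * rnorm v * rnorm v = cmod (dot u v).
  have nvv : rnorm v * rnorm v = cmod (dot v v).
    by rewrite -rnorm2 cmod_real ger0_norm ?sqr_ge0.
  by rewrite -mulrA nvv -cmodM divfK.
by rewrite lerDr mulr_ge0 ?sqr_ge0.
Qed.

End InnerProduct.

Section BoundedOperators.
Context {R : realType} {H : completeNormedModType R[i]}.
Implicit Types (S T K : H -> H) (u v : H).

Section Linearity.
Variable T : H -> H.
Hypothesis bT : bounded_op T.

Lemma bopD u v : T (u + v) = T u + T v.
Proof. by case: bT => lT _; rewrite -{1}(scale1r u) lT scale1r. Qed.

Lemma bop0 : T 0 = 0.
Proof. by have := bopD 0 0; rewrite addr0 -{1}(addr0 (T 0)) => /addrI. Qed.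

Lemma bopZ (a : R[i]) u : T (a *: u) = a *: T u.
Proof. by rewrite -{1}(addr0 (a *: u)); case: bT => lT _; rewrite lT bop0 addr0. Qed.

Lemma bopN u : T (- u) = - T u.
Proof. by rewrite -scaleN1r bopZ scaleN1r. Qed.

Lemma bopB u v : T (u - v) = T u - T v.
Proof. by rewrite bopD bopN. Qed.

Lemma bop_sum (I : Type) (r : seq I) (P : pred I) (F : I -> H) :
  T (\sum_(i <- r | P i) F i) = \sum_(i <- r | P i) T (F i).
Proof. by elim/big_rec2: _ => [|i x z _ <-]; rewrite ?bop0 ?bopD. Qed.

End Linearity.

Lemma bounded_opP T (M : R) : linear T ->
  (forall u, rnorm (T u) <= M * rnorm u) -> bounded_op T.
Proof. by split=> //; exists M. Qed.

Lemma opnorm_ge0 T : 0 <= opnorm T.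
Proof.
have [[M M_bound]|/nonemptyPn no_bound] :=
    pselect ([set M : R | 0 <= M /\ forall u, rnorm (T u) <= M * rnorm u] !=set0).
  by apply: lb_le_inf => [|N []//]; exists M.
by rewrite /opnorm no_bound inf0.
Qed.

Lemma opnorm_le T (M : R) : 0 <= M ->
  (forall u, rnorm (T u) <= M * rnorm u) -> opnorm T <= M.
Proof. by move=> M0 hM; apply: ge_inf => //; exists 0 => N []. Qed.

Lemma opnormP T u : bounded_op T -> rnorm (T u) <= opnorm T * rnorm u.
Proof.
case=> _ [M hM].
have [->|u0] := eqVneq u 0.
  by apply: le_trans (hM 0) _; rewrite rnorm0 !mulr0.
have nu : 0 < rnorm u by rewrite rnorm_gt0.
rewrite -ler_pdivrMr //; apply: lb_le_inf.
  exists (Num.max 0 M); split; first by rewrite le_max lexx.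
  move=> v; apply: le_trans (hM v) _.
  by rewrite ler_wpM2r ?rnorm_ge0 // le_max lexx orbT.
by move=> N [_ hN]; rewrite ler_pdivrMr.
Qed.

Lemma opnorm_near_max T (m : R) : 0 <= m -> m < opnorm T ->
  exists u, m * rnorm u < rnorm (T u).
Proof.
move=> m0 mT; apply: contrapT => no_u; have := mT; rewrite ltNge => /negP; apply.
apply: opnorm_le => // u; rewrite leNgt; apply/negP => hu; apply: no_u.
by exists u.
Qed.

Lemma bounded_op0 : bounded_op (fun=> 0 : H).
Proof.
apply: (@bounded_opP _ 0) => [a u v|u]; first by rewrite scaler0 addr0.
by rewrite rnorm0 mul0r.
Qed.

Lemma bounded_op_id : bounded_op (fun u : H => u).
Proof. by apply: (@bounded_opP _ 1) => // u; rewrite mul1r. Qed.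

Lemma bounded_opD S T : bounded_op S -> bounded_op T ->
  bounded_op (fun u => S u + T u).
Proof.
move=> bS bT; apply: (@bounded_opP _ (opnorm S + opnorm T)) => [a u v|u].
  by rewrite (bopD bS) (bopD bT) (bopZ bS) (bopZ bT) scalerDr addrACA.
by apply: le_trans (rnormD _ _) _; rewrite mulrDl lerD ?opnormP.
Qed.

Lemma bounded_opZ (a : R[i]) T : bounded_op T -> bounded_op (fun u => a *: T u).
Proof.
move=> bT; apply: (@bounded_opP _ (cmod a * opnorm T)) => [b u v|u].
  by rewrite (bopD bT) (bopZ bT) scalerDr !scalerA mulrC.
by rewrite rnormZ -mulrA ler_wpM2l ?cmod_ge0 ?opnormP.
Qed.

Lemma bounded_opB S T : bounded_op S -> bounded_op T ->
  bounded_op (fun u => S u - T u).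
Proof.
move=> bS bT; have := bounded_opD bS (bounded_opZ (-1) bT).
by under eq_fun do rewrite scaleN1r.
Qed.

Lemma bounded_op_comp S T : bounded_op S -> bounded_op T ->
  bounded_op (fun u => S (T u)).
Proof.
move=> bS bT; apply: (@bounded_opP _ (opnorm S * opnorm T)) => [a u v|u].
  by rewrite !bopD // !bopZ.
apply: le_trans (opnormP _ bS) _.
by rewrite -mulrA ler_wpM2l ?opnorm_ge0 ?opnormP.
Qed.

Lemma bounded_op_sum (I : Type) (r : seq I) (P : pred I) (F : I -> H -> H) :
  (forall i, P i -> bounded_op (F i)) ->
  bounded_op (fun u => \sum_(i <- r | P i) F i u).
Proof.
move=> bF; elim: r => [|i r IH].
  by under eq_fun do rewrite big_nil; exact: bounded_op0.
under eq_fun do rewrite big_cons.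
by have [Pi|//] := boolP (P i); apply: bounded_opD => //; exact: bF.
Qed.

End BoundedOperators.

Section Orthonormal.
Context {R : realType} {H : completeNormedModType R[i]}.
Variable dot : {dot H for @Num.conj R[i]}.
Hypothesis dot_norm : forall u : H, dot u u = `|u| ^+ 2.
Local Notation C := R[i].
Implicit Types (e f : nat -> H) (x y : H) (n : nat).

(** Families are functions on [nat] of which only the first [n] values count, so prefixes and
    extensions need no cast between ordinal types. *)
Definition orthonormal_fam n e := forall i j, (i < n)%N -> (j < n)%N ->
  dot (e i) (e j) = (i == j)%:R.

Definition orth_proj n e x := \sum_(i < n) dot x (e i) *: e i.

Lemma bounded_op_rank1 (e f : H) : bounded_op (fun x => dot x e *: f).
Proof.
apply: (@bounded_opP _ _ _ (rnorm e * rnorm f)) => [a u v|u].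
  by rewrite dotDl dotZl scalerDl scalerA.
rewrite rnormZ mulrAC ler_wpM2r ?rnorm_ge0 // mulrC.
exact: dot_le.
Qed.

Lemma bounded_orth_proj n e : bounded_op (orth_proj n e).
Proof.
by rewrite /orth_proj; apply: bounded_op_sum => i _; exact: bounded_op_rank1.
Qed.

Lemma orthonormal_famS n e : orthonormal_fam n.+1 e -> orthonormal_fam n e.
Proof. by move=> h i j ni nj; apply: h; exact: ltnW. Qed.

Lemma orth_proj_rec n e x :
  orth_proj n.+1 e x = orth_proj n e x + dot x (e n) *: e n.
Proof. by rewrite /orth_proj big_ord_recr. Qed.

Section Family.
Variables (n : nat) (e : nat -> H).
Hypothesis one : orthonormal_fam n e.

Lemma dot_comb (c : nat -> C) j : (j < n)%N ->
  dot (\sum_(i < n) c i *: e i) (e j) = c j.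
Proof.
move=> nj; rewrite dot_suml (bigD1 (Ordinal nj)) //= dotZl one // eqxx mulr1.
rewrite big1 ?addr0 // => i ij; rewrite dotZl one //.
by rewrite -(inj_eq val_inj) /= in ij; rewrite (negPf ij) mulr0.
Qed.

Lemma rnorm2_comb (c : nat -> C) :
  rnorm (\sum_(i < n) c i *: e i) ^+ 2 = \sum_(i < n) cmod (c i) ^+ 2.
Proof.
rewrite (rnorm2_sum_orth dot_norm) => [|i j ij].
  apply: eq_bigr => i _; rewrite rnormZ exprMn.
  suff -> : rnorm (e i) ^+ 2 = 1 by rewrite mulr1.
  by apply: (@complexI R); rewrite (rnorm2 dot_norm) one // eqxx.
rewrite dotZl dotZr one //.
by rewrite -(inj_eq val_inj) /= in ij; rewrite (negPf ij) !mulr0.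
Qed.

Lemma rnorm_fam i : (i < n)%N -> rnorm (e i) = 1.
Proof.
move=> ni; apply/eqP; rewrite -(@eqrXn2 _ 2) ?rnorm_ge0 // expr1n; apply/eqP.
by apply: (@complexI R); rewrite (rnorm2 dot_norm) one // eqxx.
Qed.

Lemma rnorm2_orth_proj x :
  rnorm (orth_proj n e x) ^+ 2 = \sum_(i < n) cmod (dot x (e i)) ^+ 2.
Proof. exact: (rnorm2_comb (fun i => dot x (e i))). Qed.

Lemma dot_orth_proj x j : (j < n)%N -> dot (orth_proj n e x) (e j) = dot x (e j).
Proof. exact: (dot_comb (fun i => dot x (e i))). Qed.

Lemma dot_sub_orth_proj x j : (j < n)%N -> dot (x - orth_proj n e x) (e j) = 0.
Proof. by move=> nj; rewrite dotBl dot_orth_proj ?subrr. Qed.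

Lemma orth_proj_pythagoras x :
  rnorm x ^+ 2 = rnorm (orth_proj n e x) ^+ 2 + rnorm (x - orth_proj n e x) ^+ 2.
Proof.
rewrite -(rnorm2D_orth dot_norm) ?(addrC (orth_proj n e x)) ?subrK //.
rewrite dot_conj {2}/orth_proj dot_sumr big1 ?rmorph0 // => i _.
by rewrite dotZr dot_sub_orth_proj ?mulr0.
Qed.

Lemma bessel x : \sum_(i < n) cmod (dot x (e i)) ^+ 2 <= rnorm x ^+ 2.
Proof. by rewrite -rnorm2_orth_proj (orth_proj_pythagoras x) lerDl sqr_ge0. Qed.

Lemma rnorm_orth_proj x : rnorm (orth_proj n e x) <= rnorm x.
Proof.
rewrite -(@ler_pXn2r _ 2) ?nnegrE ?rnorm_ge0 // (orth_proj_pythagoras x).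
by rewrite lerDl sqr_ge0.
Qed.

Lemma rnorm2_sub_orth_proj x :
  rnorm (x - orth_proj n e x) ^+ 2 =
  rnorm x ^+ 2 - \sum_(i < n) cmod (dot x (e i)) ^+ 2.
Proof. by rewrite (orth_proj_pythagoras x) rnorm2_orth_proj addrAC subrr add0r. Qed.

Lemma rnorm_sub_orth_proj x : rnorm (x - orth_proj n e x) <= rnorm x.
Proof.
rewrite -(@ler_pXn2r _ 2) ?nnegrE ?rnorm_ge0 // (orth_proj_pythagoras x).
by rewrite lerDr sqr_ge0.
Qed.

Definition extend y := fun i => if i == n then y else e i.

Lemma extend_lt y i : (i < n)%N -> extend y i = e i.
Proof. by move=> ni; rewrite /extend ltn_eqF. Qed.

Lemma extend_last y : extend y n = y.
Proof. by rewrite /extend eqxx. Qed.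

Lemma orth_proj_extend y j x : (j <= n)%N ->
  orth_proj j (extend y) x = orth_proj j e x.
Proof.
by move=> jn; apply: eq_bigr => i _; rewrite extend_lt // (leq_trans (ltn_ord i)).
Qed.

Lemma orthonormal_extend y : rnorm y = 1 ->
  (forall i, (i < n)%N -> dot y (e i) = 0) -> orthonormal_fam n.+1 (extend y).
Proof.
move=> y1 yo i j; rewrite !ltnS /extend => ni nj.
have yy : dot y y = 1 by rewrite -(rnorm2 dot_norm) y1 expr1n.
have [ein|in_] := eqVneq i n; have [ejn|jn] := eqVneq j n; rewrite ?ein ?ejn.
- by rewrite yy eqxx.
- by rewrite yo ?(eq_sym n) ?(negPf jn) // ltn_neqAle jn.
- by rewrite dot_conj yo ?(negPf in_) ?rmorph0 // ltn_neqAle in_.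
- by apply: one; rewrite ltn_neqAle ?in_ ?jn.
Qed.

End Family.

(** Membership in the span is expressed by [orth_proj n e x = x], the form in which it is used: to
    expand vectors in coordinates, and to compress operators without changing a given partial
    sum. *)
Lemma gram_schmidt (s : seq H) : exists n e, orthonormal_fam n e /\
  forall x, x \in s -> orth_proj n e x = x.
Proof.
elim: s => [|y s [n [e [one he]]]]; first by exists 0%N, (fun=> 0); split.
set w := y - orth_proj n e y.
have [w0|w0] := eqVneq w 0.
  exists n, e; split=> // x; rewrite inE => /orP[/eqP ->|/he //].
  by apply/esym/eqP; rewrite -subr_eq0; apply/eqP.
have nw : 0 < rnorm w by rewrite rnorm_gt0.
set z := ((rnorm w)^-1)%:C *: w.
have z1 : rnorm z = 1.
  by rewrite rnormZ cmod_real ger0_norm ?invr_ge0 ?ltW // mulVf ?gt_eqF.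
have zo i : (i < n)%N -> dot z (e i) = 0.
  by move=> ni; rewrite dotZl dot_sub_orth_proj ?mulr0.
exists n.+1, (extend n e z); split; first exact: orthonormal_extend.
move=> x; rewrite inE orth_proj_rec orth_proj_extend // extend_last => /orP[/eqP ->|xs].
  (* [y] and [w] differ by a combination of the [e i], all orthogonal to [z], and [w] is a multiple
     of the unit vector [z]; so the new term is exactly the missing part of [y]. *)
  have dyz : dot y z *: z = w.
    have -> : dot y z = dot w z.
      apply/esym; rewrite dotBl [X in _ - X]dot_conj /orth_proj dot_sumr big1 ?rmorph0 ?subr0 //.
      by move=> i _; rewrite dotZr zo ?mulr0.
    rewrite /z dotZr -(rnorm2 dot_norm) conj_real -rmorphM scalerA -rmorphM /=.
    rewrite (_ : _ * _ * _ = 1) ?scale1r //.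
    by field; rewrite gt_eqF.
  by rewrite dyz /w addrC subrK.
rewrite he // (_ : dot x z = 0) ?scale0r ?addr0 //.
rewrite -(he x xs) dot_conj /orth_proj dot_sumr big1 ?rmorph0 // => i _.
by rewrite dotZr zo ?mulr0.
Qed.

End Orthonormal.

(** * Singular values *)

Section SingularValues.
Context {R : realType} {H : completeNormedModType R[i]}.
Variable dot : {dot H for @Num.conj R[i]}.
Hypothesis dot_norm : forall u : H, dot u u = `|u| ^+ 2.
Local Notation C := R[i].
Implicit Types (e f : nat -> H) (x y : H) (n : nat).

(** Dimension count: the coordinates of the images of [n.+1] vectors in a spanning family of size
    [n] form a matrix with a nonzero left kernel row, which is then normalized. Thus a competitor
    [K] in [singular_value T n] kills some unit vector of the span of [n.+1] orthonormal vectors. *)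
Lemma rank_le_kernel n (K : H -> H) (e : nat -> H) :
  bounded_op K -> rank_le n K ->
  exists c : nat -> C, \sum_(i < n.+1) cmod (c i) ^+ 2 = 1 /\
    K (\sum_(i < n.+1) c i *: e i) = 0.
Proof.
move=> bK [v Kv].
have [a ha] := choice (fun i : 'I_n.+1 => Kv (e i)).
pose A : 'M[C]_(n.+1, n) := \matrix_(i, j) a i j.
have kerA : kermx A != 0.
  by rewrite -mxrank_eq0 mxrank_ker -lt0n subn_gt0 ltnS rank_leq_col.
pose d := nz_row (kermx A).
have d0 : d != 0 by rewrite nz_row_eq0.
have dA : d *m A = 0 by apply/sub_kermxP; exact: nz_row_sub.
have [k dk] : exists k, d 0 k != 0.
  apply: contrapT => no_k; move/eqP: d0; apply; apply/rowP => k; rewrite mxE.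
  by apply/eqP/negPn/negP => dk; apply: no_k; exists k.
set S := \sum_(i < n.+1) cmod (d 0 i) ^+ 2.
have S0 : 0 < S.
  rewrite /S (bigD1 k) //= ltr_pwDl ?sumr_ge0 // => [|i _]; last exact: sqr_ge0.
  by rewrite exprn_gt0 // lt_def cmod_eq0 dk cmod_ge0.
pose r := (Num.sqrt S)^-1.
have r0 : 0 <= r by rewrite invr_ge0 sqrtr_ge0.
exists (fun i => r%:C * d 0 (inord i)); split.
  under eq_bigr do rewrite inord_val cmodM exprMn cmod_real (ger0_norm r0).
  by rewrite -mulr_sumr -/S exprVn sqr_sqrtr ?ltW // mulVf // gt_eqF.
rewrite (bop_sum bK) (eq_bigr (fun i : 'I_n.+1 =>
    \sum_(j < n) (r%:C * (d 0 i * A i j)) *: v j)) => [|i _]; last first.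
  rewrite inord_val (bopZ bK) ha scaler_sumr; apply: eq_bigr => j _.
  by rewrite scalerA !mxE mulrA.
rewrite exchange_big /= big1 // => j _.
rewrite -scaler_suml -mulr_sumr (_ : \sum_(i < n.+1) _ = 0) ?mulr0 ?scale0r //.
by have := congr1 (fun M : 'rV_n => M 0 j) dA; rewrite !mxE.
Qed.

Lemma singular_value_le n (T K : H -> H) : bounded_op K -> rank_le n K ->
  singular_value T n <= opnorm (fun u => T u - K u).
Proof.
move=> bK rK; apply: ge_inf; last by exists K.
by exists 0 => _ [L _ <-]; exact: opnorm_ge0.
Qed.

Lemma rank_le0 n : rank_le n (fun=> 0 : H).
Proof.
exists (fun=> 0) => u; exists (fun=> 0).
by rewrite big1 // => i _; rewrite scale0r.
Qed.

Lemma le_singular_value n (T : H -> H) (t : R) :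
  (forall K, bounded_op K -> rank_le n K -> t <= opnorm (fun u => T u - K u)) ->
  t <= singular_value T n.
Proof.
move=> ht; apply: lb_le_inf; last by move=> _ [K [bK rK] <-]; exact: ht.
exists (opnorm (fun u => T u - 0)), (fun=> 0) => //.
by split; [exact: bounded_op0|exact: rank_le0].
Qed.

Lemma singular_value_ge0 n (T : H -> H) : 0 <= singular_value T n.
Proof. by apply: le_singular_value => K _ _; exact: opnorm_ge0. Qed.

(** A competitor of rank at most [m] becomes one of rank at most [n] by padding its spanning family
    with zeros. *)
Lemma singular_value_nonincreasing (T : H -> H) m n : (m <= n)%N ->
  singular_value T n <= singular_value T m.
Proof.
move=> mn; apply: le_singular_value => K bK [v hv].
apply: singular_value_le => //.
exists (fun i : 'I_n => if insub (val i) is Some j then v j else 0) => u.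
have [c ->] := hv u.
exists (fun i : 'I_n => if insub (val i) is Some j then c j else 0).
rewrite (eq_bigr (fun i : 'I_m =>
    let F k := if insub k is Some j then c j *: v j else 0 in F (val i))); last first.
  by move=> i _ /=; rewrite valK.
rewrite (big_ord_widen _ (fun k => if insub k is Some j then c j *: v j else 0) mn) big_mkcond /=.
apply: eq_bigr => i _; case: insubP => [j -> _ //|/negPf ->].
by rewrite scaler0.
Qed.

(** What [n] greedy steps leave of [T]. The subtracted part has rank at most [n], so the norm of
    this remainder bounds [singular_value T n] from above. *)
Definition compl (T : H -> H) f n x := T x - orth_proj dot n f (T x).

Section Greedy.
Variable T : H -> H.
Hypothesis bT : bounded_op T.

Lemma bounded_compl f n : bounded_op (compl T f n).
Proof.
apply: bounded_opB => //; apply: (@bounded_op_comp _ _ (orth_proj dot n f)) => //.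
exact: bounded_orth_proj.
Qed.

Lemma singular_value_compl f n : singular_value T n <= opnorm (compl T f n).
Proof.
apply: (@singular_value_le n T (fun u => orth_proj dot n f (T u))).
  by apply: bounded_op_comp => //; exact: bounded_orth_proj.
by exists (fun i => f i) => u; exists (fun i => dot (T u) (f i)).
Qed.

Lemma rnorm_compl f m n x : orthonormal_fam dot n f -> (m <= n)%N ->
  rnorm (compl T f n x) <= rnorm (compl T f m x).
Proof.
move=> onf mn.
have onm : orthonormal_fam dot m f.
  by move=> i j im jm; rewrite onf // (leq_trans _ mn).
rewrite -(@ler_pXn2r _ 2) ?nnegrE ?rnorm_ge0 // !rnorm2_sub_orth_proj //.
rewrite lerD2l lerN2 (big_ord_widen _ (fun i => cmod (dot (T x) (f i)) ^+ 2) mn).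
rewrite big_mkcond /=; apply: ler_sum => i _.
by case: ifP => // _; exact: sqr_ge0.
Qed.

Lemma opnorm_compl f m n : orthonormal_fam dot n f -> (m <= n)%N ->
  opnorm (compl T f n) <= opnorm (compl T f m).
Proof.
move=> onf mn; apply: opnorm_le => [|x]; first exact: opnorm_ge0.
by apply: le_trans (opnormP _ (bounded_compl f m)); exact: rnorm_compl.
Qed.

(* A functional that almost attains its norm [t] at [e] is almost a multiple of
   [dot ^~ e]: test the bound at [tau |y|^2 e + conj(beta) y], [y] orthogonal to
   [e], [beta] the value at [y]. *)
Lemma near_max_functional (S : H -> H) (t tau : R) (e f : H) :
  bounded_op S -> (forall x, rnorm (S x) <= t * rnorm x) ->
  rnorm e = 1 -> rnorm f = 1 -> dot (S e) f = tau%:C ->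
  forall x, cmod (dot (S x) f - tau%:C * dot x e) ^+ 2 <=
    (t ^+ 2 - tau ^+ 2) * rnorm x ^+ 2.
Proof.
move=> bS St e1 f1 Se x.
have ee : dot e e = 1 by rewrite -(rnorm2 dot_norm) e1 expr1n.
have Sf z : cmod (dot (S z) f) <= t * rnorm z.
  by apply: le_trans (dot_le dot_norm _ _) _; rewrite f1 mulr1.
have t0 : 0 <= t by have := St e; rewrite e1 mulr1; exact/le_trans/rnorm_ge0.
have taut : tau ^+ 2 <= t ^+ 2.
  rewrite -(real_normK (num_real tau)) ler_pXn2r ?nnegrE //.
  by have := Sf e; rewrite Se cmod_real e1 mulr1.
set y := x - dot x e *: e.
have ye : dot y e = 0 by rewrite dotBl dotZl ee mulr1 subrr.
have yx : rnorm y ^+ 2 <= rnorm x ^+ 2.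
  have -> : x = y + dot x e *: e by rewrite subrK.
  by rewrite (rnorm2D_orth dot_norm) ?lerDl ?sqr_ge0 // dotZr ye mulr0.
set beta := dot (S x) f - _.
have Sy : dot (S y) f = beta by rewrite (bopB bS) (bopZ bS) dotBl dotZl Se mulrC.
apply: le_trans (ler_wpM2l _ yx); last by rewrite subr_ge0.
pose z := (tau * rnorm y ^+ 2)%:C *: e + Num.conj beta *: y.
set G := tau ^+ 2 * rnorm y ^+ 2 + cmod beta ^+ 2.
have Sz : dot (S z) f = G%:C.
  rewrite (bopD bS) !(bopZ bS) dotDl !dotZl Se Sy /G (rmorphD (real_complex R)) /= cmod2.
  by rewrite -rmorphM /= (mulrC _ beta) mulrAC -expr2.
have Ga : 0 <= tau ^+ 2 * rnorm y ^+ 2 by apply: mulr_ge0; exact: sqr_ge0.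
have Gb : 0 <= cmod beta ^+ 2 by exact: sqr_ge0.
have G0 : 0 <= G by exact: addr_ge0.
have nz : rnorm z ^+ 2 = rnorm y ^+ 2 * G.
  rewrite (rnorm2D_orth dot_norm); last first.
    by rewrite dotZl dotZr dot_conj ye rmorph0 !mulr0.
  rewrite !rnormZ cmod_real cmod_conj e1 mulr1 real_normK ?num_real // /G.
  ring.
have hG : G ^+ 2 <= t ^+ 2 * rnorm y ^+ 2 * G.
  rewrite -mulrA -nz -exprMn ler_pXn2r ?nnegrE ?mulr_ge0 ?rnorm_ge0 //.
  by have := Sf z; rewrite Sz cmod_real ger0_norm.
have [Gz|Gn] := eqVneq G 0.
  have -> : cmod beta ^+ 2 = 0.
    by move: Gz; rewrite /G; lra.
  by apply: mulr_ge0; rewrite ?sqr_ge0 ?subr_ge0.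
have Gp : 0 < G by rewrite lt_def Gn.
have : G <= t ^+ 2 * rnorm y ^+ 2 by rewrite -(ler_pM2r Gp) -expr2.
by rewrite /G mulrBl lerBrDl.
Qed.

(* [e] and [f] are chosen one after the other, [e n] almost maximizing [compl T f n]
   and [f n] being the direction of its image; this makes [compl T f n] vanish on
   the previous [e j], which can therefore be projected out of its near maximizer. *)
Record greedy (eta : R) n e f (tau : nat -> R) : Prop := Greedy {
  greedy_orthoe : orthonormal_fam dot n e ;
  greedy_orthof : orthonormal_fam dot n f ;
  greedy_ker : forall j, (j < n)%N -> compl T f j.+1 (e j) = 0 ;
  greedy_diag : forall j, (j < n)%N -> dot (T (e j)) (f j) = (tau j)%:C ;
  greedy_ge0 : forall j, (j < n)%N -> 0 <= tau j ;
  greedy_lb : forall j, (j < n)%N -> opnorm (compl T f j) - eta <= tau j ;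
  greedy_ub : forall j, (j < n)%N -> tau j <= opnorm (compl T f j) ;
  greedy_row : forall j, (j < n)%N -> forall x,
    cmod (dot (T x) (f j) - (tau j)%:C * dot x (e j)) <= eta * rnorm x }.

Lemma greedy_step (eta : R) n e f tau : 0 < eta -> greedy eta n e f tau ->
  0 < opnorm (compl T f n) ->
  exists y z t, greedy eta n.+1 (extend n e y) (extend n f z)
    (fun i => if i == n then t else tau i).
Proof.
move=> eta0 [one onf ker0 diag tau0 lb ub row].
have ker j : (j < n)%N -> compl T f n (e j) = 0.
  move=> jn; apply/eqP; rewrite -rnorm_eq0 eq_le rnorm_ge0 andbT.
  by apply: le_trans (rnorm_compl _ onf jn) _; rewrite ker0 // rnorm0.
set S := compl T f n; set t := opnorm S => t0.
have bS : bounded_op S := bounded_compl f n.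
(* The new diagonal entry [tt] exceeds [t - delta], so [t ^+ 2 - tt ^+ 2 <= 2 * t * delta <= eta ^+
   2], which is the error allowed by [near_max_functional]; [delta <= eta] serves [greedy_lb]. *)
pose delta := Num.min eta (eta ^+ 2 / (2 * t)).
have delta0 : 0 < delta by rewrite lt_min eta0 divr_gt0 ?exprn_gt0 // mulr_gt0.
have delta_eta : delta <= eta by rewrite ge_min lexx.
have delta_t : 2 * t * delta <= eta ^+ 2.
  by rewrite mulrC -ler_pdivlMr ?mulr_gt0 // ge_min lexx orbT.
pose m := Num.max 0 (t - delta).
have m0 : 0 <= m by rewrite le_max lexx.
have mt : m < t by rewrite gt_max t0 gtrBl.
have mtd : t - delta <= m by rewrite le_max lexx orbT.
have [x hx] := opnorm_near_max m0 mt.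
pose y0 := x - orth_proj dot n e x.
have Sy0 : S y0 = S x.
  rewrite (bopB bS) /orth_proj (bop_sum bS) big1 ?subr0 // => i _.
  by rewrite (bopZ bS) /S ker ?scaler0.
have hy0 : m * rnorm y0 < rnorm (S y0).
  rewrite Sy0; apply: le_lt_trans hx; rewrite ler_wpM2l //.
  exact: rnorm_sub_orth_proj.
have ny0 : 0 < rnorm y0.
  rewrite rnorm_gt0; apply/eqP => y00.
  by move: hy0; rewrite y00 (bop0 bS) rnorm0 mulr0 ltxx.
pose y := ((rnorm y0)^-1)%:C *: y0.
have y1 : rnorm y = 1.
  by rewrite rnormZ cmod_real ger0_norm ?invr_ge0 ?ltW // mulVf ?gt_eqF.
have ye i : (i < n)%N -> dot y (e i) = 0.
  by move=> ni; rewrite dotZl dot_sub_orth_proj ?mulr0.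
set w := S y; set tt := rnorm w.
have mtt : m < tt.
  rewrite /tt /w (bopZ bS) rnormZ cmod_real ger0_norm ?invr_ge0 ?ltW //.
  by rewrite mulrC ltr_pdivlMr.
have tt0 : 0 < tt by exact: le_lt_trans mtt.
have ttt : tt <= t by have := opnormP y bS; rewrite y1 mulr1.
pose z := (tt^-1)%:C *: w.
have z1 : rnorm z = 1.
  by rewrite rnormZ cmod_real ger0_norm ?invr_ge0 ?ltW // mulVf ?gt_eqF.
have zf i : (i < n)%N -> dot z (f i) = 0.
  by move=> ni; rewrite dotZl dot_sub_orth_proj ?mulr0.
have ttz : tt%:C *: z = w.
  by rewrite scalerA -rmorphM mulfV ?gt_eqF // scale1r.
(* The projection removed from [T] has range in the span of the previous [f i], to which [z] is
   orthogonal. *)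
have Tz u : dot (T u) z = dot (S u) z.
  rewrite /S /compl dotBl [X in _ - X]dot_conj /orth_proj dot_sumr big1 ?rmorph0 ?subr0 //.
  by move=> i _; rewrite dotZr zf ?mulr0.
have wz : dot w z = tt%:C.
  by rewrite -ttz dotZl -(rnorm2 dot_norm) z1 expr1n mulr1.
have split_ord j : (j < n.+1)%N -> (j < n)%N \/ j = n.
  by rewrite ltnS leq_eqVlt => /orP[/eqP|]; [right|left].
have compl_ext j u : (j <= n)%N -> compl T (extend n f z) j u = compl T f j u.
  by move=> jn; rewrite /compl orth_proj_extend.
have compl_extE j : (j <= n)%N -> compl T (extend n f z) j = compl T f j.
  by move=> jn; apply/funext => u; exact: compl_ext.
exists y, z, tt; split.
- exact: orthonormal_extend.
- exact: orthonormal_extend.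
- move=> j /split_ord[jn|->]; first by rewrite extend_lt // compl_extE ?ker0.
  (* The enlarged remainder sends [y] to [w] minus its component along [z], and [w] is a multiple of
     [z]. *)
  rewrite /compl orth_proj_rec orth_proj_extend // !extend_last Tz opprD addrA.
  by rewrite -/(compl T f n y) -/S -/w wz ttz subrr.
- move=> j /split_ord[jn|->]; last by rewrite eqxx !extend_last Tz.
  by rewrite !extend_lt // (ltn_eqF jn) diag.
- by move=> j /split_ord[jn|->]; rewrite ?eqxx ?(ltn_eqF jn) ?tau0 // ltW.
- move=> j /split_ord[jn|->]; last first.
    by rewrite eqxx compl_extE // -/S -/t; lra.
  by rewrite (ltn_eqF jn) compl_extE ?lb // ltnW.
- move=> j /split_ord[jn|->]; last by rewrite eqxx compl_extE.
  by rewrite (ltn_eqF jn) compl_extE ?ub // ltnW.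
- move=> j /split_ord[jn|->] u.
    by rewrite !extend_lt // (ltn_eqF jn) row.
  rewrite eqxx !extend_last Tz.
  rewrite -(@ler_pXn2r _ 2) ?nnegrE ?cmod_ge0 ?mulr_ge0 ?rnorm_ge0 ?(ltW eta0) //.
  apply: le_trans (near_max_functional bS _ y1 z1 wz u) _ => [v|]; first exact: opnormP.
  rewrite exprMn ler_wpM2r ?sqr_ge0 // -/t.
  by nra.
Qed.

Lemma greedy_widen (eta : R) m n e f tau : (m <= n)%N ->
  greedy eta n e f tau -> greedy eta m e f tau.
Proof.
move=> mn [one onf ker diag tau0 lb ub row].
have w j : (j < m)%N -> (j < n)%N by move=> /leq_trans; exact.
split=> [i j /w ni /w nj|i j /w ni /w nj|j /w jn|j /w jn|j /w jn|j /w jn|j /w jn|j /w jn x].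
- exact: one.
- exact: onf.
- exact: ker.
- exact: diag.
- exact: tau0.
- exact: lb.
- exact: ub.
- exact: row.
Qed.

(** The two sums differ along each unit vector [f i] by at most [eta * rnorm x] ([greedy_row]), and
    there are [n] of them. *)
Lemma greedy_sub (eta : R) n e f tau x : greedy eta n e f tau ->
  rnorm (orth_proj dot n f (T x) - \sum_(i < n) ((tau i)%:C * dot x (e i)) *: f i)
    <= n%:R * eta * rnorm x.
Proof.
move=> g; rewrite /orth_proj -sumrB; apply: le_trans (rnorm_sum _ _ _) _.
rewrite -mulrA mulr_natl -[X in _ <= _ *+ X]card_ord -sumr_const.
apply: ler_sum => i _; rewrite -scalerBl rnormZ (rnorm_fam dot_norm (greedy_orthof g)) //.
by rewrite mulr1 (greedy_row g).
Qed.

(** Min-max argument: a competitor [K] of rank [n] kills a unit vector [x] in the span of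
    [e 0, ..., e n]. There [T] is nearly diagonal, with entries at least
    [opnorm (compl T f n) - eta]. The off-diagonal error is [n.+1%:R * eta], whence [n.+2] in
    all. *)
Lemma greedy_singular_value (eta : R) n e f tau : 0 < eta ->
  greedy eta n.+1 e f tau ->
  opnorm (compl T f n) - n.+2%:R * eta <= singular_value T n.
Proof.
move=> eta0 g; set t := opnorm _.
(* Below [eta] the left-hand side is not positive; otherwise [t - eta] is nonnegative and the
   comparison of squares below is legitimate. *)
have [t_small|t_large] := ltP t eta.
  apply: le_trans (singular_value_ge0 n T); rewrite subr_le0.
  by apply: le_trans (ltW t_small) _; rewrite ler_peMl ?ler1n // ltW.
apply: le_singular_value => K bK rK.
have [c [c1 Kc]] := rank_le_kernel e bK rK.
set x := \sum_(i < n.+1) _ in Kc.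
have x1 : rnorm x = 1.
  apply/eqP; rewrite -(@eqrXn2 _ 2) ?rnorm_ge0 // expr1n.
  by rewrite (rnorm2_comb dot_norm (greedy_orthoe g)) c1.
have bTK : bounded_op (fun u => T u - K u) by exact: bounded_opB.
have := opnormP x bTK; rewrite x1 mulr1 Kc subr0; apply: le_trans.
apply: le_trans (rnorm_orth_proj dot_norm (greedy_orthof g) _).
have := greedy_sub x g; rewrite x1 mulr1; set y := \sum_(i < _) _ => hy.
suff ty : t - eta <= rnorm y.
  have := rnormB (orth_proj dot n.+1 f (T x)) (orth_proj dot n.+1 f (T x) - y).
  rewrite opprB addrC subrK -(natr1 n.+1) mulrDl mul1r => h.
  lra.
rewrite -(@ler_pXn2r _ 2) ?nnegrE ?rnorm_ge0 ?subr_ge0 //.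
rewrite (rnorm2_comb dot_norm (greedy_orthof g) (fun i => (tau i)%:C * dot x (e i))).
rewrite -[leLHS]mulr1 -c1 mulr_sumr; apply: ler_sum => i _.
rewrite (dot_comb (greedy_orthoe g)) // cmodM exprMn cmod_real.
rewrite ler_wpM2r ?sqr_ge0 // real_normK ?num_real //.
rewrite ler_pXn2r ?nnegrE ?subr_ge0 ?(greedy_ge0 g) //.
apply: le_trans (greedy_lb g (ltn_ord i)); rewrite lerD2r.
apply: opnorm_compl; last by rewrite -ltnS.
exact: orthonormal_famS (greedy_orthof g).
Qed.

(** Positive singular values keep the remainder nonzero, so the choice can go on for [n] steps.
    Estimating the remainder after [n] steps takes [n.+1] vectors: one more step is made and its
    vectors are then discarded, unless the remainder is already zero. *)
Lemma greedy_exists (eta : R) n : 0 < eta ->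
  (forall i, (i < n)%N -> 0 < singular_value T i) ->
  exists e f tau, greedy eta n e f tau /\
    opnorm (compl T f n) <= singular_value T n + n.+2%:R * eta.
Proof.
move=> eta0 sn.
have [e [f [tau g]]] : exists e f tau, greedy eta n e f tau.
  elim: n sn => [|n IH] sn; first by exists (fun=> 0), (fun=> 0), (fun=> 0).
  have [i ni|e [f [tau g]]] := IH; first by rewrite sn // ltnW.
  have := greedy_step eta0 g (lt_le_trans (sn n (ltnSn n)) (singular_value_compl f n)).
  by case=> y [z [t g']]; eexists _, _, _; exact: g'.
exists e, f, tau; split=> //.
have [t0|] := ltP 0 (opnorm (compl T f n)); last first.
  by move=> /le_trans; apply; rewrite addr_ge0 ?singular_value_ge0 // mulr_ge0 // ltW.
have [y [z [t g']]] := greedy_step eta0 g t0.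
have := greedy_singular_value eta0 g'; rewrite lerBlDr; apply: le_trans.
rewrite (_ : compl T (extend n f z) n = compl T f n) //.
by apply/funext => u; rewrite /compl orth_proj_extend.
Qed.

Lemma approx_svd n (eps : R) : 0 < eps ->
  (forall i, (i < n)%N -> 0 < singular_value T i) ->
  exists e f, [/\ orthonormal_fam dot n e, orthonormal_fam dot n f,
    forall i, (i < n)%N -> singular_value T i - eps <= cmod (dot (T (e i)) (f i))
    & forall x, rnorm (T x -
         \sum_(i < n) ((singular_value T i)%:C * dot x (e i)) *: f i) <=
       (singular_value T n + eps) * rnorm x].
Proof.
move=> eps0 sn; pose N : R := n.+2%:R + n%:R + n%:R * (n.+2%:R + 1).
have N0 : 0 < N by rewrite ltr_pwDl // ?addr_ge0 ?mulr_ge0 ?addr_ge0 // ltr_pwDl.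
have [eta [eta0 etaN]] : exists eta, 0 < eta /\ N * eta = eps.
  by exists (eps / N); rewrite divr_gt0 // mulrC divfK // gt_eqF.
have [e [f [tau [g tn]]]] := greedy_exists eta0 sn.
have nN : n.+2%:R <= N by have := ler0n R n; have := ler0n R n.+2; rewrite /N; nra.
have eta_eps : eta <= eps.
  by rewrite -etaN ler_peMl ?(ltW eta0) // (le_trans _ nN) // ler1n.
have tau_lb i : (i < n)%N -> singular_value T i - eta <= tau i.
  move=> ni; apply: le_trans (greedy_lb g ni); rewrite lerD2r.
  exact: singular_value_compl.
have tau_ub i : (i < n)%N -> tau i <= singular_value T i + n.+2%:R * eta.
  move=> ni; apply: le_trans (greedy_ub g ni) _; rewrite -lerBlDr.
  apply: le_trans (greedy_singular_value eta0 (greedy_widen ni g)).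
  by rewrite lerD2l lerN2 ler_wpM2r ?(ltW eta0) // ler_nat !ltnS ltnW.
exists e, f; split; [exact: greedy_orthoe g|exact: greedy_orthof g| |].
  move=> i ni; rewrite (greedy_diag g ni) cmod_real ger0_norm ?(greedy_ge0 g) //.
  by apply: le_trans (tau_lb i ni); rewrite lerD2l lerN2.
move=> x; set y := \sum_(i < n) _.
pose z := \sum_(i < n) ((tau i)%:C * dot x (e i)) *: f i.
have -> : T x - y = compl T f n x + (orth_proj dot n f (T x) - z) + (z - y).
  by rewrite /compl addrA -[_ + (_ - z) + z]addrA subrK subrK.
apply: le_trans (rnormD _ _) _; apply: le_trans (lerD (rnormD _ _) (lexx _)) _.
have h1 := opnormP x (bounded_compl f n).
have h2 := greedy_sub x g.
have h3 : rnorm (z - y) <= n%:R * (n.+2%:R + 1) * eta * rnorm x.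
  rewrite /z /y -sumrB; apply: le_trans (rnorm_sum _ _ _) _.
  rewrite -!mulrA mulr_natl -[X in _ <= _ *+ X]card_ord -sumr_const.
  apply: ler_sum => i _; rewrite -scalerBl rnormZ (rnorm_fam dot_norm (greedy_orthof g)) //.
  rewrite mulr1 -mulrBl -rmorphB cmodM cmod_real [leRHS]mulrA ler_pM ?cmod_ge0 //.
    rewrite ler_norml; have := tau_lb i (ltn_ord i); have := tau_ub i (ltn_ord i).
    have : 0 <= n.+2%:R * eta by apply: mulr_ge0; rewrite // ltW.
    by move=> *; apply/andP; split; lra.
  apply: le_trans (dot_le dot_norm _ _) _.
  by rewrite (rnorm_fam dot_norm (greedy_orthoe g)) ?mulr1.
apply: le_trans (lerD (lerD h1 h2) h3) _; rewrite -!mulrDl ler_wpM2r ?rnorm_ge0 //.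
by rewrite -etaN /N; lra.
Qed.

End Greedy.
End SingularValues.

(** * Jensen and Hölder inequalities for real powers *)

Section RealPowers.
Context {R : realType}.

Lemma powR_half_sqr (x q : R) : 0 <= x -> (x ^+ 2) `^ (q / 2) = x `^ q.
Proof. by move=> x0; rewrite -powR_mulrn // -powRrM mulrC divfK. Qed.

Lemma ler_powRl (q x y : R) : 0 <= q -> 0 <= x -> x <= y -> x `^ q <= y `^ q.
Proof.
by move=> q0 x0 xy; apply: ge0_ler_powR; rewrite ?nnegrE //; exact: le_trans xy.
Qed.

Lemma ler_powR_inv (q x y : R) : 0 < q -> 0 <= x -> 0 <= y ->
  x `^ q <= y `^ q -> x <= y.
Proof.
move=> q0 x0 y0; apply: contraTT; rewrite -!ltNge => yx.
by apply: gt0_ltr_powR; rewrite ?nnegrE.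
Qed.

Lemma jensen_powR (I : finType) (w t : I -> R) (G rho : R) :
  (forall i, 0 <= w i) -> (forall i, 0 <= t i) -> \sum_i w i <= G -> 0 < G ->
  1 <= rho ->
  (\sum_i w i * t i) `^ rho <= G `^ (rho - 1) * \sum_i w i * t i `^ rho.
Proof.
move=> w0 t0 wG G0; rewrite le_eqVlt => /orP[/eqP <-|rho1].
  rewrite subrr powRr0 mul1r powRr1 ?sumr_ge0 // => [|i _]; last exact: mulr_ge0.
  by apply: ler_sum => i _; rewrite powRr1.
have rho0 : 0 < rho by exact: lt_trans rho1.
have rho10 : 0 < rho - 1 by rewrite subr_gt0.
set S := \sum_i w i * t i; set A := \sum_i w i * t i `^ rho.
have S0 : 0 <= S by apply: sumr_ge0 => i _; exact: mulr_ge0.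
(* Young's inequality with [b], the power [rho - 1] of [y], is the tangent-line bound for the power
   function at [y]; summed against the weights it gives Jensen's inequality. The case [rho = 1] was
   split off because its conjugate exponent is infinite. *)
pose y := S / G; have y0 : 0 <= y by rewrite divr_ge0 // ltW.
have yG : y * G = S by rewrite /y divfK ?gt_eqF.
pose b := y `^ (rho - 1).
have b0 : 0 <= b by exact: powR_ge0.
have yb : y * b = y `^ rho by rewrite /b mulr_powRB1.
have young i : t i * b <= t i `^ rho / rho + y `^ rho * ((rho - 1) / rho).
  have := @conjugate_powR R (t i) b rho (rho / (rho - 1)) (t0 i) b0 rho0.
  rewrite invf_div -powRrM (_ : (rho - 1) * (rho / (rho - 1)) = rho); last first.
    by field; rewrite gt_eqF.
  apply; first by rewrite divr_gt0.
  by field; rewrite !gt_eqF.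
have bS : S * b <= A / rho + S * b * ((rho - 1) / rho).
  rewrite [X in X <= _]mulr_suml.
  apply: (@le_trans _ _ (\sum_i (w i * t i `^ rho / rho +
      w i * (y `^ rho * ((rho - 1) / rho))))).
    apply: ler_sum => i _; rewrite -!mulrA -mulrDr ler_wpM2l //.
  have -> : S * b = G * y `^ rho by rewrite -yb -yG mulrAC mulrC.
  rewrite big_split /= -!mulr_suml -/A lerD2l -mulrA ler_wpM2r //.
  by rewrite mulr_ge0 ?powR_ge0 // divr_ge0 ?(ltW rho10) ?(ltW rho0).
have bA : S * b <= A.
  have e : S * b = S * b / rho + S * b * ((rho - 1) / rho).
    by field; rewrite gt_eqF.
  by rewrite {1}e lerD2r ler_pM2r ?invr_gt0 in bS.
rewrite -(mulr_powRB1 S0 rho0) -{2}yG (powRM _ y0 (ltW G0)) -/b mulrA mulrC.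
by rewrite ler_wpM2l ?powR_ge0.
Qed.

(** Jensen with exponent [q / 2] is applied to the squares and uses the row sums; exchanging the
    summations then uses the column sums. The factors [gamma ^+ 2] to the power [q / 2 - 1] from the
    rows and [gamma ^+ 2] from the columns combine to [gamma] to the power [q]. *)
Lemma substochastic_powR (I J : finType) (w : I -> J -> R) (x : I -> R)
    (s : J -> R) (gamma q : R) :
  0 < gamma -> 2 <= q -> (forall i j, 0 <= w i j) ->
  (forall i, \sum_j w i j <= gamma ^+ 2) ->
  (forall j, \sum_i w i j <= gamma ^+ 2) ->
  (forall i, 0 <= x i) -> (forall j, 0 <= s j) ->
  (forall i, x i ^+ 2 <= \sum_j w i j * s j ^+ 2) ->
  \sum_i x i `^ q <= gamma `^ q * \sum_j s j `^ q.
Proof.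
move=> g0 q2 w0 w1 w2 x0 s0 xw; set rho := q / 2.
have rho1 : 1 <= rho by rewrite /rho ler_pdivlMr ?ltr0n // mul1r.
have g20 : 0 < gamma ^+ 2 by rewrite exprn_gt0.
pose G := (gamma ^+ 2) `^ (rho - 1).
have xi i : x i `^ q <= G * \sum_j w i j * s j `^ q.
  rewrite -(powR_half_sqr q (x0 i)) -/rho.
  apply: (@le_trans _ _ ((\sum_j w i j * s j ^+ 2) `^ rho)).
    by apply: ler_powRl; rewrite ?sqr_ge0 // (le_trans _ rho1).
  apply: le_trans (jensen_powR _ _ (w1 i) g20 rho1) _ => // [j|].
    exact: sqr_ge0.
  rewrite ler_wpM2l ?powR_ge0 // le_eqVlt; apply/orP; left; apply/eqP.
  by apply: eq_bigr => j _; rewrite powR_half_sqr.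
apply: le_trans (ler_sum _ (fun i _ => xi i)) _.
rewrite -mulr_sumr exchange_big /= -(powR_half_sqr q (ltW g0)) -/rho.
rewrite -(mulr_powRB1 (ltW g20)) ?(lt_le_trans _ rho1) // -/G (mulrC (gamma ^+ 2)) -mulrA.
rewrite ler_wpM2l ?powR_ge0 // mulr_sumr; apply: ler_sum => j _.
by rewrite -mulr_suml ler_wpM2r ?powR_ge0.
Qed.

(** After normalizing by [A] and [B], Young's inequality with the conjugate exponents [p / r] and
    [q / r] is applied to the [r]-th powers of the terms. A vanishing bound forces all terms to
    vanish and is treated first. *)
Lemma holder_sum (I : finType) (x y : I -> R) (A B p q r : R) :
  (forall i, 0 <= x i) -> (forall i, 0 <= y i) -> 0 <= A -> 0 <= B ->
  0 < p -> 0 < q -> 0 < r -> r^-1 = p^-1 + q^-1 ->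
  \sum_i x i `^ p <= A `^ p -> \sum_i y i `^ q <= B `^ q ->
  \sum_i (x i * y i) `^ r <= (A * B) `^ r.
Proof.
move=> x0 y0 A0 B0 p0 q0 r0 rpq hx hy.
have zero (z : I -> R) (e : R) : 0 < e -> \sum_i z i `^ e <= 0 `^ e ->
    forall i, z i = 0.
  move=> e0; rewrite powR0 ?gt_eqF // => hz i; apply/eqP.
  have : \sum_i z i `^ e == 0 by rewrite eq_le hz sumr_ge0 // => k _; exact: powR_ge0.
  rewrite psumr_eq0 => [/allP/(_ i (mem_index_enum _))|k _]; last exact: powR_ge0.
  by rewrite /= powR_eq0 => /andP[].
have [A00|An] := eqVneq A 0.
  rewrite big1 ?powR_ge0 // => i _; rewrite A00 in hx.
  by rewrite (zero _ _ p0 hx) mul0r powR0 // gt_eqF.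
have [B00|Bn] := eqVneq B 0.
  rewrite big1 ?powR_ge0 // => i _; rewrite B00 in hy.
  by rewrite (zero _ _ q0 hy) mulr0 powR0 // gt_eqF.
have Ap : 0 < A by rewrite lt_def An.
have Bp : 0 < B by rewrite lt_def Bn.
have unit (z : I -> R) (e D : R) : 0 < D -> (forall i, 0 <= z i) ->
    \sum_i z i `^ e <= D `^ e -> \sum_i (z i / D) `^ e <= 1.
  move=> D0 z0 hz; under eq_bigr do rewrite powRM ?invr_ge0 ?(ltW D0) //.
  rewrite -mulr_suml -powR_inv1 ?(ltW D0) // -powRrM mulN1r powRN.
  by rewrite ler_pdivrMr ?mul1r // powR_gt0.
have {}hx := unit _ _ _ Ap x0 hx; have {}hy := unit _ _ _ Bp y0 hy.
have AB i : (x i * y i) `^ r = (A * B) `^ r * (x i / A * (y i / B)) `^ r.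
  rewrite -powRM ?mulr_ge0 ?invr_ge0 //; congr (_ `^ r).
  by field; rewrite An Bn.
under eq_bigr do rewrite AB.
rewrite -mulr_sumr ler_piMr ?powR_ge0 //.
apply: (@le_trans _ _ (\sum_i ((x i / A) `^ p * (r / p) + (y i / B) `^ q * (r / q)))).
  apply: ler_sum => i _; set u := x i / A; set v := y i / B.
  have u0 : 0 <= u by rewrite divr_ge0.
  have v0 : 0 <= v by rewrite divr_ge0.
  rewrite powRM //.
  have := @conjugate_powR R (u `^ r) (v `^ r) (p / r) (q / r) (powR_ge0 _ _) (powR_ge0 _ _).
  rewrite -!powRrM ![r * (_ / r)]mulrC !divfK ?gt_eqF // !invf_div; apply.
  - by rewrite divr_gt0.
  - by rewrite divr_gt0.
  - by rewrite -mulrDr -rpq mulfV // gt_eqF.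
rewrite big_split /= -!mulr_suml.
apply: (@le_trans _ _ (1 * (r / p) + 1 * (r / q))).
  by apply: lerD; rewrite ler_wpM2r // divr_ge0 // ltW.
by rewrite !mul1r -mulrDr -rpq mulfV // gt_eqF.
Qed.

End RealPowers.

(** * Norms given by series, as bounds on partial sums *)

Section PowerSeries.
Context {R : realType}.
Local Open Scope ereal_scope.

(** This serves both [l2norm] and [schatten_norm]: extended-real series are exchanged for
    inequalities between finite real sums, on which the estimates operate. *)
Lemma poweR_nneseries_le (f : nat -> R) (p K : R) : (0 < p)%R -> (0 <= K)%R ->
  (forall n, 0 <= f n)%R ->
  poweR (\sum_(0 <= n <oo) (f n)%:E) p^-1 <= K%:E <->
  forall n, (\sum_(i < n) f i <= K `^ p)%R.
Proof.
move=> p0 K0 f0.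
have fe0 n : 0 <= (f n)%:E by rewrite lee_fin.
have part n : \sum_(0 <= i < n) (f i)%:E = (\sum_(i < n) f i)%:E.
  by rewrite big_mkord sumEFin.
have sum0 : 0 <= \sum_(0 <= n <oo) (f n)%:E by apply: nneseries_ge0 => n _ _.
have iff : poweR (\sum_(0 <= n <oo) (f n)%:E) p^-1 <= K%:E <->
    \sum_(0 <= n <oo) (f n)%:E <= (K `^ p)%:E.
  split=> h.
    have -> : \sum_(0 <= n <oo) (f n)%:E =
        poweR (poweR (\sum_(0 <= n <oo) (f n)%:E) p^-1) p.
      by rewrite -poweRrM mulVf ?gt_eqF // poweRe1.
    rewrite -poweR_EFin; apply: gt0_ler_poweR h; first exact: ltW.
      by rewrite in_itv /= poweR_ge0 leey.
    by rewrite in_itv /= lee_fin K0 leey.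
  have -> : K%:E = poweR (K `^ p)%:E p^-1.
    by rewrite poweR_EFin -powRrM mulfV ?gt_eqF // powRr1.
  apply: gt0_ler_poweR h; first by rewrite invr_ge0 ltW.
    by rewrite in_itv /= sum0 leey.
  by rewrite in_itv /= lee_fin powR_ge0 leey.
rewrite iff; split=> [h n|h].
  rewrite -lee_fin -part; apply: le_trans h.
  exact: nneseries_lim_ge.
apply: lime_le; first exact: is_cvg_nneseries.
by near=> n; rewrite part lee_fin h.
Unshelve. all: by end_near. Qed.

Lemma poweR_nneseries_fin (f : nat -> R) (p : R) : (0 < p)%R ->
  (forall n, 0 <= f n)%R ->
  poweR (\sum_(0 <= n <oo) (f n)%:E) p^-1 < +oo ->
  exists K, [/\ (0 <= K)%R, poweR (\sum_(0 <= n <oo) (f n)%:E) p^-1 = K%:E &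
    forall n, (\sum_(i < n) f i <= K `^ p)%R].
Proof.
move=> p0 f0 h; set x := poweR _ _ in h *.
have x0 : 0 <= x by exact: poweR_ge0.
have xE : x = (fine x)%:E by rewrite fineK // ge0_fin_numE.
have fx0 : (0 <= fine x)%R by exact: fine_ge0.
exists (fine x); split=> //; apply/(poweR_nneseries_le p0 fx0 f0).
by rewrite -xE.
Qed.

Lemma l2norm_le (a : nat -> R[i]) (M : R) : (0 <= M)%R ->
  l2norm a <= M%:E <-> forall n, (\sum_(i < n) cmod (a i) ^+ 2 <= M ^+ 2)%R.
Proof.
move=> M0; rewrite /l2norm poweR_nneseries_le // => [|n]; last exact: sqr_ge0.
by rewrite (powR_mulrn 2 M0).
Qed.

End PowerSeries.

Section SchattenNorm.
Context {R : realType} {H : completeNormedModType R[i]}.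
Implicit Types (T : H -> H) (p K : R).

Lemma schatten_norm_le T p K : 0 < p -> 0 <= K ->
  (forall n, \sum_(i < n) singular_value T i `^ p <= K `^ p) ->
  (schatten_norm p T <= K%:E)%E.
Proof.
move=> p0 K0 h; apply/poweR_nneseries_le => // n; exact: powR_ge0.
Qed.

Lemma schatten_normP T p : 0 < p -> schatten p T ->
  exists K, [/\ 0 <= K, schatten_norm p T = K%:E &
    forall n, \sum_(i < n) singular_value T i `^ p <= K `^ p].
Proof.
move=> p0 [_ h].
by apply: (poweR_nneseries_fin p0 _ h) => n; exact: powR_ge0.
Qed.

(** Too many singular values above [delta] would exceed the [p]-sum bound. The least admissible
    index is returned, so that the earlier singular values exceed [delta] and [approx_svd]
    applies. *)
Lemma schatten_singular_value_small T p K (delta : R) : 0 < p -> 0 < delta ->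
  (forall n, \sum_(i < n) singular_value T i `^ p <= K `^ p) ->
  exists n, singular_value T n <= delta /\
    forall i, (i < n)%N -> 0 < singular_value T i.
Proof.
move=> p0 d0 hK.
have ex : exists n, singular_value T n <= delta.
  apply: contrapT => large.
  have {}large n : delta < singular_value T n.
    by rewrite ltNge; apply/negP => small; apply: large; exists n.
  have dp : 0 < delta `^ p by exact: powR_gt0.
  pose m := (Num.truncn (K `^ p / delta `^ p)).+1.
  have : m%:R * delta `^ p <= K `^ p.
    apply: le_trans (hK m); rewrite mulr_natl -[X in _ *+ X]card_ord -sumr_const.
    by apply: ler_sum => i _; apply: ler_powRl; rewrite ?ltW.
  by rewrite -ler_pdivlMr // leNgt truncnS_gt.
case: (ex_minnP ex) => n small minn; exists n; split=> // i ni.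
by apply: (lt_trans d0); rewrite ltNge; apply/negP => /minn; rewrite leqNgt ni.
Qed.

End SchattenNorm.

(** * Spectral measures and integrals *)

Lemma le_of_eps (R : realType) (a b c : R) : 0 <= c ->
  (forall eps, 0 < eps -> a <= b + eps * c) -> a <= b.
Proof.
move=> c0 h; apply/ler_addgt0Pr => e e0.
have c1 : 0 < c + 1 by rewrite ltr_wpDl.
apply: le_trans (h (e / (c + 1)) (divr_gt0 e0 c1)) _.
rewrite lerD2l -mulrA [_^-1 * _]mulrC mulrA ler_pdivrMr //.
by rewrite ler_wpM2l ?(ltW e0) // lerDl.
Qed.

(** From [y k ^+ 2 <= B] follows [y k <= B + 1], so an error [d <= 1] in [x k] changes its square by
    at most [d * (2 * (B + 1) + 1)]. *)
Lemma sum_sqr_approx (R : realType) (K : finType) (x : K -> R) (B : R) :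
  (forall k, 0 <= x k) -> 0 <= B ->
  (forall eps, 0 < eps -> exists y : K -> R,
    (forall k, 0 <= y k /\ x k <= y k + eps) /\ \sum_k y k ^+ 2 <= B) ->
  \sum_k x k ^+ 2 <= B.
Proof.
move=> x0 B0 h.
apply: (@le_of_eps _ _ _ (#|K|%:R * (2 * (B + 1) + 1))) => [|eps eps0].
  by rewrite mulr_ge0 // !addr_ge0 ?mulr_ge0 ?addr_ge0.
pose d := Num.min 1 eps.
have d0 : 0 < d by rewrite lt_min ltr01.
have d1 : d <= 1 by rewrite ge_min lexx.
have de : d <= eps by rewrite ge_min lexx orbT.
have [y [hy yB]] := h d d0.
have yk k : y k <= B + 1.
  have : y k ^+ 2 <= B.
    by apply: le_trans yB; rewrite (bigD1 k) //= lerDl sumr_ge0 // => i _; exact: sqr_ge0.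
  by have [yk0 _] := hy k; nra.
apply: (@le_trans _ _ (\sum_k (y k ^+ 2 + eps * (2 * (B + 1) + 1)))).
  apply: ler_sum => k _; have [yk0 xy] := hy k; have := yk k; have := x0 k; nra.
rewrite big_split /= sumr_const; apply: lerD => //; by rewrite -[X in X <= _]mulr_natl mulrCA.
Qed.

Section SpectralMeasureTheory.
Context {R : realType} {H : completeNormedModType R[i]}.
Context {dot : {dot H for @Num.conj R[i]}}.
Hypothesis dot_norm : forall u : H, dot u u = `|u| ^+ 2.
Context {d} {X : measurableType d}.
Variable E : spectral_measure dot X.
Local Notation C := R[i].
Implicit Types (A B N : set X) (u v : H).

Lemma rnorm_eps0 u : (forall eps, 0 < eps -> rnorm u <= eps) -> u = 0.
Proof.
move=> h; apply/eqP; rewrite -rnorm_eq0 eq_le rnorm_ge0 andbT.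
by apply: (@le_of_eps _ _ _ 1) => // e e0; rewrite mulr1 add0r h.
Qed.

Lemma cvg_rnorm (f : nat -> H) (l : H) : f n @[n --> \oo] --> l ->
  forall eps : R, 0 < eps -> exists m, forall n, (m <= n)%N -> rnorm (f n - l) <= eps.
Proof.
move=> /cvgrPdist_le h eps eps0.
have [|N _ hN] := h eps%:C; first by rewrite ltcR.
by exists N => n /hN; rewrite distrC rnorm_le.
Qed.

Lemma spectral_idem A u : measurable A -> E A (E A u) = E A u.
Proof. by move=> /(spectral_projection E)[]. Qed.

Lemma spectral_sym A u v : measurable A -> dot (E A u) v = dot u (E A v).
Proof. by move=> /(spectral_projection E)[]. Qed.

Lemma dot_spectral A u : measurable A -> dot (E A u) u = (rnorm (E A u) ^+ 2)%:C.
Proof.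
by move=> mA; rewrite (rnorm2 dot_norm) -spectral_sym // spectral_idem.
Qed.

Lemma rnorm_spectral A u : measurable A -> rnorm (E A u) <= rnorm u.
Proof.
move=> mA; have [->|n0] := eqVneq (rnorm (E A u)) 0; first exact: rnorm_ge0.
have n1 : 0 < rnorm (E A u) by rewrite lt_def n0 rnorm_ge0.
rewrite -(ler_pM2l n1); apply: le_trans (dot_le dot_norm _ _).
by rewrite dot_spectral // cmod_real ger0_norm ?sqr_ge0.
Qed.

Lemma bounded_spectral A : measurable A -> bounded_op (E A).
Proof.
move=> mA; have [lA _ _] := spectral_projection E mA.
by apply: (bounded_opP (M := 1)) => // u; rewrite mul1r rnorm_spectral.
Qed.

Lemma spectral_cvg (F : nat -> set X) u :
  (forall n, measurable (F n)) -> trivIset setT F ->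
  forall eps : R, 0 < eps -> exists m, forall n, (m <= n)%N ->
    rnorm (\sum_(i < n) E (F i) u - E (\bigcup_i F i) u) <= eps.
Proof. by move=> mF tF; apply: cvg_rnorm; exact: spectral_sigma_additive. Qed.

(** For the constant sequence [set0], two consecutive partial sums near the limit differ by exactly
    this term. Finite additivity follows from this by padding with empty sets. *)
Lemma spectral0 u : E set0 u = 0.
Proof.
apply: rnorm_eps0 => eps eps0.
have e2 : 0 < eps / 2 by rewrite divr_gt0.
have [] := @spectral_cvg (fun=> set0) u _ _ _ e2 => // [|N hN].
  by apply/trivIsetP => i j _ _ _; rewrite set0I.
have h1 := hN N (leqnn N); have h2 := hN N.+1 (leqnSn N).
set l := E (\bigcup_i _) u in h1 h2; rewrite big_ord_recr /= in h2.
set S := \sum_(i < N) _ in h1 h2.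
have -> : E set0 u = (S + E set0 u - l) - (S - l).
  by rewrite opprB addrA subrK addrC addKr.
by apply: le_trans (rnormB _ _) _; lra.
Qed.

Lemma spectralU A B u : measurable A -> measurable B -> A `&` B = set0 ->
  E (A `|` B) u = E A u + E B u.
Proof.
move=> mA mB dAB; apply/esym/eqP; rewrite -subr_eq0; apply/eqP.
apply: rnorm_eps0 => eps eps0.
have [] := @spectral_cvg (bigcup2 A B) u _ _ _ eps0.
- by move=> [|[|n]] //=; exact: measurable0.
- rewrite -trivIset_bigcup2 //.
move=> N hN; have := hN N.+2 (leqW (leqnSn N)).
rewrite bigcup2E !big_ord_recl /= big1 ?addr0 // => i _; exact: spectral0.
Qed.

(** With [v = E B u], the projection of the union sends [v] to [E A v + v]. Its squared norm is
    [rnorm v ^+ 2 + 3 * rnorm (E A v) ^+ 2], yet at most [rnorm v ^+ 2]. *)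
Lemma spectral_orth A B u : measurable A -> measurable B -> A `&` B = set0 ->
  E A (E B u) = 0.
Proof.
move=> mA mB dAB; set v := E B u.
have vB : E B v = v by exact: spectral_idem.
have := rnorm_spectral v (measurableU _ _ mA mB).
rewrite spectralU // vB -(@ler_pXn2r _ 2) ?nnegrE ?rnorm_ge0 //.
rewrite (rnorm2D dot_norm) dot_spectral //= => h.
apply/eqP; rewrite -rnorm_eq0 -sqrf_eq0.
by have := sqr_ge0 (rnorm (E A v)); nra.
Qed.

Lemma spectral_dot_orth A B u v : measurable A -> measurable B ->
  A `&` B = set0 -> dot (E A u) (E B v) = 0.
Proof. by move=> mA mB dAB; rewrite spectral_sym // spectral_orth // dot0r. Qed.

Lemma spectralD A B u : measurable A -> measurable B -> A `<=` B ->
  E B u = E A u + E (B `\` A) u.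
Proof.
by move=> mA mB AB; rewrite -spectralU ?setDIK ?setDUK //; exact: measurableD.
Qed.

Lemma rnorm_spectral_mono A B u : measurable A -> measurable B -> A `<=` B ->
  rnorm (E A u) <= rnorm (E B u).
Proof.
move=> mA mB AB; have mBA := measurableD mB mA.
rewrite -(@ler_pXn2r _ 2) ?nnegrE ?rnorm_ge0 // (spectralD u mA mB AB).
rewrite (rnorm2D_orth dot_norm) ?lerDl ?sqr_ge0 //.
by rewrite spectral_dot_orth // setDIK.
Qed.

Lemma spectral_null_sub A N u : measurable A -> A `<=` N -> spectral_null E N ->
  E A u = 0.
Proof.
move=> mA AN [mN EN]; apply/eqP; rewrite -rnorm_eq0 eq_le rnorm_ge0 andbT.
by apply: le_trans (rnorm_spectral_mono u mA mN AN) _; rewrite EN rnorm0.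
Qed.

Lemma spectral_null0 : spectral_null E set0.
Proof. by split=> [|u]; [exact: measurable0|exact: spectral0]. Qed.

Lemma spectral_nullU N1 N2 : spectral_null E N1 -> spectral_null E N2 ->
  spectral_null E (N1 `|` N2).
Proof.
move=> n1 n2; have [m1 E1] := n1; have [m2 E2] := n2.
have mU := measurableU _ _ m1 m2; split=> // u.
rewrite (spectralD u m1 mU); last exact: subsetUl.
rewrite E1 add0r (@spectral_null_sub _ N2) //; first exact: measurableD.
by move=> x [[]].
Qed.

Lemma spectral_null_bigU (I : Type) (r : seq I) (N : I -> set X) :
  (forall i, spectral_null E (N i)) ->
  spectral_null E (\big[setU/set0]_(i <- r) N i).
Proof.
move=> nN; elim/big_rec: _ => [|i A _ nA]; first exact: spectral_null0.
exact: spectral_nullU.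
Qed.

Lemma spectral_bigU (I : eqType) (r : seq I) (P : I -> set X) u : uniq r ->
  (forall i, measurable (P i)) ->
  (forall i j, i != j -> P i `&` P j = set0) ->
  E (\big[setU/set0]_(i <- r) P i) u = \sum_(i <- r) E (P i) u.
Proof.
move=> + mP dP; elim: r => [_|i r IH /= /andP[ir ur]].
  by rewrite !big_nil spectral0.
rewrite !big_cons spectralU ?IH //; first exact: bigsetU_measurable.
rewrite big_distrr /= big_seq big1 // => j jr; apply: dP.
by apply: contraNneq ir => ->.
Qed.

(** Exhaustion is required only through [E], that is, up to a null set; atoms lying in an
    exceptional set can therefore be dropped. *)
Record spectral_partition (I : finType) (P : I -> set X) : Prop := SpectralPartition {
  partition_measurable : forall i, measurable (P i) ;
  partition_disjoint : forall i j, i != j -> P i `&` P j = set0 ;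
  partition_total : forall u, \sum_i E (P i) u = u }.

Section Partition.
Variables (I : finType) (P : I -> set X).
Hypothesis sP : spectral_partition P.
Let mP := partition_measurable sP.
Let dP := partition_disjoint sP.

Lemma partition_rnorm2 (c : I -> C) u :
  rnorm (\sum_i c i *: E (P i) u) ^+ 2 = \sum_i cmod (c i) ^+ 2 * rnorm (E (P i) u) ^+ 2.
Proof.
rewrite (rnorm2_sum_orth dot_norm) => [|i j ij].
  by apply: eq_bigr => i _; rewrite rnormZ exprMn.
by rewrite dotZl dotZr spectral_dot_orth ?mulr0 // dP.
Qed.

Lemma partition_rnorm2_sum u : \sum_i rnorm (E (P i) u) ^+ 2 = rnorm u ^+ 2.
Proof.
rewrite -{2}(partition_total sP u) (rnorm2_sum_orth dot_norm) // => i j ij.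
by rewrite spectral_dot_orth // dP.
Qed.

Lemma partition_rnorm_le (c : I -> C) u (M : R) : 0 <= M ->
  (forall i, cmod (c i) <= M) ->
  rnorm (\sum_i c i *: E (P i) u) <= M * rnorm u.
Proof.
move=> M0 cM; rewrite -(@ler_pXn2r _ 2) ?nnegrE ?mulr_ge0 ?rnorm_ge0 //.
rewrite exprMn partition_rnorm2 -partition_rnorm2_sum mulr_sumr.
apply: ler_sum => i _; rewrite ler_wpM2r ?sqr_ge0 //.
by rewrite ler_pXn2r ?nnegrE ?cmod_ge0.
Qed.

End Partition.

(** The pieces are the atoms of the Boolean algebra generated by the [D j], indexed by membership
    patterns. An atom without a point outside [N] is null and is discarded; in each other one such a
    point is chosen, so that bounds valid off [N] apply there. *)
Lemma atoms_partition (J : finType) (D : J -> set X) N :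
  (forall j, measurable (D j)) -> spectral_null E N ->
  exists (I : finType) (P : I -> set X) (x : I -> X) (b : I -> J -> bool),
  [/\ spectral_partition P, forall i, ~ N (x i), forall i j, b i j = (x i \in D j)
    & forall j u, E (D j) u = \sum_(i | b i j) E (P i) u].
Proof.
move=> mD nN.
pose atom (G : {ffun J -> bool}) := [set x | forall j, G j = (x \in D j)].
have matom G : measurable (atom G).
  have -> : atom G = \big[setI/setT]_j (if G j then D j else ~` D j).
    apply/seteqP; split=> x /=.
      move=> hx; elim/big_rec: _ => [//|j A _ xA]; split=> //.
      by rewrite hx; case: (asboolP (D j x)) => h; [rewrite mem_set|rewrite memNset].
    move=> hx j; move: hx; rewrite (bigD1 j) //= => -[hx _]; move: hx.
    by case: (G j) => h; [rewrite mem_set|rewrite memNset].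
  apply: bigsetI_measurable => j _.
  by case: ifP => _; [exact: mD|exact/measurableC/mD].
have datom G G' : G != G' -> atom G `&` atom G' = set0.
  move=> GG'; apply/seteqP; split=> // x [hG hG']; apply/negP: GG'; rewrite negbK.
  by apply/eqP/ffunP => j; rewrite hG hG'.
pose good := [pred G | `[< exists x, atom G x /\ ~ N x >]].
have Ebad G u : ~~ good G -> E (atom G) u = 0.
  move=> /asboolPn bad; apply: (@spectral_null_sub _ N) => // x xG.
  by apply: contrapT => xN; apply: bad; exists x.
have union (Q : pred {ffun J -> bool}) A u :
    (forall x, A x <-> Q [ffun j => x \in D j]) ->
    E A u = \sum_(G | Q G) E (atom G) u.
  move=> AQ; rewrite -big_filter -spectral_bigU ?filter_uniq ?index_enum_uniq //.
  congr (E _ u); rewrite -bigcup_seq; apply/seteqP; split=> x /=.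
    move=> /AQ Qx; exists [ffun j => x \in D j]; last by move=> j; rewrite ffunE.
    by rewrite /= mem_filter Qx mem_index_enum.
  move=> [G /=]; rewrite mem_filter => /andP[QG _] xG; apply/AQ.
  suff <- : G = [ffun j => x \in D j] by [].
  by apply/ffunP => j; rewrite ffunE xG.
have to_good (Q : pred {ffun J -> bool}) u :
    \sum_(G | Q G) E (atom G) u =
    \sum_(G : {G | G \in good} | Q (val G)) E (atom (val G)) u.
  rewrite -(big_sub_cond (op := +%R) good Q (fun G => E (atom G) u)).
  rewrite (bigID good) /= [X in _ + X]big1 ?addr0 => [|G /andP[_ /Ebad //]].
  by apply: eq_bigl => G; rewrite andbC.
have [x hx] := choice (fun G : {G | G \in good} => elimT (asboolP _) (valP G)).
exists {G | G \in good}, (fun G => atom (val G)), x.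
exists (fun (G : {G | G \in good}) (j : J) => (val G) j).
split=> [|G|G j|j u]; [split| | |].
- by move=> G; exact: matom.
- by move=> G G' GG'; apply: datom.
- move=> u; rewrite -(to_good xpredT) -(union _ setT) ?spectral_setT //.
- by have [] := hx G.
- by have [+ _] := hx G; apply.
- rewrite (union (fun G => G j)) ?(to_good (fun G => G j)) // => y.
  by rewrite ffunE in_setE.
Qed.

(* The points [x i] are taken on the atoms of the sets occurring in simple
   approximants of all the [f k] at once. *)
Lemma sampling (K : finType) (f : K -> X -> C) (A : K -> H -> H) N (eps : R) :
  spectral_null E N -> 0 < eps ->
  (forall k, is_spectral_integral E (f k) (A k)) ->
  exists (I : finType) (P : I -> set X) (x : I -> X),
  [/\ spectral_partition P, forall i, ~ N (x i) &
    forall k u, rnorm (A k u - \sum_i f k (x i) *: E (P i) u) <= eps * rnorm u].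
Proof.
move=> nN eps0 hA; have e2 : 0 < eps / 2 by rewrite divr_gt0.
(* Approximants of different [f k] have different lengths; packing each one, with its exceptional
   set, into a dependent tuple lets all be chosen at once. *)
pose Q k (g : {n : nat & (('I_n -> C) * ('I_n -> set X) * set X)%type}) :=
  let c := (projT2 g).1.1 in let D := (projT2 g).1.2 in let N := (projT2 g).2 in
  [/\ forall i, measurable (D i), spectral_null E N,
    forall x, ~ N x -> cmod (f k x - \sum_i c i * \1_(D i) x) <= eps / 2
    & opnorm (fun u => A k u - \sum_i c i *: E (D i) u) <= eps / 2].
have /choice[g hg] : forall k, exists g, Q k g.
  move=> k.
  have [_ /(_ _ e2)[n [c [D [mD [N' nN' hN'] ho]]]]] := hA k.
  by exists (existT _ n (c, D, N')).
pose n k := projT1 (g k); pose c k : 'I_(n k) -> C := (projT2 (g k)).1.1.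
pose D k : 'I_(n k) -> set X := (projT2 (g k)).1.2; pose N' k := (projT2 (g k)).2.
have nN' : spectral_null E (\big[setU/set0]_k N' k).
  by apply: spectral_null_bigU => k; have [] := hg k.
pose J := {k : K & 'I_(n k)}.
have [j|I [P [x [b [sP xN bD ED]]]]] :=
    @atoms_partition J (fun j => D (tag j) (tagged j)) _ _ (spectral_nullU nN nN').
  by have [+ _ _ _] := hg (tag j); apply.
exists I, P, x; split=> // [i xi|k u]; first by apply: (xN i); left.
have [mD _ fD AD] := hg k; rewrite -/(c k) -/(D k) in mD fD AD.
have bAD : bounded_op (fun u => A k u - \sum_i c k i *: E (D k i) u).
  apply: bounded_opB; first by have [] := hA k.
  by apply: bounded_op_sum => i _; apply/bounded_opZ/bounded_spectral.
pose s i := \sum_l c k l * \1_(D k l) (x i).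
have sE : \sum_l c k l *: E (D k l) u = \sum_i s i *: E (P i) u.
  under eq_bigr => l _ do rewrite (ED (Tagged (fun k => 'I_(n k)) l)) big_mkcond scaler_sumr.
  rewrite exchange_big /=; apply: eq_bigr => i _; rewrite /s scaler_suml.
  apply: eq_bigr => l _; rewrite bD /= indicE.
  by case: (x i \in D k l); rewrite ?mulr1 // mulr0 scale0r scaler0.
have -> : A k u - \sum_i f k (x i) *: E (P i) u =
    (A k u - \sum_l c k l *: E (D k l) u) - \sum_i (f k (x i) - s i) *: E (P i) u.
  rewrite sE (eq_bigr _ (fun i _ => scalerBl _ _ _)) sumrB opprB addrA subrK //.
apply: le_trans (rnormB _ _) _.
have h1 : rnorm (A k u - \sum_l c k l *: E (D k l) u) <= eps / 2 * rnorm u.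
  by apply: le_trans (opnormP u bAD) _; apply: ler_wpM2r; rewrite ?rnorm_ge0.
have h2 := @partition_rnorm_le _ _ sP (fun i => f k (x i) - s i) u (eps / 2) (ltW e2).
apply: le_trans (lerD h1 (h2 _)) _ => [i|]; last by rewrite -mulrDl -splitr.
apply: fD => xi; apply: (xN i); right; rewrite (bigD1 k) //=; left.
exact: xi.
Qed.

End SpectralMeasureTheory.

Section SpectralIntegralTheory.
Context {R : realType} {H : completeNormedModType R[i]}.
Context {dot : {dot H for @Num.conj R[i]}}.
Hypothesis dot_norm : forall u : H, dot u u = `|u| ^+ 2.
Context {d} {X : measurableType d}.
Variable E : spectral_measure dot X.
Local Notation C := R[i].
Local Notation is_si := (is_spectral_integral E).
Implicit Types (N : set X) (u v : H).

(** Arbitrary finite index types replace ordinals so that simple functions can be added over a sum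
    type, and the operator norm gives way to an inequality at each vector. *)
Lemma is_spectral_integral_intro (f : X -> C) A : bounded_op A ->
  (forall eps : R, 0 < eps -> exists (I : finType) (c : I -> C) (D : I -> set X) N,
    [/\ forall i, measurable (D i), spectral_null E N,
      forall x, ~ N x -> cmod (f x - \sum_i c i * \1_(D i) x) <= eps &
      forall u, rnorm (A u - \sum_i c i *: E (D i) u) <= eps * rnorm u]) ->
  is_si f A.
Proof.
move=> bA h; split=> // eps /[dup] eps0 /h[I [c [D [N [mD nN fD AD]]]]].
have enum (V : nmodType) (F : I -> V) :
    \sum_i F i = \sum_(k < #|I|) F (enum_val k) by rewrite -big_enum_val.
exists #|I|, (fun k => c (enum_val k)), (fun k => D (enum_val k)); split=> //.
- by exists N => // x /fD; rewrite enum.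
- by apply: opnorm_le => [|u]; [exact: ltW|rewrite -(enum _ (fun i => c i *: E (D i) u))].
Qed.

Lemma is_spectral_integral_elim (f : X -> C) A (eps : R) : is_si f A -> 0 < eps ->
  exists (I : finType) (c : I -> C) (D : I -> set X) N,
    [/\ forall i, measurable (D i), spectral_null E N,
      forall x, ~ N x -> cmod (f x - \sum_i c i * \1_(D i) x) <= eps &
      forall u, rnorm (A u - \sum_i c i *: E (D i) u) <= eps * rnorm u].
Proof.
move=> [bA h] /h[n [c [D [mD [N nN fD] AD]]]].
exists 'I_n, c, D, N; split=> // u.
have b : bounded_op (fun u => A u - \sum_i c i *: E (D i) u).
  by apply: bounded_opB => //; apply: bounded_op_sum => i _;
    apply/bounded_opZ/bounded_spectral.
by apply: le_trans (opnormP u b) _; rewrite ler_wpM2r ?rnorm_ge0.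
Qed.

Lemma is_spectral_integral_indic (D : set X) : measurable D ->
  is_si (\1_D : X -> C) (E D).
Proof.
move=> mD; apply: is_spectral_integral_intro => [|eps eps0].
  exact: bounded_spectral.
exists 'I_1, (fun=> 1), (fun=> D), set0; split=> // [|x _|u].
- exact: spectral_null0.
- by rewrite big_ord1 mul1r subrr cmod0 ltW.
- by rewrite big_ord1 scale1r subrr rnorm0 mulr_ge0 ?rnorm_ge0 ?ltW.
Qed.

Lemma is_spectral_integral0 : is_si (fun=> 0) (fun=> 0).
Proof.
apply: is_spectral_integral_intro => [|eps eps0]; first exact: bounded_op0.
exists 'I_0, (fun=> 0), (fun=> set0), set0; split=> // [|x _|u].
- exact: spectral_null0.
- by rewrite big_ord0 subrr cmod0 ltW.
- by rewrite big_ord0 subrr rnorm0 mulr_ge0 ?rnorm_ge0 ?ltW.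
Qed.

Lemma is_spectral_integralD (f g : X -> C) A B : is_si f A -> is_si g B ->
  is_si (fun x => f x + g x) (fun u => A u + B u).
Proof.
move=> hA hB; apply: is_spectral_integral_intro => [|eps eps0].
  by apply: bounded_opD; [case: hA|case: hB].
have e2 : 0 < eps / 2 by rewrite divr_gt0.
have [I [c [D [N [mD nN fD AD]]]]] := is_spectral_integral_elim hA e2.
have [I' [c' [D' [N' [mD' nN' fD' AD']]]]] := is_spectral_integral_elim hB e2.
exists (I + I')%type, (fun i => match i with inl i => c i | inr i => c' i end),
  (fun i => match i with inl i => D i | inr i => D' i end), (N `|` N').
split=> [[]//||x /not_orP[/fD hx /fD' hx']|u].
- exact: spectral_nullU.
- rewrite big_sumType /= opprD addrACA; apply: le_trans (cmodD _ _) _.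
  by rewrite [eps]splitr lerD.
- rewrite big_sumType /= opprD addrACA; apply: le_trans (rnormD _ _) _.
  by rewrite [eps]splitr mulrDl lerD.
Qed.

Lemma is_spectral_integralZ (a : C) (f : X -> C) A : is_si f A ->
  is_si (fun x => a * f x) (fun u => a *: A u).
Proof.
move=> hA; apply: is_spectral_integral_intro => [|eps eps0].
  by apply: bounded_opZ; case: hA.
have a1 : 0 < cmod a + 1 by rewrite ltr_wpDl ?cmod_ge0.
have e1 : 0 < eps / (cmod a + 1) by rewrite divr_gt0.
have ae : cmod a * (eps / (cmod a + 1)) <= eps.
  by rewrite mulrCA ger_pMr // ler_pdivrMr // mul1r lerDl.
have [I [c [D [N [mD nN fD AD]]]]] := is_spectral_integral_elim hA e1.
exists I, (fun i => a * c i), D, N; split=> // [x /fD hx|u].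
- under eq_bigr do rewrite -mulrA.
  rewrite -mulr_sumr -mulrBr cmodM; apply: le_trans ae.
  by rewrite ler_wpM2l ?cmod_ge0.
- under eq_bigr do rewrite -scalerA.
  rewrite -scaler_sumr -scalerBr rnormZ.
  apply: le_trans (ler_wpM2r (rnorm_ge0 u) ae).
  by rewrite -mulrA ler_wpM2l ?cmod_ge0.
Qed.

Lemma is_spectral_integral_sum (J : Type) (r : seq J) (w : J -> C)
    (f : J -> X -> C) (A : J -> H -> H) : (forall j, is_si (f j) (A j)) ->
  is_si (fun x => \sum_(j <- r) w j * f j x) (fun u => \sum_(j <- r) w j *: A j u).
Proof.
move=> hA; elim: r => [|j r IH].
  by under eq_fun do rewrite big_nil; under [X in is_si _ X]eq_fun do rewrite big_nil;
    exact: is_spectral_integral0.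
under eq_fun do rewrite big_cons; under [X in is_si _ X]eq_fun do rewrite big_cons.
by apply: is_spectral_integralD => //; exact: is_spectral_integralZ.
Qed.

Lemma sampling_at (K V : finType) (f : K -> X -> C) (A : K -> H -> H) N
    (v : V -> H) (eps : R) : spectral_null E N -> 0 < eps ->
  (forall k, is_si (f k) (A k)) ->
  exists (I : finType) (P : I -> set X) (x : I -> X),
  [/\ spectral_partition E P, forall i, ~ N (x i) &
    forall k l, rnorm (A k (v l) - \sum_i f k (x i) *: E (P i) (v l)) <= eps].
Proof.
move=> nN eps0 hA; pose S := 1 + \sum_l rnorm (v l).
have S0 : 0 < S by rewrite ltr_wpDr // sumr_ge0 // => l _; exact: rnorm_ge0.
have [I [P [x [sP xN AP]]]] := sampling dot_norm nN (divr_gt0 eps0 S0) hA.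
exists I, P, x; split=> // k l; apply: le_trans (AP k (v l)) _.
rewrite -mulrA ger_pMr // mulrC ler_pdivrMr // mul1r /S (bigD1 l) //=.
by rewrite addrCA lerDl addr_ge0 // sumr_ge0 // => j _; exact: rnorm_ge0.
Qed.

(** For sampled operators, orthogonality of the pieces turns the left-hand side into the sum over
    [i] of [\sum_k cmod (f k (x i)) ^+ 2] times [rnorm (E (P i) u) ^+ 2], and the bound on [f]
    applies at each [x i]. *)
Lemma spectral_integral_column (K : finType) (f : K -> X -> C) (A : K -> H -> H)
    N (M : R) u : spectral_null E N -> 0 <= M ->
  (forall x, ~ N x -> \sum_k cmod (f k x) ^+ 2 <= M ^+ 2) ->
  (forall k, is_si (f k) (A k)) ->
  \sum_k rnorm (A k u) ^+ 2 <= (M * rnorm u) ^+ 2.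
Proof.
move=> nN M0 fM hA; apply: sum_sqr_approx => [k||eps eps0].
- exact: rnorm_ge0.
- exact: sqr_ge0.
have [I [P [x [sP xN AP]]]] := sampling_at (fun _ : unit => u) nN eps0 hA.
exists (fun k => rnorm (\sum_i f k (x i) *: E (P i) u)); split=> [k|].
  split; first exact: rnorm_ge0.
  have := AP k tt; have := rnormD (A k u - \sum_i f k (x i) *: E (P i) u)
    (\sum_i f k (x i) *: E (P i) u).
  by rewrite subrK; lra.
under eq_bigr do rewrite (partition_rnorm2 dot_norm sP).
rewrite exchange_big /= exprMn -(partition_rnorm2_sum dot_norm sP) mulr_sumr.
apply: ler_sum => i _; rewrite -mulr_suml ler_wpM2r ?sqr_ge0 //.
exact: fM.
Qed.

Lemma spectral_integral_bound (f : X -> C) A N (M : R) u : spectral_null E N ->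
  0 <= M -> (forall x, ~ N x -> cmod (f x) <= M) -> is_si f A ->
  rnorm (A u) <= M * rnorm u.
Proof.
move=> nN M0 fM hA.
rewrite -(@ler_pXn2r _ 2) ?nnegrE ?mulr_ge0 ?rnorm_ge0 //.
have := @spectral_integral_column unit (fun=> f) (fun=> A) N M u nN M0.
rewrite !big_const !card_unit /= !addr0; apply=> // x /fM fx.
by rewrite big_const card_unit /= addr0 ler_pXn2r ?nnegrE ?cmod_ge0.
Qed.

Lemma spectral_integral_adjoint (f : X -> C) A B u v : is_si f A ->
  is_si (fun x => Num.conj (f x)) B -> dot (A u) v = dot u (B v).
Proof.
move=> hA hB; apply/eqP; rewrite -subr_eq0 -cmod_eq0 eq_le cmod_ge0 andbT.
apply: (@le_of_eps _ _ _ (rnorm u + rnorm v)) => [|eps eps0].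
  by rewrite addr_ge0 ?rnorm_ge0.
(* Indexing by [bool] samples both functions over one partition at the same points; the two sampled
   sums are then exactly adjoint to each other. *)
have [|I [P [x [sP _ AP]]]] := @sampling_at bool bool
  (fun b => if b then f else fun x => Num.conj (f x)) (fun b => if b then A else B)
  set0 (fun b => if b then u else v) eps (spectral_null0 E) eps0.
  by case.
have hu := AP true true; have hv := AP false false; rewrite /= in hu hv.
set su := \sum_i _ in hu; set sv := \sum_i _ in hv.
have suv : dot su v = dot u sv.
  rewrite dot_suml dot_sumr; apply: eq_bigr => i _.
  by rewrite dotZl dotZr conjCK spectral_sym //; exact: partition_measurable sP i.
have -> : dot (A u) v - dot u (B v) = dot (A u - su) v - dot u (B v - sv).
  by rewrite dotBl dotBr suv opprB addrA subrK.
apply: le_trans (cmodB _ _) _; rewrite add0r mulrDr addrC.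
apply: lerD; apply: le_trans (dot_le dot_norm _ _) _.
  by rewrite mulrC ler_wpM2r ?rnorm_ge0.
by rewrite ler_wpM2r ?rnorm_ge0.
Qed.

End SpectralIntegralTheory.

(** * Existence of spectral integrals *)

Section Existence.
Context {R : realType} {H : completeNormedModType R[i]}.
Context {dot : {dot H for @Num.conj R[i]}}.
Hypothesis dot_norm : forall u : H, dot u u = `|u| ^+ 2.
Context {d} {X : measurableType d}.
Variable E : spectral_measure dot X.
Local Notation C := R[i].
Local Notation is_si := (is_spectral_integral E).
Implicit Types (N : set X) (u v : H).

(** [S] is [h] times the number of thresholds [h, 2h, ..., nh] not exceeding [y]. The first clause
    drives the induction: once a threshold is reached, so are all the previous ones. *)
Lemma staircase (y h : R) n : 0 < h -> 0 <= y ->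
  let S := \sum_(k < n) h * (k.+1%:R * h <= y)%R%:R in
  (n%:R * h <= y -> S = n%:R * h) /\ (y <= n%:R * h -> y - h <= S <= y).
Proof.
move=> h0 y0; elim: n => [|n] /=.
  rewrite big_ord0 !mul0r; split=> // yle; apply/andP; split=> //; lra.
rewrite big_ord_recr /=; set S := \sum_(_ < n) _; rewrite -(natr1 n) => -[IH1 IH2].
have [yn|yn] := leP ((n%:R + 1) * h) y.
  have nh : n%:R * h <= y by lra.
  by rewrite (IH1 nh) mulr1; split=> [_|yle]; [ring|apply/andP; split; lra].
rewrite mulr0 addr0; split=> [|_]; first by lra.
have [nh|/ltW nh] := leP (n%:R * h) y; last exact: IH2.
by rewrite (IH1 nh); apply/andP; split; lra.
Qed.

Lemma real_simple_approx (f : X -> R) (M eps : R) : measurable_fun setT f ->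
  0 < M -> 0 < eps ->
  exists (I : finType) (c : I -> R) (D : I -> set X),
    (forall i, measurable (D i)) /\
    forall x, `|f x| <= M -> `|f x - \sum_i c i * \1_(D i) x| <= eps.
Proof.
move=> mf M0 eps0; pose n := (Num.truncn (2 * M / eps)).+1.
pose h := 2 * M / n%:R.
have n0 : 0 < n%:R :> R by rewrite ltr0n.
have h0 : 0 < h by rewrite !mulr_gt0 ?invr_gt0.
have he : h <= eps.
  by rewrite ler_pdivrMr // -ler_pdivrMl // mulrC ltW // truncnS_gt.
have nh : n%:R * h = 2 * M by rewrite mulrC divfK // gt_eqF.
(* Index [ord0] carries the constant [- M], undoing the shift by [M] that makes the function
   nonnegative; the other indices are the [n] steps of height [h] covering the length [2 * M]. *)
exists 'I_n.+1, (fun i => if unlift ord0 i is Some _ then h else - M).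
exists (fun i => if unlift ord0 i is Some k then [set x | k.+1%:R * h <= f x + M] else setT).
split=> [i|x fx].
  case: unlift => [k|]; last exact: measurableT.
  have -> : [set x | k.+1%:R * h <= f x + M] = f @^-1` [set` `[k.+1%:R * h - M, +oo[].
    by apply/seteqP; split=> x /=; rewrite in_itv /= andbT lerBlDr.
  by rewrite -[X in measurable X]setTI; apply: mf => //; exact: measurable_itv.
rewrite big_ord_recl unlift_none indicE in_setT mulr1.
under eq_bigr => k _ do rewrite liftK indicE.
have y0 : 0 <= f x + M by move: fx; rewrite ler_norml; lra.
have y1 : f x + M <= n%:R * h by move: fx; rewrite nh ler_norml; lra.
have [_ /(_ y1)] := staircase n h0 y0.
rewrite (eq_bigr (fun k : 'I_n => h * (x \in [set x | k.+1%:R * h <= f x + M])%:R)).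
  by move=> /andP[hl hu]; rewrite ler_norml; apply/andP; split; lra.
move=> k _; congr (_ * _%:R); case: (boolP (_ <= _)) => hk.
  by rewrite mem_set.
by rewrite memNset //; exact/negP.
Qed.

Lemma complex_simple_approx (f : X -> C) (M eps : R) : cmeasurable f ->
  0 < M -> 0 < eps ->
  exists (I : finType) (c : I -> C) (D : I -> set X),
    (forall i, measurable (D i)) /\
    forall x, cmod (f x) <= M -> cmod (f x - \sum_i c i * \1_(D i) x) <= eps.
Proof.
move=> [mr mi] M0 eps0; have e2 : 0 < eps / 2 by rewrite divr_gt0.
have [I [c [D [mD hc]]]] := real_simple_approx mr M0 e2.
have [I' [c' [D' [mD' hc']]]] := real_simple_approx mi M0 e2.
exists (I + I')%type, (fun i => match i with inl i => (c i)%:C | inr i => 'i * (c' i)%:C end).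
exists (fun i => match i with inl i => D i | inr i => D' i end).
split=> [[]//|x fx].
have cast (J : finType) (a : J -> R) (B : J -> set X) :
    \sum_j (a j)%:C * (\1_(B j) x : C) = (\sum_j a j * \1_(B j) x)%:C.
  rewrite rmorph_sum; apply: eq_bigr => j _; rewrite rmorphM !indicE /=.
  by rewrite rmorph_nat.
have ei : \sum_j 'i * (c' j)%:C * \1_(D' j) x = 'i * (\sum_j c' j * \1_(D' j) x)%:C.
  by rewrite -cast mulr_sumr; apply: eq_bigr => j _; rewrite mulrA.
rewrite big_sumType /= ei cast [f x]complexE opprD addrACA -mulrBr -!rmorphB.
apply: le_trans (cmodD _ _) _; rewrite cmodM !cmod_real.
have -> : cmod ('i : C) = 1.
  by apply/eqP; rewrite -(@eqrXn2 _ 2) ?cmod_ge0 // cmod2E /= expr0n add0r.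
rewrite mul1r [eps]splitr; apply: lerD; [apply: hc|apply: hc'].
  exact: le_trans (Re_le_cmod _) fx.
exact: le_trans (Im_le_cmod _) fx.
Qed.

Lemma is_spectral_integral_simple (I : finType) (c : I -> C) (D : I -> set X) :
  (forall i, measurable (D i)) ->
  is_si (fun x => \sum_i c i * \1_(D i) x) (fun u => \sum_i c i *: E (D i) u).
Proof.
move=> mD; apply: (is_spectral_integral_sum dot_norm) => i.
exact: (is_spectral_integral_indic dot_norm).
Qed.

Lemma inv_nat_small (e : R) : 0 < e -> exists n : nat, n.+1%:R^-1 <= e.
Proof.
move=> e0; exists (Num.truncn e^-1).
by rewrite invf_ple ?posrE ?ltr0n // ltW // truncnS_gt.
Qed.

(** The bound on [a m - a n] passes to the limit in [m] because [e m] tends to 0, so the limit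
    inherits the rate. *)
Lemma cauchy_rnorm (a : nat -> H) (e : nat -> R) :
  (forall eps, 0 < eps -> exists n, forall m, (n <= m)%N -> e m <= eps) ->
  (forall m n, rnorm (a m - a n) <= e m + e n) ->
  exists l, forall n, rnorm (l - a n) <= e n.
Proof.
move=> e_small ha.
have e0 n : 0 <= e n by have := ha n n; rewrite subrr rnorm0; lra.
have /cvg_ex[l al] : cvg (a n @[n --> \oo]).
  apply/cauchy_cvgP/cauchyP => eps eps0.
  (* The uniform structure takes its radii in [R[i]]; a positive element there is real, and half of
     it is a usable real radius. *)
  have [r r0 re] : exists2 r : R, 0 < r & r%:C < eps.
    move: eps0; rewrite ltcE => /andP[/eqP /= ei e_gt0].
    exists (complex.Re eps / 2); first by rewrite divr_gt0.
    by rewrite ltcE /= ei eqxx /= ltr_pdivrMr // mulr_natr mulr2n ltrDl.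
  have r2 : 0 < r / 2 by rewrite divr_gt0.
  have [n hn] := e_small _ r2.
  exists (a n); exists n => // m /= nm.
  rewrite -ball_normE /=; apply: le_lt_trans re; rewrite -rnorm_le.
  by apply: le_trans (ha _ _) _; have := hn n (leqnn n); have := hn m nm; lra.
exists l => n; apply: (@le_of_eps _ _ _ 2) => // eps eps0.
have [n1 h1] := cvg_rnorm al eps0; have [n2 h2] := e_small _ eps0.
pose m := maxn n1 n2.
have -> : l - a n = (l - a m) + (a m - a n) by rewrite addrA subrK.
apply: le_trans (rnormD _ _) _; rewrite rnorm_distC.
have := h1 m (leq_maxl _ _); have := h2 m (leq_maxr _ _); have := ha m n; lra.
Qed.

(** [spectral_integral] falls back on the zero operator when no value exists, so existence has to be
    secured before its properties can be used. Integrals of simple approximants form a Cauchy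
    sequence at each vector, with rate [1/(n+1)]. *)
Lemma spectral_integral_exists (f : X -> C) N (M : R) : cmeasurable f ->
  spectral_null E N -> (forall x, ~ N x -> cmod (f x) <= M) ->
  exists A, is_si f A.
Proof.
move=> mf nN fM; pose M' := Num.max 1 M.
have M0 : 0 < M' by rewrite lt_max ltr01.
have {}fM x : ~ N x -> cmod (f x) <= M'.
  by move=> /fM /le_trans; apply; rewrite le_max lexx orbT.
pose e n : R := n.+1%:R^-1.
have e0 n : 0 < e n by rewrite invr_gt0 ltr0n.
have e_small eps : 0 < eps -> exists n, forall m, (n <= m)%N -> e m <= eps.
  move=> /inv_nat_small[n hn]; exists n => m nm; apply: le_trans hn.
  by rewrite lef_pV2 ?posrE ?ltr0n // ler_nat.
pose approx n (sA : (X -> C) * (H -> H)) := is_si sA.1 sA.2 /\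
  (forall x, ~ N x -> cmod (f x - sA.1 x) <= e n) /\
  exists (I : finType) (c : I -> C) (D : I -> set X),
   [/\ (forall i, measurable (D i)), sA.1 = (fun x => \sum_i c i * \1_(D i) x) &
       sA.2 = (fun u => \sum_i c i *: E (D i) u)].
have /choice[sA hsA] : forall n, exists sA, approx n sA.
  move=> n; have [I [c [D [mD hs]]]] := complex_simple_approx mf M0 (e0 n).
  exists (fun x => \sum_i c i * \1_(D i) x, fun u => \sum_i c i *: E (D i) u).
  split; first exact: is_spectral_integral_simple.
  by split=> [x /fM /hs //|]; exists I, c, D.
pose s n := (sA n).1; pose A n := (sA n).2.
have siA n : is_si (s n) (A n) by have [] := hsA n.
have fs n x : ~ N x -> cmod (f x - s n x) <= e n by have [_ [+ _]] := hsA n; apply.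
have bA n : bounded_op (A n) by case: (siA n).
(* The difference is the integral of [s m - s n], which is at most [e m + e n] off [N]. *)
have AA m n u : rnorm (A m u - A n u) <= e m * rnorm u + e n * rnorm u.
  have := is_spectral_integralD dot_norm (siA m) (is_spectral_integralZ dot_norm (-1) (siA n)).
  move=> /(spectral_integral_bound dot_norm u nN (addr_ge0 (ltW (e0 m)) (ltW (e0 n)))).
  rewrite -mulrDl scaleN1r; apply=> x xN; rewrite mulN1r.
  have -> : s m x - s n x = (f x - s n x) - (f x - s m x).
    by rewrite opprB [RHS]addrC addrA subrK.
  by apply: le_trans (cmodB _ _) _; rewrite addrC lerD ?fs.
have /choice[L hL] : forall u, exists l, forall n, rnorm (l - A n u) <= e n * rnorm u.
  move=> u; apply: (@cauchy_rnorm (A ^~ u) (fun n => e n * rnorm u)) => // eps eps0.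
  have r1 : 0 < rnorm u + 1 by rewrite ltr_wpDl ?rnorm_ge0.
  have [n hn] := e_small _ (divr_gt0 eps0 r1); exists n => m /hn em.
  apply: le_trans (ler_wpM2r (rnorm_ge0 u) em) _.
  by rewrite -mulrA ger_pMr // mulrC ler_pdivrMr // mul1r lerDl.
(* [L] was chosen vector by vector, so linearity must be recovered from that of the [A n]. *)
have LZD a u v : L (a *: u + v) = a *: L u + L v.
  apply/eqP; rewrite -subr_eq0; apply/eqP; apply: rnorm_eps0 => eps eps0.
  pose K := rnorm (a *: u + v) + (cmod a * rnorm u + rnorm v) + 1.
  have K0 : 0 < K.
    by rewrite ltr_wpDl // !addr_ge0 ?mulr_ge0 ?rnorm_ge0 ?cmod_ge0.
  have [n /(_ n (leqnn n)) hn] := e_small _ (divr_gt0 eps0 K0).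
  have -> : L (a *: u + v) - (a *: L u + L v) =
      (L (a *: u + v) - A n (a *: u + v)) - (a *: (L u - A n u) + (L v - A n v)).
    rewrite (bopD (bA n)) (bopZ (bA n)) scalerBr addrACA -opprD.
    by rewrite [in RHS]opprB addrA subrK.
  apply: le_trans (rnormB _ _) _.
  apply: le_trans (lerD (lexx _) (rnormD _ _)) _; rewrite rnormZ.
  have h1 := hL (a *: u + v) n; have h2 := hL v n.
  have h3 : cmod a * rnorm (L u - A n u) <= cmod a * (e n * rnorm u).
    by rewrite ler_wpM2l ?cmod_ge0.
  have : e n * K <= eps by rewrite -ler_pdivlMr.
  by have := e0 n; rewrite /K; lra.
have bL : bounded_op L.
  apply: (@bounded_opP _ _ _ (e 0 + opnorm (A 0))) => [a u v|u]; first exact: LZD.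
  rewrite -[L u](subrK (A 0 u)); apply: le_trans (rnormD _ _) _.
  by rewrite mulrDl lerD ?hL ?opnormP.
exists L; apply: (is_spectral_integral_intro bL) => eps eps0.
have [n /(_ n (leqnn n)) en] := e_small _ eps0.
have [_ [_ [I [c [D [mD s_eq A_eq]]]]]] := hsA n.
exists I, c, D, N; split=> // [x xN|u].
  have := fs n x xN; rewrite /s s_eq => /le_trans; exact.
have := hL u n; rewrite /A A_eq => /le_trans; apply.
by rewrite ler_wpM2r ?rnorm_ge0.
Qed.

Lemma is_spectral_integralP (f : X -> C) A : is_si f A ->
  is_si f (spectral_integral E f).
Proof. by move=> hA; apply: xgetPex; exists A. Qed.

End Existence.

(** Operator norm at most [beta] for a finite matrix, tested on pairs of vectors. The form is
    bilinear: conjugating the arbitrary [eta] does not affect the bound. The majorants [Y] and [Z]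
    avoid square roots. *)
Definition form_bound (R : realType) (J K : finType) (b : J -> K -> R[i]) (beta : R) :=
  forall (xi : K -> R[i]) (eta : J -> R[i]) (Y Z : R), 0 <= Y -> 0 <= Z ->
  \sum_k cmod (xi k) ^+ 2 <= Y ^+ 2 -> \sum_j cmod (eta j) ^+ 2 <= Z ^+ 2 ->
  cmod (\sum_j \sum_k b j k * (xi k * eta j)) <= beta * (Y * Z).

Definition vanishes (R : realType) (f : nat -> R[i]) :=
  forall eps : R, 0 < eps -> exists n, forall m, (n <= m)%N -> cmod (f m) <= eps.

(** * Matrices with spectral integrals as entries *)

Section MatrixBound.
Context {R : realType} {H : completeNormedModType R[i]}.
Context {dot : {dot H for @Num.conj R[i]}}.
Hypothesis dot_norm : forall u : H, dot u u = `|u| ^+ 2.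
Local Notation C := R[i].

Lemma cauchy_schwarz_cmod (L : finType) (F : L -> C) (beta Y Z : R)
    (y z : L -> R) : 0 <= beta -> 0 <= Y -> 0 <= Z ->
  (forall l, 0 <= y l) -> (forall l, 0 <= z l) ->
  \sum_l y l <= Y ^+ 2 -> \sum_l z l <= Z ^+ 2 ->
  (forall l, cmod (F l) <= beta * (Num.sqrt (y l) * Num.sqrt (z l))) ->
  cmod (\sum_l F l) <= beta * (Y * Z).
Proof.
move=> beta0 Y0 Z0 y0 z0 yY zZ hF; apply: le_trans (cmod_sum _ _ _) _.
apply: le_trans (ler_sum _ (fun l _ => hF l)) _.
rewrite -mulr_sumr ler_wpM2l //; apply: cauchy_schwarz_sum => //.
  by under eq_bigr do rewrite sqr_sqrtr //.
by under eq_bigr do rewrite sqr_sqrtr //.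
Qed.

(** A matrix tensored with an identity keeps its norm: the scalar bound is applied in each
    coordinate of an orthonormal family spanning the [y k], and Cauchy-Schwarz sums over the
    coordinates. For the [z j], Bessel's inequality suffices. *)
Lemma form_bound_vec (J K : finType) (b : J -> K -> C) (beta : R) (y : K -> H)
    (z : J -> H) (Y Z : R) : form_bound b beta -> 0 <= beta -> 0 <= Y -> 0 <= Z ->
  \sum_k rnorm (y k) ^+ 2 <= Y ^+ 2 -> \sum_j rnorm (z j) ^+ 2 <= Z ^+ 2 ->
  cmod (\sum_j \sum_k b j k * dot (y k) (z j)) <= beta * (Y * Z).
Proof.
move=> hb beta0 Y0 Z0 yY zZ.
have [n [e [one he]]] := gram_schmidt dot_norm [seq y k | k <- enum K].
have {}he k : orth_proj dot n e (y k) = y k.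
  by apply: he; apply: map_f; rewrite mem_enum.
have sum0 (L : finType) (F : L -> C) : 0 <= \sum_l cmod (F l) ^+ 2.
  by apply: sumr_ge0 => l _; exact: sqr_ge0.
have -> : \sum_j \sum_k b j k * dot (y k) (z j) = \sum_(l < n)
    \sum_j \sum_k b j k * (dot (y k) (e l) * dot (e l) (z j)).
  rewrite [RHS]exchange_big /=; apply: eq_bigr => j _.
  rewrite [RHS]exchange_big /=; apply: eq_bigr => k _.
  rewrite -{1}(he k) /orth_proj dot_suml mulr_sumr; apply: eq_bigr => l _.
  by rewrite dotZl.
apply: (@cauchy_schwarz_cmod _ _ _ _ _
  (fun l : 'I_n => \sum_k cmod (dot (y k) (e l)) ^+ 2)
  (fun l : 'I_n => \sum_j cmod (dot (e l) (z j)) ^+ 2)) => // [||l].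
- rewrite exchange_big /=; apply: le_trans yY; apply: ler_sum => k _.
  exact: bessel.
- rewrite exchange_big /=; apply: le_trans zZ; apply: ler_sum => j _.
  under eq_bigr do rewrite dot_conj cmod_conj.
  exact: bessel.
- by apply: hb; rewrite ?sqrtr_ge0 // sqr_sqrtr.
Qed.

Context {d} {X : measurableType d}.
Variable E : spectral_measure dot X.
Local Notation is_si := (is_spectral_integral E).
Implicit Types (N : set X) (u v : H).

(** On a sampled partition the form splits over the pieces, as [E (P i)] is idempotent and
    self-adjoint. On each piece [form_bound_vec] applies to the scalar matrix at [x i]; the squared
    norms of the pieces add up again. *)
Lemma spectral_integral_form (J K : finType) (b : J -> K -> X -> C)
    (B : J -> K -> H -> H) N (beta : R) (y : K -> H) (z : J -> H) (Y Z : R) :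
  spectral_null E N -> 0 <= beta ->
  (forall x, ~ N x -> form_bound (fun j k => b j k x) beta) ->
  (forall j k, is_si (b j k) (B j k)) -> 0 <= Y -> 0 <= Z ->
  \sum_k rnorm (y k) ^+ 2 <= Y ^+ 2 -> \sum_j rnorm (z j) ^+ 2 <= Z ^+ 2 ->
  cmod (\sum_j \sum_k dot (B j k (y k)) (z j)) <= beta * (Y * Z).
Proof.
move=> nN beta0 hb hB Y0 Z0 yY zZ.
apply: (@le_of_eps _ _ _ (\sum_j \sum_(k : K) rnorm (z j))) => [|eps eps0].
  by apply: sumr_ge0 => j _; apply: sumr_ge0 => k _; exact: rnorm_ge0.
have [|I [P [x [sP xN BP]]]] := @sampling_at _ _ _ dot_norm _ _ _ (J * K)%type _
  (fun jk => b jk.1 jk.2) (fun jk => B jk.1 jk.2) N y eps nN eps0.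
  by move=> [j k]; exact: hB.
pose s j k := \sum_i b j k (x i) *: E (P i) (y k).
have mP := partition_measurable sP.
have -> : \sum_j \sum_k dot (B j k (y k)) (z j) =
    \sum_j \sum_k dot (s j k) (z j) + \sum_j \sum_k dot (B j k (y k) - s j k) (z j).
  rewrite -big_split /=; apply: eq_bigr => j _; rewrite -big_split /=.
  by apply: eq_bigr => k _; rewrite -dotDl addrC subrK.
apply: le_trans (cmodD _ _) _; apply: lerD; last first.
  apply: le_trans (cmod_sum _ _ _) _; rewrite mulr_sumr; apply: ler_sum => j _.
  apply: le_trans (cmod_sum _ _ _) _; rewrite mulr_sumr; apply: ler_sum => k _.
  apply: le_trans (dot_le dot_norm _ _) _; rewrite ler_wpM2r ?rnorm_ge0 //.
  exact: (BP (j, k) k).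
have -> : \sum_j \sum_k dot (s j k) (z j) =
    \sum_i \sum_j \sum_k b j k (x i) * dot (E (P i) (y k)) (E (P i) (z j)).
  rewrite [RHS]exchange_big /=; apply: eq_bigr => j _.
  rewrite [RHS]exchange_big /=; apply: eq_bigr => k _; rewrite /s dot_suml.
  by apply: eq_bigr => i _; rewrite dotZl -spectral_sym // spectral_idem.
apply: (@cauchy_schwarz_cmod _ _ _ _ _
  (fun i => \sum_k rnorm (E (P i) (y k)) ^+ 2)
  (fun i => \sum_j rnorm (E (P i) (z j)) ^+ 2)) => //.
- by move=> i; apply: sumr_ge0 => k _; exact: sqr_ge0.
- by move=> i; apply: sumr_ge0 => k _; exact: sqr_ge0.
- rewrite exchange_big /=; apply: le_trans yY; apply: ler_sum => k _.
  by rewrite (partition_rnorm2_sum dot_norm sP).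
- rewrite exchange_big /=; apply: le_trans zZ; apply: ler_sum => k _.
  by rewrite (partition_rnorm2_sum dot_norm sP).
- move=> i; apply: form_bound_vec; rewrite ?sqrtr_ge0 //; first exact: hb.
    by rewrite sqr_sqrtr // sumr_ge0 // => k _; exact: sqr_ge0.
  by rewrite sqr_sqrtr // sumr_ge0 // => k _; exact: sqr_ge0.
Qed.

End MatrixBound.

(** * Dominated convergence for spectral integrals *)

Section DominatedConvergence.
Context {R : realType} {H : completeNormedModType R[i]}.
Context {dot : {dot H for @Num.conj R[i]}}.
Hypothesis dot_norm : forall u : H, dot u u = `|u| ^+ 2.
Local Notation C := R[i].
Context {d} {X : measurableType d}.
Variable E : spectral_measure dot X.
Local Notation is_si := (is_spectral_integral E).
Implicit Types (N : set X) (u v : H).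

Lemma spectral_exhaustion (G : nat -> set X) N u (eps : R) :
  (forall n, measurable (G n)) -> (forall n, G n `<=` G n.+1) ->
  spectral_null E N -> (forall x, ~ N x -> exists n, G n x) -> 0 < eps ->
  exists n, rnorm (u - E (G n) u) <= eps.
Proof.
move=> mG incG nN NG eps0.
have ndG : nondecreasing_seq G.
  by apply/nondecreasing_seqP => n; apply/subsetPset; exact: incG.
have mS n : measurable (seqD G n).
  by case: n => [|n] /=; [exact: mG|exact: measurableD].
have mU : measurable (\bigcup_n G n) by exact: bigcup_measurable.
have [n hn] := spectral_cvg E u mS (trivIset_seqD ndG) eps0.
exists n; move: (hn n.+1 (leqnSn n)); rewrite eq_bigcup_seqD.
(* The successive differences of the [G n] are disjoint and their projections telescope. *)
have -> : \sum_(i < n.+1) E (seqD G i) u = E (G n) u.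
  elim: n {hn} => [|n IH]; first by rewrite big_ord1.
  by rewrite big_ord_recr IH /= -(spectralD E u (mG n) (mG n.+1)).
suff -> : E (\bigcup_n G n) u = u by rewrite rnorm_distC.
rewrite -[RHS](spectral_setT E) (spectralD E u mU measurableT) //.
rewrite (@spectral_null_sub _ _ _ dot_norm _ _ _ (setT `\` \bigcup_n G n) N) ?addr0 //.
  by apply: measurableD.
by move=> x [_ xG]; apply: contrapT => /NG[m Gm]; apply: xG; exists m.
Qed.

(** The sampled sum is split according to whether [x i] lies in [G]. The pieces are not adapted to
    [G], so its indicator is sampled at the same points: this relates the pieces outside [G] to
    [u - E G u]. *)
Lemma spectral_integral_split_bound (f : X -> C) A N G (M delta : R) u :
  is_si f A -> spectral_null E N -> measurable G -> 0 <= M -> 0 <= delta ->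
  (forall x, ~ N x -> cmod (f x) <= M) ->
  (forall x, ~ N x -> G x -> cmod (f x) <= delta) ->
  rnorm (A u) <= delta * rnorm u + M * rnorm (u - E G u).
Proof.
move=> hA nN mG M0 delta0 fM fG.
apply: (@le_of_eps _ _ _ (1 + M)) => [|eps eps0]; first by rewrite addr_ge0.
have [|I [P [x [sP xN AP]]]] := @sampling_at _ _ _ dot_norm _ _ _ bool unit
  (fun b => if b then f else \1_G) (fun b => if b then A else E G) N (fun=> u) eps nN eps0.
  by case=> //; exact: is_spectral_integral_indic.
have /= hu := AP true tt; have /= hG := AP false tt.
set s := \sum_i _ in hu; set g := \sum_i _ in hG.
pose c1 i : C := f (x i) * (x i \in G)%:R.
pose c2 i : C := f (x i) * (x i \notin G)%:R.
have sE : s = \sum_i c1 i *: E (P i) u + \sum_i c2 i *: E (P i) u.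
  rewrite -big_split /=; apply: eq_bigr => i _; rewrite -scalerDl /c1 /c2.
  by case: (x i \in G); rewrite ?(mulr1, mulr0, addr0, add0r).
have h1 : rnorm (\sum_i c1 i *: E (P i) u) <= delta * rnorm u.
  apply: (partition_rnorm_le dot_norm sP) => // i; rewrite /c1.
  case: (boolP (x i \in G)) => [/set_mem xG|_]; last by rewrite mulr0 cmod0.
  by rewrite mulr1 fG.
have h2 : rnorm (\sum_i c2 i *: E (P i) u) <= M * rnorm (u - g).
  have -> : u - g = \sum_i (x i \notin G)%:R *: E (P i) u.
    rewrite -{1}(partition_total sP u) /g -sumrB; apply: eq_bigr => i _.
    by rewrite indicE; case: (x i \in G); rewrite ?scale1r ?scale0r ?subrr ?subr0.
  rewrite -(@ler_pXn2r _ 2) ?nnegrE ?mulr_ge0 ?rnorm_ge0 // exprMn.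
  rewrite !(partition_rnorm2 dot_norm sP) mulr_sumr; apply: ler_sum => i _.
  rewrite /c2 cmodM exprMn -mulrA; apply: ler_wpM2r.
    by apply: mulr_ge0; exact: sqr_ge0.
  by rewrite ler_pXn2r ?nnegrE ?cmod_ge0 // fM.
have h3 : rnorm (u - g) <= rnorm (u - E G u) + eps.
  have -> : u - g = (u - E G u) + (E G u - g) by rewrite addrA subrK.
  by apply: le_trans (rnormD _ _) _; rewrite lerD2l.
have h4 : rnorm (A u) <= eps + rnorm s.
  by rewrite -{1}(subrK s (A u)); apply: le_trans (rnormD _ _) _; rewrite lerD2r.
have h5 : rnorm s <= delta * rnorm u + M * rnorm (u - g).
  by rewrite sE; apply: le_trans (rnormD _ _) _; exact: lerD.
have h6 : M * rnorm (u - g) <= M * (rnorm (u - E G u) + eps) by rewrite ler_wpM2l.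
lra.
Qed.

Lemma measurable_cmod_le (f : X -> C) (delta : R) : cmeasurable f ->
  measurable [set x | cmod (f x) <= delta].
Proof.
move=> [mr mi]; have [d0|d0] := ltP delta 0.
  rewrite (_ : [set x | _] = set0) //; apply/seteqP; split=> x //= h.
  by have := cmod_ge0 (f x); lra.
pose g x := complex.Re (f x) ^+ 2 + complex.Im (f x) ^+ 2.
have mg : measurable_fun setT g.
  by apply: measurable_funD; apply: measurable_funX.
have -> : [set x | cmod (f x) <= delta] = g @^-1` [set` `]-oo, delta ^+ 2]].
  apply/seteqP; split=> x /=; rewrite in_itv /= /g -cmod2E;
    by rewrite ler_pXn2r ?nnegrE ?cmod_ge0.
by rewrite -[X in measurable X]setTI; apply: mg => //; exact: measurable_itv.
Qed.

(* Egorov's argument: the projections onto the sets where all later terms are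
   small converge strongly to the identity. *)
Lemma spectral_integral_dct (f : nat -> X -> C) (A : nat -> H -> H) N (M : R) u v :
  spectral_null E N -> 0 <= M -> (forall n, cmeasurable (f n)) ->
  (forall n, is_si (f n) (A n)) ->
  (forall x, ~ N x -> forall n, cmod (f n x) <= M) ->
  (forall x, ~ N x -> vanishes (f ^~ x)) ->
  vanishes (fun n => dot (A n u) v).
Proof.
move=> nN M0 mf hA fM f0 eps eps0.
pose K := (rnorm u + M) * rnorm v + 1.
have K0 : 0 < K.
  by rewrite ltr_wpDl // mulr_ge0 ?addr_ge0 ?rnorm_ge0.
pose delta := eps / K; have delta0 : 0 < delta by rewrite divr_gt0.
pose G n := \bigcap_(m in [set m | (n <= m)%N]) [set x | cmod (f m x) <= delta].
have mG n : measurable (G n).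
  by apply: bigcap_measurableType => // m _; exact: measurable_cmod_le.
have incG n : G n `<=` G n.+1 by move=> x Gx m /= nm; apply: Gx; exact: ltnW.
have NG x : ~ N x -> exists n, G n x.
  by move=> /f0 /(_ _ delta0)[n hn]; exists n => m /= /hn.
have [n hn] := spectral_exhaustion u mG incG nN NG delta0.
exists n => m nm; apply: le_trans (dot_le dot_norm _ _) _.
have := spectral_integral_split_bound u (hA m) nN (mG n) M0 (ltW delta0)
  (fun x xN => fM x xN m) (fun x _ Gx => Gx m nm).
have := ler_wpM2l M0 hn; have := rnorm_ge0 v.
have dK : delta * K = eps by rewrite divfK ?gt_eqF.
move=> v0 h1 h2.
apply: (@le_trans _ _ ((delta * rnorm u + M * delta) * rnorm v)).
  by rewrite ler_wpM2r //; lra.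
by rewrite -dK /K; lra.
Qed.

Lemma cmeasurableD (f g : X -> C) : cmeasurable f -> cmeasurable g ->
  cmeasurable (fun x => f x + g x).
Proof.
move=> [fr fi] [gr gi].
split; [rewrite (_ : (fun=> _) = (fun x => complex.Re (f x) + complex.Re (g x)))|
  rewrite (_ : (fun=> _) = (fun x => complex.Im (f x) + complex.Im (g x)))];
  rewrite ?raddfD //.
- exact: measurable_funD.
- by apply/funext => x; case: (f x) (g x) => [? ?] [].
- exact: measurable_funD.
- by apply/funext => x; case: (f x) (g x) => [? ?] [].
Qed.

Lemma cmeasurableZ (a : C) (f : X -> C) : cmeasurable f ->
  cmeasurable (fun x => a * f x).
Proof.
move=> [fr fi]; case: a => a b; split.
  rewrite (_ : (fun=> _) = (fun x => a * complex.Re (f x) - b * complex.Im (f x))).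
    by apply: measurable_funB; apply: measurable_funM.
  by apply/funext => x; case: (f x).
rewrite (_ : (fun=> _) = (fun x => a * complex.Im (f x) + b * complex.Re (f x))).
  by apply: measurable_funD; apply: measurable_funM.
by apply/funext => x; case: (f x).
Qed.

Lemma cmeasurable_sum (J : Type) (r : seq J) (w : J -> C) (f : J -> X -> C) :
  (forall j, cmeasurable (f j)) -> cmeasurable (fun x => \sum_(j <- r) w j * f j x).
Proof.
move=> mf; elim: r => [|j r IH].
  by under eq_fun do rewrite big_nil; split; exact: measurable_cst.
under eq_fun do rewrite big_cons.
by apply: cmeasurableD => //; exact: cmeasurableZ.
Qed.

(** Form suited to iteration: the other variables are frozen in the weights [w], and the second
    conclusion supplies the domination for integrating the next variable. *)
Lemma spectral_integral_dct_sum (J : Type) (r : nat -> seq J) (w : nat -> J -> C)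
    (f : J -> X -> C) (A : J -> H -> H) N (M : R) u v :
  spectral_null E N -> 0 <= M -> (forall j, cmeasurable (f j)) ->
  (forall j, is_si (f j) (A j)) ->
  (forall x, ~ N x -> forall n, cmod (\sum_(j <- r n) w n j * f j x) <= M) ->
  (forall x, ~ N x -> vanishes (fun n => \sum_(j <- r n) w n j * f j x)) ->
  vanishes (fun n => \sum_(j <- r n) w n j * dot (A j u) v) /\
  forall n, cmod (\sum_(j <- r n) w n j * dot (A j u) v) <= M * (rnorm u * rnorm v).
Proof.
move=> nN M0 mf hA fM f0.
have e n : \sum_(j <- r n) w n j * dot (A j u) v =
    dot (\sum_(j <- r n) w n j *: A j u) v.
  by rewrite dot_suml; apply: eq_bigr => j _; rewrite dotZl.
have hF n := is_spectral_integral_sum dot_norm (r n) (w n) hA.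
split=> [|n].
  under eq_fun do rewrite e.
  apply: (spectral_integral_dct u v nN M0 _ hF) => // n; exact: cmeasurable_sum.
rewrite e; apply: le_trans (dot_le dot_norm _ _) _.
rewrite mulrA ler_wpM2r ?rnorm_ge0 //.
by apply: (spectral_integral_bound dot_norm u nN M0 _ (hF n)) => x xN; exact: fM.
Qed.

End DominatedConvergence.

Section TripleDominatedConvergence.
Context {R : realType} {H : completeNormedModType R[i]}.
Context {dot : {dot H for @Num.conj R[i]}}.
Hypothesis dot_norm : forall u : H, dot u u = `|u| ^+ 2.
Local Notation C := R[i].
Context {d1 d2 d3 : measure_display}.
Context {X1 : measurableType d1} {X2 : measurableType d2} {X3 : measurableType d3}.
Variables (E1 : spectral_measure dot X1) (E2 : spectral_measure dot X2).
Variable E3 : spectral_measure dot X3.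

(** The variables are integrated one at a time, the dominating constant gaining a factor
    [rnorm u * rnorm v] each time. Products of three scalars arise because operators of rank one
    between the spectral integrals factor the inner product. *)
Lemma triple_spectral_integral_dct (J : Type) (r : nat -> seq J) (w : nat -> J -> C)
    (f1 : J -> X1 -> C) (f2 : J -> X2 -> C) (f3 : J -> X3 -> C)
    (A1 A2 A3 : J -> H -> H) (N1 : set X1) (N2 : set X2) (N3 : set X3) (M : R)
    (u1 v1 u2 v2 u3 v3 : H) :
  spectral_null E1 N1 -> spectral_null E2 N2 -> spectral_null E3 N3 -> 0 <= M ->
  (forall j, cmeasurable (f1 j)) -> (forall j, cmeasurable (f2 j)) ->
  (forall j, cmeasurable (f3 j)) ->
  (forall j, is_spectral_integral E1 (f1 j) (A1 j)) ->
  (forall j, is_spectral_integral E2 (f2 j) (A2 j)) ->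
  (forall j, is_spectral_integral E3 (f3 j) (A3 j)) ->
  (forall x1 x2 x3, ~ N1 x1 -> ~ N2 x2 -> ~ N3 x3 -> forall n,
    cmod (\sum_(j <- r n) w n j * (f1 j x1 * f2 j x2 * f3 j x3)) <= M) ->
  (forall x1 x2 x3, ~ N1 x1 -> ~ N2 x2 -> ~ N3 x3 ->
    vanishes (fun n => \sum_(j <- r n) w n j * (f1 j x1 * f2 j x2 * f3 j x3))) ->
  vanishes (fun n => \sum_(j <- r n)
    w n j * (dot (A1 j u1) v1 * dot (A2 j u2) v2 * dot (A3 j u3) v3)).
Proof.
move=> nN1 nN2 nN3 M0 m1 m2 m3 h1 h2 h3 fM f0.
have sumE n (a b c : J -> C) :
    \sum_(j <- r n) w n j * (a j * b j * c j) = \sum_(j <- r n) w n j * b j * c j * a j.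
  by apply: eq_bigr => j _; ring.
pose M1 := M * (rnorm u1 * rnorm v1); pose M2 := M1 * (rnorm u2 * rnorm v2).
have M10 : 0 <= M1 by rewrite !mulr_ge0 ?rnorm_ge0.
have M20 : 0 <= M2 by rewrite !mulr_ge0 ?rnorm_ge0.
have step1 x2 x3 : ~ N2 x2 -> ~ N3 x3 ->
    vanishes (fun n => \sum_(j <- r n) w n j * (dot (A1 j u1) v1 * f2 j x2 * f3 j x3)) /\
    forall n, cmod (\sum_(j <- r n) w n j * (dot (A1 j u1) v1 * f2 j x2 * f3 j x3)) <= M1.
  move=> n2 n3; have := spectral_integral_dct_sum dot_norm
    (w := fun n j => w n j * f2 j x2 * f3 j x3) (r := r) u1 v1 nN1 M0 m1 h1.
  move=> []; first by move=> x1 n1 n; rewrite -sumE fM.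
    by move=> x1 n1; under eq_fun do rewrite -sumE; exact: f0.
  move=> hv hb; split=> [|n]; last by rewrite sumE; exact: hb.
  by under eq_fun do rewrite sumE.
have sumE2 n (a b c : J -> C) :
    \sum_(j <- r n) w n j * (a j * b j * c j) = \sum_(j <- r n) w n j * a j * c j * b j.
  by apply: eq_bigr => j _; ring.
have step2 x3 : ~ N3 x3 ->
    vanishes (fun n => \sum_(j <- r n) w n j * (dot (A1 j u1) v1 * dot (A2 j u2) v2 * f3 j x3)) /\
    forall n, cmod (\sum_(j <- r n) w n j * (dot (A1 j u1) v1 * dot (A2 j u2) v2 * f3 j x3)) <= M2.
  move=> n3; have := spectral_integral_dct_sum dot_norm
    (w := fun n j => w n j * dot (A1 j u1) v1 * f3 j x3) (r := r) u2 v2 nN2 M10 m2 h2.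
  move=> []; first by move=> x2 n2 n; rewrite -sumE2; have [_] := step1 x2 x3 n2 n3.
    by move=> x2 n2; under eq_fun do rewrite -sumE2; have [] := step1 x2 x3 n2 n3.
  move=> hv hb; split=> [|n]; last by rewrite sumE2; exact: hb.
  by under eq_fun do rewrite sumE2.
have := spectral_integral_dct_sum dot_norm
  (w := fun n j => w n j * (dot (A1 j u1) v1 * dot (A2 j u2) v2)) (r := r) u3 v3 nN3 M20 m3 h3.
move=> [|x3 n3|hv _].
- move=> x3 n3 n; have [_ /(_ n)] := step2 x3 n3.
  by under eq_bigr do rewrite mulrA.
- have [+ _] := step2 x3 n3.
  by under eq_fun do under eq_bigr do rewrite mulrA.
- by under eq_fun do under eq_bigr do rewrite mulrA.
Qed.

End TripleDominatedConvergence.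

(** * Independence of the representation *)

Section Vanishing.
Context {R : realType}.
Local Notation C := R[i].
Implicit Types f g : nat -> C.

Lemma vanishesZ (a : C) f : vanishes f -> vanishes (fun n => a * f n).
Proof.
move=> hf eps eps0; have a1 : 0 < cmod a + 1 by rewrite ltr_wpDl ?cmod_ge0.
have [n hn] := hf _ (divr_gt0 eps0 a1); exists n => m /hn fm.
rewrite cmodM; apply: le_trans (ler_wpM2l (cmod_ge0 a) fm) _.
by rewrite mulrCA ger_pMr // ler_pdivrMr // mul1r lerDl.
Qed.

Lemma vanishesD f g : vanishes f -> vanishes g -> vanishes (fun n => f n + g n).
Proof.
move=> hf hg eps eps0; have e2 : 0 < eps / 2 by rewrite divr_gt0.
have [n hn] := hf _ e2; have [n' hn'] := hg _ e2.
exists (maxn n n') => m; rewrite geq_max => /andP[/hn h1 /hn' h2].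
by apply: le_trans (cmodD _ _) _; rewrite [eps]splitr lerD.
Qed.

Lemma vanishes0 : vanishes (fun=> 0 : C).
Proof. by move=> eps eps0; exists 0%N => m _; rewrite cmod0 ltW. Qed.

Lemma vanishes_sum (I : Type) (r : seq I) (F : I -> nat -> C) :
  (forall i, vanishes (F i)) -> vanishes (fun n => \sum_(i <- r) F i n).
Proof.
move=> hF; elim: r => [|i r IH].
  by under eq_fun do rewrite big_nil; exact: vanishes0.
by under eq_fun do rewrite big_cons; exact: vanishesD.
Qed.

(** The limit over rectangles is restricted to the diagonal, so that one index governs everything
    that follows. *)
Lemma double_sum_to_vanishes (a : nat -> nat -> C) (l : C) : double_sum_to a l ->
  vanishes (fun n => \sum_(j < n) \sum_(k < n) a j k - l).
Proof.
move=> al eps eps0.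
have diag : (n, n) @[n --> \oo] --> (\oo, \oo)%classic.
  by apply: cvg_pair; exact: cvg_id.
have /cvgrPdist_le h := cvg_comp _ _ diag al.
have [|n _ hn] := h eps%:C; first by rewrite ltcR.
by exists n => m /hn /=; rewrite cmod_le distrC.
Qed.

End Vanishing.

Lemma tail_small (R : realType) (s : nat -> R) (B eps : R) :
  (forall n, s n <= s n.+1) -> (forall n, s n <= B) -> 0 < eps ->
  exists M, forall m n, (M <= m)%N -> s n - s m <= eps.
Proof.
move=> incs sB eps0.
have mono : {homo s : m n / (m <= n)%N >-> m <= n} by apply: homo_leq => //; exact: le_trans.
have hs : has_sup (range s).
  by split; [exists (s 0%N), 0%N|exists B => _ [n _ <-]].
have [_ [M _ <-] hM] := sup_adherent eps0 hs.
exists M => m n Mm; rewrite lerBlDl -lerBlDr.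
apply: le_trans (mono _ _ Mm); apply: le_trans (ltW hM); rewrite lerD2r.
by apply: ub_le_sup; [case: hs|exists n].
Qed.

(** * Operators attached to a representation *)

Section BoundedRepresentation.
Context {R : realType} {H : completeNormedModType R[i]}.
Context {dot : {dot H for @Num.conj R[i]}}.
Hypothesis dot_norm : forall u : H, dot u u = `|u| ^+ 2.
Local Notation C := R[i].
Context {d1 d2 d3 : measure_display}.
Context {X1 : measurableType d1} {X2 : measurableType d2} {X3 : measurableType d3}.
Variables (E1 : spectral_measure dot X1) (E2 : spectral_measure dot X2).
Variable E3 : spectral_measure dot X3.

(* [rep_alpha], [rep_beta], [rep_gamma] are upper bounds of the three norms, made
   positive to avoid degenerate cases. *)
Record bounded_rep := BoundedRep {
  rep_a : nat -> X1 -> C ; rep_b : nat -> nat -> X2 -> C ; rep_c : nat -> X3 -> C ;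
  rep_alpha : R ; rep_beta : R ; rep_gamma : R ;
  rep_N1 : set X1 ; rep_N2 : set X2 ; rep_N3 : set X3 ;
  rep_alpha0 : 0 < rep_alpha ; rep_beta0 : 0 < rep_beta ; rep_gamma0 : 0 < rep_gamma ;
  rep_null1 : spectral_null E1 rep_N1 ;
  rep_null2 : spectral_null E2 rep_N2 ;
  rep_null3 : spectral_null E3 rep_N3 ;
  rep_ma : forall j, cmeasurable (rep_a j) ;
  rep_mb : forall j k, cmeasurable (rep_b j k) ;
  rep_mc : forall k, cmeasurable (rep_c k) ;
  rep_ha : forall x, ~ rep_N1 x -> forall n,
    \sum_(j < n) cmod (rep_a j x) ^+ 2 <= rep_alpha ^+ 2 ;
  rep_hb : forall x, ~ rep_N2 x -> forall m n,
    form_bound (fun (j : 'I_m) (k : 'I_n) => rep_b j k x) rep_beta ;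
  rep_hc : forall x, ~ rep_N3 x -> forall n,
    \sum_(k < n) cmod (rep_c k x) ^+ 2 <= rep_gamma ^+ 2 }.

Section One.
Variable D : bounded_rep.
Local Notation alpha := (rep_alpha D).
Local Notation beta := (rep_beta D).
Local Notation gamma := (rep_gamma D).

Definition opA j := spectral_integral E1 (rep_a D j).
Definition opA_adj j := spectral_integral E1 (fun x => Num.conj (rep_a D j x)).
Definition opB j k := spectral_integral E2 (rep_b D j k).
Definition opC k := spectral_integral E3 (rep_c D k).
Definition opC_adj k := spectral_integral E3 (fun x => Num.conj (rep_c D k x)).

Lemma l2_coef (f : nat -> C) (M : R) j : 0 <= M ->
  (forall n, \sum_(j < n) cmod (f j) ^+ 2 <= M ^+ 2) -> cmod (f j) <= M.
Proof.
move=> M0 /(_ j.+1); rewrite big_ord_recr /= => h.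
rewrite -(@ler_pXn2r _ 2) ?nnegrE ?cmod_ge0 //; apply: le_trans h.
by rewrite lerDr sumr_ge0 // => i _; exact: sqr_ge0.
Qed.

Lemma cmeasurable_conj d (X : measurableType d) (f : X -> C) :
  cmeasurable f -> cmeasurable (fun x => Num.conj (f x)).
Proof.
move=> [fr fi]; split.
  by rewrite (_ : (fun=> _) = (fun x => complex.Re (f x))) //; apply/funext => x; case: (f x).
rewrite (_ : (fun=> _) = (fun x => - complex.Im (f x))); last first.
  by apply/funext => x; case: (f x).
exact: measurable_funN.
Qed.

Lemma rep_a_bound j x : ~ rep_N1 D x -> cmod (rep_a D j x) <= alpha.
Proof.
by move=> /rep_ha h; apply: (l2_coef (f := fun j => rep_a D j x) j) h; exact/ltW/rep_alpha0.
Qed.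

Lemma rep_c_bound j x : ~ rep_N3 D x -> cmod (rep_c D j x) <= gamma.
Proof.
by move=> /rep_hc h; apply: (l2_coef (f := fun j => rep_c D j x) j) h; exact/ltW/rep_gamma0.
Qed.

Lemma is_opA j : is_spectral_integral E1 (rep_a D j) (opA j).
Proof.
have [A hA] := spectral_integral_exists dot_norm (rep_ma D j) (rep_null1 D) (rep_a_bound j).
exact: is_spectral_integralP hA.
Qed.

Lemma is_opA_adj j :
  is_spectral_integral E1 (fun x => Num.conj (rep_a D j x)) (opA_adj j).
Proof.
have [|A hA] := spectral_integral_exists dot_norm (cmeasurable_conj (rep_ma D j))
    (rep_null1 D) (M := alpha).
  by move=> x xN; rewrite cmod_conj; exact: rep_a_bound.
exact: is_spectral_integralP hA.
Qed.

Lemma is_opC j : is_spectral_integral E3 (rep_c D j) (opC j).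
Proof.
have [A hA] := spectral_integral_exists dot_norm (rep_mc D j) (rep_null3 D) (rep_c_bound j).
exact: is_spectral_integralP hA.
Qed.

Lemma is_opC_adj j :
  is_spectral_integral E3 (fun x => Num.conj (rep_c D j x)) (opC_adj j).
Proof.
have [|A hA] := spectral_integral_exists dot_norm (cmeasurable_conj (rep_mc D j))
    (rep_null3 D) (M := gamma).
  by move=> x xN; rewrite cmod_conj; exact: rep_c_bound.
exact: is_spectral_integralP hA.
Qed.

Lemma is_opB j k : is_spectral_integral E2 (rep_b D j k) (opB j k).
Proof.
have [|A hA] := spectral_integral_exists dot_norm (rep_mb D j k) (rep_null2 D) (M := beta).
  move=> x xN; have := @rep_hb D x xN j.+1 k.+1.
  (* The entry [(j, k)] is the last one of the section of size [j.+1] by [k.+1]; testing the form on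
     the last basis vectors isolates it. *)
  move=> /(_ (fun i => (i == ord_max)%:R) (fun i => (i == ord_max)%:R) 1 1 ler01 ler01).
  have e n : \sum_(i < n.+1) cmod ((i == ord_max)%:R : C) ^+ 2 <= 1 ^+ 2.
    rewrite (bigD1 ord_max) //= eqxx cmod1 big1 ?addr0 // => i /negPf ->.
    by rewrite cmod0 expr0n.
  move=> /(_ (e k) (e j)); rewrite !mulr1 (bigD1 ord_max) //= [X in _ + X]big1 ?addr0.
    rewrite (bigD1 ord_max) //= [X in _ + X]big1 ?addr0 ?eqxx ?mulr1 // => i /negPf ->.
    by rewrite mul0r mulr0.
  by move=> i /negPf ij; rewrite big1 // => l _; rewrite ij !mulr0.
exact: is_spectral_integralP hA.
Qed.

Lemma bounded_op_opA j : bounded_op (opA j). Proof. by case: (is_opA j). Qed.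
Lemma bounded_op_opB j k : bounded_op (opB j k). Proof. by case: (is_opB j k). Qed.
Lemma dot_opA j u v : dot (opA j u) v = dot u (opA_adj j v).
Proof. exact: (spectral_integral_adjoint dot_norm u v (is_opA j) (is_opA_adj j)). Qed.

Lemma dot_opC k u v : dot (opC k u) v = dot u (opC_adj k v).
Proof. exact: (spectral_integral_adjoint dot_norm u v (is_opC k) (is_opC_adj k)). Qed.

Lemma column_opA n u : \sum_(j < n) rnorm (opA j u) ^+ 2 <= (alpha * rnorm u) ^+ 2.
Proof.
apply: (spectral_integral_column dot_norm u (rep_null1 D) (ltW (rep_alpha0 D)) _
  (fun j : 'I_n => is_opA j)) => x xN; exact: rep_ha.
Qed.

Lemma column_opA_adj n u :
  \sum_(j < n) rnorm (opA_adj j u) ^+ 2 <= (alpha * rnorm u) ^+ 2.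
Proof.
apply: (spectral_integral_column dot_norm u (rep_null1 D) (ltW (rep_alpha0 D)) _
  (fun j : 'I_n => is_opA_adj j)) => x xN.
by under eq_bigr do rewrite cmod_conj; exact: rep_ha.
Qed.

Lemma column_opC n u : \sum_(j < n) rnorm (opC j u) ^+ 2 <= (gamma * rnorm u) ^+ 2.
Proof.
apply: (spectral_integral_column dot_norm u (rep_null3 D) (ltW (rep_gamma0 D)) _
  (fun j : 'I_n => is_opC j)) => x xN; exact: rep_hc.
Qed.

Lemma column_opC_adj n u :
  \sum_(j < n) rnorm (opC_adj j u) ^+ 2 <= (gamma * rnorm u) ^+ 2.
Proof.
apply: (spectral_integral_column dot_norm u (rep_null3 D) (ltW (rep_gamma0 D)) _
  (fun j : 'I_n => is_opC_adj j)) => x xN.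
by under eq_bigr do rewrite cmod_conj; exact: rep_hc.
Qed.

Lemma opB_form_bound n (y z : nat -> H) (Y Z : R) : 0 <= Y -> 0 <= Z ->
  \sum_(k < n) rnorm (y k) ^+ 2 <= Y ^+ 2 -> \sum_(j < n) rnorm (z j) ^+ 2 <= Z ^+ 2 ->
  cmod (\sum_(j < n) \sum_(k < n) dot (opB j k (y k)) (z j)) <= beta * (Y * Z).
Proof.
move=> Y0 Z0 hy hz.
apply: (@spectral_integral_form _ _ _ dot_norm _ _ E2 'I_n 'I_n (fun j k => rep_b D j k)
  (fun j k => opB j k) (rep_N2 D) beta (fun k => y k) (fun j => z j)) => //.
- exact: rep_null2.
- exact/ltW/rep_beta0.
- by move=> x xN; exact: rep_hb.
- by move=> j k; exact: is_opB.
Qed.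

(** The vectors [w j] have joint norm [W]; testing [opB_form_bound] against [w] itself gives
    [W ^+ 2 <= beta * Y * W], so [W <= beta * Y]. Then [T] acts on each [w j] separately. *)
Lemma opTB_form_bound n (T : H -> H) (y z : nat -> H) (Y Z : R) : bounded_op T ->
  0 <= Y -> 0 <= Z ->
  \sum_(k < n) rnorm (y k) ^+ 2 <= Y ^+ 2 -> \sum_(j < n) rnorm (z j) ^+ 2 <= Z ^+ 2 ->
  cmod (\sum_(j < n) \sum_(k < n) dot (T (opB j k (y k))) (z j)) <=
    opnorm T * beta * (Y * Z).
Proof.
move=> bT Y0 Z0 hy hz.
pose w (j : nat) := \sum_(k < n) opB j k (y k).
have e (S : H -> H) (q : nat -> H) : bounded_op S ->
    \sum_(j < n) \sum_(k < n) dot (S (opB j k (y k))) (q j) = \sum_(j < n) dot (S (w j)) (q j).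
  by move=> bS; apply: eq_bigr => j _; rewrite -dot_suml -(bop_sum bS).
pose W := Num.sqrt (\sum_(j < n) rnorm (w j) ^+ 2).
have W0 : 0 <= W by exact: sqrtr_ge0.
have W2 : \sum_(j < n) rnorm (w j) ^+ 2 = W ^+ 2.
  by rewrite sqr_sqrtr // sumr_ge0 // => j _; exact: sqr_ge0.
have WY : W <= beta * Y.
  have := opB_form_bound Y0 W0 hy (z := w); rewrite W2 lexx => /(_ isT).
  rewrite (e (fun x => x) w bounded_op_id).
  under eq_bigr do rewrite -(rnorm2 dot_norm).
  rewrite -rmorph_sum /= cmod_real W2 ger0_norm ?sqr_ge0 // expr2 mulrA.
  have [->|Wn] := eqVneq W 0; first by rewrite mulr_ge0 // ltW // rep_beta0.
  by rewrite ler_pM2r // lt_def Wn.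
rewrite e //; apply: le_trans (cmod_sum _ _ _) _.
apply: (@le_trans _ _ (\sum_(j < n) opnorm T * (rnorm (w j) * rnorm (z j)))).
  apply: ler_sum => j _; apply: le_trans (dot_le dot_norm _ _) _.
  by rewrite mulrA ler_wpM2r ?rnorm_ge0 ?opnormP.
rewrite -mulr_sumr -mulrA ler_wpM2l ?opnorm_ge0 //.
apply: (@le_trans _ _ (W * Z)); last by rewrite mulrA ler_wpM2r.
by apply: cauchy_schwarz_sum => //; rewrite W2.
Qed.

(** This provides the constant, uniform in [n], that dominates the scalar partial sums in dominated
    convergence. *)
Lemma scalar_form_bound n x1 x2 x3 : ~ rep_N1 D x1 -> ~ rep_N2 D x2 -> ~ rep_N3 D x3 ->
  cmod (\sum_(j < n) \sum_(k < n) rep_a D j x1 * rep_b D j k x2 * rep_c D k x3)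
    <= beta * (gamma * alpha).
Proof.
move=> n1 n2 n3.
have := @rep_hb D x2 n2 n n (fun k => rep_c D k x3) (fun j => rep_a D j x1)
  gamma alpha (ltW (rep_gamma0 D)) (ltW (rep_alpha0 D))
  (rep_hc n3 n) (rep_ha n1 n).
apply: le_trans; rewrite le_eqVlt; apply/orP; left; apply/eqP; congr cmod.
by apply: eq_bigr => j _; apply: eq_bigr => k _; ring.
Qed.

(** The sequences [p] and [q] stand for [opC k u] and [opA_adj j v]; leaving them free allows
    truncated sequences to be inserted. *)
Definition rep_form T Q n (p q : nat -> H) : C :=
  \sum_(j < n) \sum_(k < n) dot (T (opB j k (Q (p k)))) (q j).

Definition rep_sum T Q u v n : C :=
  \sum_(j < n) \sum_(k < n) dot (opA j (T (opB j k (Q (opC k u))))) v.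

Lemma rep_sumE T Q u v n :
  rep_sum T Q u v n = rep_form T Q n (opC ^~ u) (opA_adj ^~ v).
Proof. by apply: eq_bigr => j _; apply: eq_bigr => k _; rewrite dot_opA. Qed.

Lemma rep_form_bound T Q n (p q : nat -> H) (P Z : R) : bounded_op T -> bounded_op Q ->
  0 <= P -> 0 <= Z ->
  \sum_(k < n) rnorm (p k) ^+ 2 <= P ^+ 2 -> \sum_(j < n) rnorm (q j) ^+ 2 <= Z ^+ 2 ->
  cmod (rep_form T Q n p q) <= opnorm T * beta * (opnorm Q * P * Z).
Proof.
move=> bT bQ P0 Z0 hp hq; apply: (opTB_form_bound (y := fun k => Q (p k))) => //.
  by rewrite mulr_ge0 ?opnorm_ge0.
rewrite exprMn; apply: le_trans (ler_wpM2l (sqr_ge0 _) hp); rewrite mulr_sumr.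
apply: ler_sum => k _; rewrite -exprMn ler_pXn2r ?nnegrE ?mulr_ge0 ?opnorm_ge0 ?rnorm_ge0 //.
exact: opnormP.
Qed.

(** Passing from the square of size [m] to that of size [n] adds late [k] with all [j], and early
    [k] with late [j]; in each part one of the two columns is a tail of size [tau]. The hypotheses
    on the tails involve neither [T] nor [Q]. *)
Lemma rep_sum_tail T Q u v m n (tau : R) : bounded_op T -> bounded_op Q ->
  (m <= n)%N -> 0 <= tau ->
  \sum_(k < n) rnorm (opC k u) ^+ 2 - \sum_(k < m) rnorm (opC k u) ^+ 2 <= tau ^+ 2 ->
  \sum_(j < n) rnorm (opA_adj j v) ^+ 2 - \sum_(j < m) rnorm (opA_adj j v) ^+ 2 <= tau ^+ 2 ->
  cmod (rep_sum T Q u v n - rep_sum T Q u v m) <=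
    opnorm T * beta * opnorm Q * (alpha * rnorm v + gamma * rnorm u) * tau.
Proof.
move=> bT bQ mn tau0 hC hA; rewrite !rep_sumE.
pose cut (p : nat -> H) k := if (k < m)%N then p k else 0.
pose rest (p : nat -> H) k := if (k < m)%N then 0 else p k.
have sum_cut (F : nat -> H) (G : H -> R) : G 0 = 0 ->
    \sum_(k < m) G (F k) = \sum_(k < n) G (cut F k).
  move=> G0; rewrite (big_ord_widen _ (fun k => G (F k)) mn) big_mkcond /=.
  by apply: eq_bigr => k _; rewrite /cut; case: ifP.
have norm0 : rnorm (0 : H) ^+ 2 = 0 by rewrite rnorm0 expr0n.
have restE (F : nat -> H) : \sum_(k < n) rnorm (rest F k) ^+ 2 =
    \sum_(k < n) rnorm (F k) ^+ 2 - \sum_(k < m) rnorm (F k) ^+ 2.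
  rewrite (sum_cut F (fun x => rnorm x ^+ 2) norm0) -sumrB; apply: eq_bigr => k _.
  by rewrite /cut /rest; case: ifP; rewrite norm0 ?subrr ?subr0.
have cutE : rep_form T Q m (opC ^~ u) (opA_adj ^~ v) =
    rep_form T Q n (cut (opC ^~ u)) (cut (opA_adj ^~ v)).
  rewrite /rep_form.
  rewrite (big_ord_widen _ (fun j =>
    \sum_(k < m) dot (T (opB j k (Q (opC k u)))) (opA_adj j v)) mn).
  rewrite big_mkcond; apply: eq_bigr => j _; rewrite {2}/cut; case: ifP => _; last first.
    by rewrite big1 // => k _; rewrite dot0r.
  rewrite (big_ord_widen _ (fun k => dot (T (opB j k (Q (opC k u)))) (opA_adj j v)) mn).
  rewrite big_mkcond; apply: eq_bigr => k _; rewrite /cut; case: ifP => // _.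
  by rewrite (bop0 bQ) (bop0 (bounded_op_opB j k)) (bop0 bT) dot0l.
have -> : rep_form T Q n (opC ^~ u) (opA_adj ^~ v) - rep_form T Q m (opC ^~ u) (opA_adj ^~ v) =
    rep_form T Q n (rest (opC ^~ u)) (opA_adj ^~ v) +
    rep_form T Q n (cut (opC ^~ u)) (rest (opA_adj ^~ v)).
  rewrite cutE /rep_form -sumrB -big_split; apply: eq_bigr => j _.
  rewrite -sumrB -big_split; apply: eq_bigr => k _ /=; rewrite /cut /rest.
  case: (k < m)%N; case: (j < m)%N; rewrite ?(bop0 bQ) ?(bop0 (bounded_op_opB j k)) ?(bop0 bT);
    by rewrite ?dot0r ?dot0l ?subrr ?subr0 ?addr0 ?add0r.
have cut_le : \sum_(k < n) rnorm (cut (opC ^~ u) k) ^+ 2 <= (gamma * rnorm u) ^+ 2.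
  by rewrite -(sum_cut _ (fun x => rnorm x ^+ 2) norm0); exact: column_opC.
have g0 : 0 <= gamma * rnorm u by rewrite mulr_ge0 ?rnorm_ge0 // ltW // rep_gamma0.
have a0 : 0 <= alpha * rnorm v by rewrite mulr_ge0 ?rnorm_ge0 // ltW // rep_alpha0.
apply: le_trans (cmodD _ _) _.
have h1 : \sum_(k < n) rnorm (rest (opC ^~ u) k) ^+ 2 <= tau ^+ 2 by rewrite restE.
have h2 : \sum_(k < n) rnorm (rest (opA_adj ^~ v) k) ^+ 2 <= tau ^+ 2 by rewrite restE.
have := rep_form_bound bT bQ tau0 a0 h1 (q := opA_adj ^~ v) (column_opA_adj n v).
have := rep_form_bound bT bQ g0 tau0 cut_le h2.
lra.
Qed.

End One.

Section Two.
Variables D D' : bounded_rep.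
Hypothesis same : exists N1 N2 N3,
  [/\ spectral_null E1 N1, spectral_null E2 N2, spectral_null E3 N3
    & forall x1 x2 x3, ~ N1 x1 -> ~ N2 x2 -> ~ N3 x3 -> vanishes (fun n =>
      \sum_(j < n) \sum_(k < n) rep_a D j x1 * rep_b D j k x2 * rep_c D k x3 -
      \sum_(j < n) \sum_(k < n) rep_a D' j x1 * rep_b D' j k x2 * rep_c D' k x3)].

(** This is independence for rank-one [T] and [Q], whose inner products factor into these three
    scalars. *)
Lemma rep_sum_rank1 u1 v1 u2 v2 u3 v3 : vanishes (fun n =>
  \sum_(j < n) \sum_(k < n)
    dot (opA D j u1) v1 * dot (opB D j k u2) v2 * dot (opC D k u3) v3 -
  \sum_(j < n) \sum_(k < n)
    dot (opA D' j u1) v1 * dot (opB D' j k u2) v2 * dot (opC D' k u3) v3).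
Proof.
have [N1 [N2 [N3 [nN1 nN2 nN3 h0]]]] := same.
pose l n := [seq (j, k) | j <- iota 0 n, k <- iota 0 n].
(* The difference of the two double sums is written as one sum over tagged indices with weights 1
   and -1, to which dominated convergence applies as a whole. *)
pose r n := [seq (true, jk) | jk <- l n] ++ [seq (false, jk) | jk <- l n].
pose sel (s : bool) := if s then D else D'.
have rE (F : bool -> nat -> nat -> C) n :
    \sum_(i <- r n) (if i.1 then 1 else -1) * F i.1 i.2.1 i.2.2 =
    \sum_(j < n) \sum_(k < n) F true j k - \sum_(j < n) \sum_(k < n) F false j k.
  rewrite /r big_cat !big_map !big_allpairs /=.
  have e (G : nat -> C) : \sum_(i <- iota 0 n) G i = \sum_(i < n) G i.
    by rewrite -(big_mkord xpredT) /index_iota subn0.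
  rewrite e (e (fun j => \sum_(k <- iota 0 n) -1 * F false j k)).
  rewrite -sumrN; congr (_ + _); apply: eq_bigr => j _.
    by rewrite e; apply: eq_bigr => k _; rewrite mul1r.
  by rewrite e -sumrN; apply: eq_bigr => k _; rewrite mulN1r.
have := @triple_spectral_integral_dct _ _ _ dot_norm _ _ _ _ _ _ E1 E2 E3
  (bool * (nat * nat)) r (fun _ i => if i.1 then 1 else -1)
  (fun i => rep_a (sel i.1) i.2.1) (fun i => rep_b (sel i.1) i.2.1 i.2.2)
  (fun i => rep_c (sel i.1) i.2.2) (fun i => opA (sel i.1) i.2.1)
  (fun i => opB (sel i.1) i.2.1 i.2.2) (fun i => opC (sel i.1) i.2.2)
  (N1 `|` (rep_N1 D `|` rep_N1 D')) (N2 `|` (rep_N2 D `|` rep_N2 D'))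
  (N3 `|` (rep_N3 D `|` rep_N3 D'))
  (rep_beta D * (rep_gamma D * rep_alpha D) + rep_beta D' * (rep_gamma D' * rep_alpha D'))
  u1 v1 u2 v2 u3 v3.
under eq_fun do rewrite (rE (fun s j k => dot (opA (sel s) j u1) v1 *
  dot (opB (sel s) j k u2) v2 * dot (opC (sel s) k u3) v3)).
apply.
- by do 2?apply: spectral_nullU => //; exact: rep_null1.
- by do 2?apply: spectral_nullU => //; exact: rep_null2.
- by do 2?apply: spectral_nullU => //; exact: rep_null3.
- have pos (D0 : bounded_rep) : 0 <= rep_beta D0 * (rep_gamma D0 * rep_alpha D0).
    by rewrite !mulr_ge0 // ltW ?rep_alpha0 ?rep_beta0 ?rep_gamma0.
  by rewrite addr_ge0.
- by move=> i; exact: rep_ma.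
- by move=> i; exact: rep_mb.
- by move=> i; exact: rep_mc.
- by move=> i; exact: is_opA.
- by move=> i; exact: is_opB.
- by move=> i; exact: is_opC.
- move=> x1 x2 x3 /not_orP[n1 /not_orP[n1D n1D']] /not_orP[n2 /not_orP[n2D n2D']].
  move=> /not_orP[n3 /not_orP[n3D n3D']] n.
  rewrite (rE (fun s j k => rep_a (sel s) j x1 * rep_b (sel s) j k x2 * rep_c (sel s) k x3)).
  by apply: le_trans (cmodB _ _) _; apply: lerD; exact: scalar_form_bound.
- move=> x1 x2 x3 /not_orP[n1 _] /not_orP[n2 _] /not_orP[n3 _].
  under eq_fun do rewrite (rE (fun s j k =>
    rep_a (sel s) j x1 * rep_b (sel s) j k x2 * rep_c (sel s) k x3)).
  exact: h0.
Qed.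

End Two.
End BoundedRepresentation.

(** * Compressions, and independence for bounded operators *)

Section Independence.
Context {R : realType} {H : completeNormedModType R[i]}.
Context {dot : {dot H for @Num.conj R[i]}}.
Hypothesis dot_norm : forall u : H, dot u u = `|u| ^+ 2.
Local Notation C := R[i].

Section Compression.
Variables (n : nat) (e : nat -> H).

Definition compress (T : H -> H) x := orth_proj dot n e (T (orth_proj dot n e x)).

Lemma orth_proj_sym x y : dot (orth_proj dot n e x) y = dot x (orth_proj dot n e y).
Proof.
rewrite /orth_proj dot_suml dot_sumr; apply: eq_bigr => i _.
by rewrite dotZl dotZr -dot_conj mulrC.
Qed.

Lemma bounded_compress T : bounded_op T -> bounded_op (compress T).
Proof.
move=> bT; apply: (@bounded_op_comp _ _ (orth_proj dot n e)).
  exact: bounded_orth_proj.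
by apply: bounded_op_comp => //; exact: bounded_orth_proj.
Qed.

Lemma opnorm_compress T : bounded_op T -> orthonormal_fam dot n e ->
  opnorm (compress T) <= opnorm T.
Proof.
move=> bT one; apply: opnorm_le => [|x]; first exact: opnorm_ge0.
apply: le_trans (rnorm_orth_proj dot_norm one _) _.
apply: le_trans (opnormP _ bT) _.
by rewrite ler_wpM2l ?opnorm_ge0 ?rnorm_orth_proj.
Qed.

Lemma compressE T x : bounded_op T -> compress T x = \sum_(i : 'I_n * 'I_n)
  (dot x (e i.2) * dot (T (e i.2)) (e i.1)) *: e i.1.
Proof.
move=> bT; rewrite -(pair_bigA _ (fun l m : 'I_n => (dot x (e m) * dot (T (e m)) (e l)) *: e l)) /=.
apply: eq_bigr => l _; rewrite -scaler_suml; congr (_ *: _).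
rewrite /orth_proj (bop_sum bT) dot_suml; apply: eq_bigr => m _.
by rewrite (bopZ bT) dotZl.
Qed.

End Compression.

Context {d1 d2 d3 : measure_display}.
Context {X1 : measurableType d1} {X2 : measurableType d2} {X3 : measurableType d3}.
Variables (E1 : spectral_measure dot X1) (E2 : spectral_measure dot X2).
Variable E3 : spectral_measure dot X3.
Local Notation rep := (bounded_rep E1 E2 E3).

(** Each compression is a sum of rank-one operators, so the partial sum is a combination of rank-one
    ones with a number of terms and coefficients that do not depend on [N] or on [D]. *)
Lemma rep_sum_compress (D : rep) n e T Q u v N : bounded_op T -> bounded_op Q ->
  rep_sum D (compress n e T) (compress n e Q) u v N =
  \sum_(i : ('I_n * 'I_n) * ('I_n * 'I_n))
    (dot (T (e i.1.2)) (e i.1.1) * dot (Q (e i.2.2)) (e i.2.1)) *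
    \sum_(j < N) \sum_(k < N) dot (opA D j (e i.1.1)) v *
       dot (opB D j k (e i.2.1)) (e i.1.2) * dot (opC D k u) (e i.2.2).
Proof.
move=> bT bQ; under [RHS]eq_bigr do rewrite mulr_sumr.
rewrite [RHS]exchange_big /=; apply: eq_bigr => j _.
under [RHS]eq_bigr do rewrite mulr_sumr.
rewrite [RHS]exchange_big /=; apply: eq_bigr => k _.
have bA := bounded_op_opA dot_norm D j; have bB := bounded_op_opB dot_norm D j k.
rewrite (compressE _ e _ bT) (bop_sum bA) dot_suml.
rewrite -(pair_bigA _ (fun i1 i2 : 'I_n * 'I_n =>
  dot (T (e i1.2)) (e i1.1) * dot (Q (e i2.2)) (e i2.1) *
  (dot (opA D j (e i1.1)) v * dot (opB D j k (e i2.1)) (e i1.2) * dot (opC D k u) (e i2.2)))) /=.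
apply: eq_bigr => i1 _; rewrite (bopZ bA) dotZl.
rewrite (compressE _ e _ bQ) (bop_sum bB) dot_suml !mulr_suml.
by apply: eq_bigr => i2 _; rewrite (bopZ bB) dotZl; ring.
Qed.

Section TwoRepresentations.
Variables D D' : rep.
Hypothesis same : exists N1 N2 N3,
  [/\ spectral_null E1 N1, spectral_null E2 N2, spectral_null E3 N3
    & forall x1 x2 x3, ~ N1 x1 -> ~ N2 x2 -> ~ N3 x3 -> vanishes (fun n =>
      \sum_(j < n) \sum_(k < n) rep_a D j x1 * rep_b D j k x2 * rep_c D k x3 -
      \sum_(j < n) \sum_(k < n) rep_a D' j x1 * rep_b D' j k x2 * rep_c D' k x3)].
Variables T Q : H -> H.
Hypotheses (bT : bounded_op T) (bQ : bounded_op Q).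
Variables u v : H.

Lemma rep_sum_compress_indep n e : vanishes (fun N =>
  rep_sum D (compress n e T) (compress n e Q) u v N -
  rep_sum D' (compress n e T) (compress n e Q) u v N).
Proof.
under eq_fun do rewrite !rep_sum_compress // -sumrB.
apply: vanishes_sum => i; under eq_fun do rewrite -mulrBr.
by apply: vanishesZ; exact: rep_sum_rank1.
Qed.

(** All the vectors that [Q] or [T] receives, returns or is tested against in the partial sum of
    length [M]; a projection fixing them leaves that sum unchanged by compression. *)
Definition rep_vectors (D0 : rep) M : seq H :=
  [seq opC D0 k u | k <- iota 0 M] ++ [seq Q (opC D0 k u) | k <- iota 0 M] ++
  [seq opA_adj D0 j v | j <- iota 0 M] ++
  [seq opB D0 j k (Q (opC D0 k u)) | j <- iota 0 M, k <- iota 0 M].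

Lemma rep_sum_compress_fix (D0 : rep) M n e :
  (forall x, x \in rep_vectors D0 M -> orth_proj dot n e x = x) ->
  rep_sum D0 (compress n e T) (compress n e Q) u v M = rep_sum D0 T Q u v M.
Proof.
move=> fixv; rewrite !rep_sumE //; apply: eq_bigr => j _; apply: eq_bigr => k _.
have ji : (j : nat) \in iota 0 M by rewrite mem_iota /=.
have ki : (k : nat) \in iota 0 M by rewrite mem_iota /=.
have fC : orth_proj dot n e (opC D0 k u) = opC D0 k u.
  by apply: fixv; rewrite mem_cat (map_f (fun k => opC D0 k u)).
have fQ : orth_proj dot n e (Q (opC D0 k u)) = Q (opC D0 k u).
  by apply: fixv; rewrite !mem_cat (map_f (fun k => Q (opC D0 k u))) ?orbT.
have fA : orth_proj dot n e (opA_adj D0 j v) = opA_adj D0 j v.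
  by apply: fixv; rewrite !mem_cat (map_f (fun j => opA_adj D0 j v)) ?orbT.
have fB : orth_proj dot n e (opB D0 j k (Q (opC D0 k u))) = opB D0 j k (Q (opC D0 k u)).
  apply: fixv; rewrite !mem_cat.
  by rewrite (allpairs_f (fun j k => opB D0 j k (Q (opC D0 k u)))) ?orbT.
by rewrite /compress fC fQ fB orth_proj_sym fA.
Qed.

(** [M] is chosen before [T0] and [Q0]: one cutoff serves the original operators and any compression
    of them. *)
Lemma rep_sum_tail_small (D0 : rep) (tau : R) : 0 < tau ->
  exists M, forall m, (M <= m)%N -> forall n, (m <= n)%N ->
    forall T0 Q0, bounded_op T0 -> bounded_op Q0 ->
    opnorm T0 <= opnorm T -> opnorm Q0 <= opnorm Q ->
    cmod (rep_sum D0 T0 Q0 u v n - rep_sum D0 T0 Q0 u v m) <=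
      opnorm T * rep_beta D0 * opnorm Q *
      (rep_alpha D0 * rnorm v + rep_gamma D0 * rnorm u) * tau.
Proof.
move=> tau0; have tau2 : 0 < tau ^+ 2 by rewrite exprn_gt0.
have incr (F : nat -> H) n : \sum_(k < n) rnorm (F k) ^+ 2 <= \sum_(k < n.+1) rnorm (F k) ^+ 2.
  by rewrite big_ord_recr lerDl sqr_ge0.
have [M1 h1] := tail_small (incr (opC D0 ^~ u)) (fun n => column_opC dot_norm D0 n u) tau2.
have [M2 h2] := tail_small (incr (opA_adj D0 ^~ v)) (fun n => column_opA_adj dot_norm D0 n v) tau2.
exists (maxn M1 M2) => m; rewrite geq_max => /andP[m1 m2] n mn T0 Q0 bT0 bQ0 leT leQ.
apply: le_trans (rep_sum_tail dot_norm bT0 bQ0 mn (ltW tau0) (h1 m n m1) (h2 m n m2)) _.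
have ab : 0 <= rep_alpha D0 * rnorm v + rep_gamma D0 * rnorm u.
  by rewrite addr_ge0 // mulr_ge0 ?rnorm_ge0 // ltW ?rep_alpha0 ?rep_gamma0.
have b0 := ltW (rep_beta0 D0).
rewrite ler_wpM2r ?(ltW tau0) // ler_wpM2r // ler_pM ?mulr_ge0 ?opnorm_ge0 //.
by rewrite ler_wpM2r.
Qed.

(** First [M] makes the tails small, then [e] spans the vectors met up to [M], then [N] makes the
    compressed difference small. At length [M] compression changes nothing, and from [M] to [N] each
    sum moves by at most a tail. *)
Lemma rep_sum_indep : vanishes (fun N => rep_sum D T Q u v N - rep_sum D' T Q u v N).
Proof.
move=> eps eps0.
pose G (D0 : rep) := opnorm T * rep_beta D0 * opnorm Q *
      (rep_alpha D0 * rnorm v + rep_gamma D0 * rnorm u).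
have G0 (D0 : rep) : 0 <= G D0.
  rewrite mulr_ge0 ?addr_ge0 ?mulr_ge0 ?opnorm_ge0 ?rnorm_ge0 //;
    by rewrite ltW // ?rep_alpha0 ?rep_gamma0 ?rep_beta0.
(* Four tails occur, two for each representation; together they take [eps / 2], the compressed
   difference the other half. *)
pose K := 2 * (G D + G D') + 1.
have K0 : 0 < K by rewrite ltr_wpDl // mulr_ge0 // addr_ge0.
have tau0 : 0 < eps / 2 / K by rewrite !divr_gt0.
set tau := eps / 2 / K in tau0.
have tauK : K * tau = eps / 2 by rewrite mulrC divfK // gt_eqF.
have [M1 h1] := rep_sum_tail_small D tau0; have [M2 h2] := rep_sum_tail_small D' tau0.
pose M := maxn M1 M2.
have [n [e [one he]]] := gram_schmidt dot_norm (rep_vectors D M ++ rep_vectors D' M).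
have fixD : rep_sum D (compress n e T) (compress n e Q) u v M = rep_sum D T Q u v M.
  by apply: rep_sum_compress_fix => x xD; apply: he; rewrite mem_cat xD.
have fixD' : rep_sum D' (compress n e T) (compress n e Q) u v M = rep_sum D' T Q u v M.
  by apply: rep_sum_compress_fix => x xD; apply: he; rewrite mem_cat xD orbT.
have e2 : 0 < eps / 2 by rewrite divr_gt0.
have [N0 hN0] := rep_sum_compress_indep n e e2.
have bT' := bounded_compress n e bT; have bQ' := bounded_compress n e bQ.
have leT' := opnorm_compress bT one; have leQ' := opnorm_compress bQ one.
exists (maxn M N0) => N; rewrite geq_max => /andP[MN /hN0 hN].
have t1 := h1 M (leq_maxl _ _) N MN T Q bT bQ (lexx _) (lexx _).
have t2 := h1 M (leq_maxl _ _) N MN _ _ bT' bQ' leT' leQ'.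
have t3 := h2 M (leq_maxr _ _) N MN T Q bT bQ (lexx _) (lexx _).
have t4 := h2 M (leq_maxr _ _) N MN _ _ bT' bQ' leT' leQ'.
rewrite -/(G D) fixD in t1 t2; rewrite -/(G D') fixD' in t3 t4.
set x := rep_sum D T Q u v N; set x' := rep_sum D' T Q u v N.
set y := rep_sum D _ _ u v N in hN t2; set y' := rep_sum D' _ _ u v N in hN t4.
set z := rep_sum D T Q u v M in t1 t2; set z' := rep_sum D' T Q u v M in t3 t4.
have -> : x - x' = (x - z) - (y - z) + (y - y') + ((y' - z') - (x' - z')) by ring.
apply: le_trans (cmodD _ _) _.
apply: le_trans (lerD (cmodD _ _) (cmodB _ _)) _.
apply: le_trans (lerD (lerD (cmodB _ _) (lexx _)) (lexx _)) _.
move: t1 t2 t3 t4; rewrite -/x -/x' => t1 t2 t3 t4.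
have := ltW tau0; rewrite /K in tauK; lra.
Qed.

End TwoRepresentations.

(** A strict majorant of the infimum dominates some essential bound, so the infimum need not be
    shown to be attained. *)
Lemma Linf_l2_bound d (X : measurableType d) (E : spectral_measure dot X)
    (a : nat -> X -> C) (alpha : R) : (Linf_l2_norm E a < alpha%:E)%E ->
  exists2 N, spectral_null E N &
    forall x, ~ N x -> forall n, \sum_(j < n) cmod (a j x) ^+ 2 <= alpha ^+ 2.
Proof.
move=> /ereal_inf_lt[M [M0 [N nN hN]] Ma]; exists N => // x /hN xM n.
have a0 : 0 <= alpha by rewrite -lee_fin; exact: le_trans M0 (ltW Ma).
have /(l2norm_le _ a0) : (l2norm (a ^~ x) <= alpha%:E)%E.
  exact: le_trans xM (ltW Ma).
exact.
Qed.

(** [xi] is padded with zeros to a sequence in l^2, whose row series are eventually constant; the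
    bound on the image is then paired with [eta] by Cauchy-Schwarz. *)
Lemma l2_matrix_form_bound (b : nat -> nat -> C) (M : R) m n :
  l2_matrix_bound b M -> form_bound (fun (j : 'I_m) (k : 'I_n) => b j k) M.
Proof.
move=> [M0 hb] xi eta Y Z Y0 Z0 hxi heta.
pose x k : C := if insub k is Some i then xi i else 0.
have xE (i : 'I_n) : x i = xi i by rewrite /x valK.
have x0 k : (n <= k)%N -> x k = 0 by move=> nk; rewrite /x insubF // ltnNge nk.
have sum_x (V : nmodType) (F : nat -> V) N : (forall k, (n <= k)%N -> F k = 0) ->
    (n <= N)%N -> \sum_(k < N) F k = \sum_(k < n) F k.
  move=> F0 nN; rewrite (big_ord_widen _ F nN) [RHS]big_mkcond /=.
  by apply: eq_bigr => k _; case: ltnP => // /F0.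
have xY : (l2norm x <= Y%:E)%E.
  apply/(l2norm_le _ Y0) => N; apply: le_trans hxi.
  have -> : \sum_(k < n) cmod (xi k) ^+ 2 = \sum_(k < n) cmod (x k) ^+ 2.
    by apply: eq_bigr => i _; rewrite xE.
  rewrite -(@sum_x _ (fun k => cmod (x k) ^+ 2) (maxn n N)) ?leq_maxl //; last first.
    by move=> k /x0 ->; rewrite cmod0 expr0n.
  rewrite (big_ord_widen _ (fun k => cmod (x k) ^+ 2) (leq_maxr n N)) big_mkcond.
  by apply: ler_sum => k _; case: ifP => // _; exact: sqr_ge0.
have [_] := hb x (le_lt_trans xY (ltry Y)).
have rowE j : limn (series (fun k => b j k * x k : C^o)) = \sum_(k < n) b j k * x k.
  apply/cvg_lim; first exact: norm_hausdorff.
  apply: cvg_near_cst; exists n => // N /= nN; rewrite /series /= big_mkord.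
  by apply: (@sum_x C (fun k => b j k * x k)) => // k /x0 ->; rewrite mulr0.
rewrite /= (funext rowE).
have MY0 : 0 <= M * Y by rewrite mulr_ge0.
move=> h; have {h} /(l2norm_le _ MY0) h :
    (l2norm (fun j => \sum_(k < n) b j k * x k)%R <= (M * Y)%:E)%E.
  by apply: le_trans h _; rewrite EFinM lee_wpmul2l // lee_fin.
apply: (@le_trans _ _ (\sum_(j < m) cmod (\sum_(k < n) b j k * x k) * cmod (eta j))).
  apply: le_trans (cmod_sum _ _ _) _; apply: ler_sum => j _.
  rewrite -cmodM mulr_suml le_eqVlt; apply/orP; left; apply/eqP; congr cmod.
  by apply: eq_bigr => k _; rewrite xE mulrA.
by rewrite mulrA; apply: cauchy_schwarz_sum => //; exact: h.
Qed.

Lemma form_bound_le (J K : finType) (b : J -> K -> C) (M beta : R) : M <= beta ->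
  form_bound b M -> form_bound b beta.
Proof.
move=> Mb hb xi eta Y Z Y0 Z0 hxi heta; apply: le_trans (hb xi eta Y Z Y0 Z0 hxi heta) _.
by rewrite ler_wpM2r ?mulr_ge0.
Qed.

Lemma Linf_matrix_bound d (X : measurableType d) (E : spectral_measure dot X)
    (b : nat -> nat -> X -> C) (beta : R) : (Linf_matrix_norm E b < beta%:E)%E ->
  exists2 N, spectral_null E N & forall x, ~ N x -> forall m n,
    form_bound (fun (j : 'I_m) (k : 'I_n) => b j k x) beta.
Proof.
move=> /ereal_inf_lt[M [M0 [N nN hN]] Mb]; exists N => // x /hN xM m n.
have /ereal_inf_lt[_ [M' hM' <-]] := le_lt_trans xM Mb.
rewrite lte_fin => /ltW Mb'; apply: (form_bound_le Mb').
exact: (l2_matrix_form_bound (b := fun j k => b j k x)).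
Qed.

Lemma spectral_ess_sup_ge0 d (X : measurableType d) (E : spectral_measure dot X)
  (f : X -> \bar R) : (0 <= spectral_ess_sup E f)%E.
Proof. by apply: le_ereal_inf_tmp => M []. Qed.

Lemma bounded_rep_of (Psi : X1 -> X2 -> X3 -> C) a b c (alpha beta gamma : R) :
  haagerup_representation E1 E2 E3 Psi a b c ->
  (Linf_l2_norm E1 a < alpha%:E)%E -> (Linf_matrix_norm E2 b < beta%:E)%E ->
  (Linf_l2_norm E3 c < gamma%:E)%E ->
  exists D : rep, [/\ rep_a D = a, rep_b D = b & rep_c D = c] /\
    [/\ rep_alpha D = alpha, rep_beta D = beta & rep_gamma D = gamma].
Proof.
move=> [[ma _] [mb _] [mc _] _] ha hb hc.
have pos (x : \bar R) (r : R) : (0 <= x)%E -> (x < r%:E)%E -> 0 < r.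
  by move=> x0 xr; rewrite -lte_fin; exact: le_lt_trans x0 xr.
have [N1 n1 h1] := Linf_l2_bound ha; have [N2 n2 h2] := Linf_matrix_bound hb.
have [N3 n3 h3] := Linf_l2_bound hc.
have a0 := pos _ _ (spectral_ess_sup_ge0 _ _) ha.
have b0 := pos _ _ (spectral_ess_sup_ge0 _ _) hb.
have c0 := pos _ _ (spectral_ess_sup_ge0 _ _) hc.
by exists (@BoundedRep _ _ _ _ _ _ _ _ _ E1 E2 E3 a b c alpha beta gamma N1 N2 N3
  a0 b0 c0 n1 n2 n3 ma mb mc h1 h2 h3).
Qed.

(** [W] comes with a representation of its own, for which any finite majorants will do; independence
    transfers the convergence to the given [D]. *)
Lemma triple_operator_integral_rep_sum (Psi : X1 -> X2 -> X3 -> C) T Q W a b c (D : rep) :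
  bounded_op T -> bounded_op Q -> triple_operator_integral E1 E2 E3 Psi T Q W ->
  haagerup_representation E1 E2 E3 Psi a b c ->
  [/\ rep_a D = a, rep_b D = b & rep_c D = c] ->
  forall u v, vanishes (fun N => rep_sum D T Q u v N - dot (W u) v).
Proof.
move=> bT bQ [bW [a' [b' [c' [rep' hW]]]]] rep [Da Db Dc] u v.
have [[_ fa] [_ fb] [_ fc] _] := rep'.
have real_ub (x : \bar R) : (0 <= x)%E -> (x < +oo)%E -> exists r : R, (x < r%:E)%E.
  move=> x0 xoo; exists (fine x + 1); rewrite -(@fineK _ x) ?ge0_fin_numE //.
  by rewrite lte_fin ltrDl.
have [alpha ha] := real_ub _ (spectral_ess_sup_ge0 _ _) fa.
have [beta hb] := real_ub _ (spectral_ess_sup_ge0 _ _) fb.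
have [gamma hc] := real_ub _ (spectral_ess_sup_ge0 _ _) fc.
have [D' [[Da' Db' Dc'] _]] := bounded_rep_of rep' ha hb hc.
have := double_sum_to_vanishes (hW u v); rewrite -Da' -Db' -Dc' => /vanishesD h.
have same : exists N1 N2 N3,
  [/\ spectral_null E1 N1, spectral_null E2 N2, spectral_null E3 N3
    & forall x1 x2 x3, ~ N1 x1 -> ~ N2 x2 -> ~ N3 x3 -> vanishes (fun n =>
      \sum_(j < n) \sum_(k < n) rep_a D j x1 * rep_b D j k x2 * rep_c D k x3 -
      \sum_(j < n) \sum_(k < n) rep_a D' j x1 * rep_b D' j k x2 * rep_c D' k x3)].
  have [_ _ _ [M1 [M2 [M3 [m1 m2 m3 hM]]]]] := rep.
  have [_ _ _ [M1' [M2' [M3' [m1' m2' m3' hM']]]]] := rep'.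
  exists (M1 `|` M1'), (M2 `|` M2'), (M3 `|` M3'); split; try exact: spectral_nullU.
  move=> x1 x2 x3 /not_orP[p1 p1'] /not_orP[p2 p2'] /not_orP[p3 p3'].
  have /double_sum_to_vanishes v1 := hM x1 x2 x3 p1 p2 p3.
  have /double_sum_to_vanishes/(vanishesZ (-1)) v2 := hM' x1 x2 x3 p1' p2' p3'.
  have := vanishesD v1 v2; rewrite Da Db Dc Da' Db' Dc'.
  by under eq_fun do rewrite mulN1r opprB addrA subrK.
have := h _ (rep_sum_indep same bT bQ u v).
by under eq_fun do rewrite addrC addrA subrK.
Qed.

End Independence.

(** * Schatten norm estimates *)

Section DiagonalEstimate.
Context {R : realType} {H : completeNormedModType R[i]}.
Variable dot : {dot H for @Num.conj R[i]}.
Hypothesis dot_norm : forall u : H, dot u u = `|u| ^+ 2.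
Local Notation C := R[i].

(** [approx_svd] for [W] supplies test families whose diagonal entries nearly reach the singular
    values. If the last singular value is zero it adds nothing to the sum; otherwise it bounds the
    others from below, so an additive error becomes a relative one. *)
Lemma schatten_norm_le_diag (W : H -> H) (r K : R) : bounded_op W -> 0 < r -> 0 <= K ->
  (forall n e f, orthonormal_fam dot n e -> orthonormal_fam dot n f ->
     forall eps : R, 0 < eps -> exists z : 'I_n -> R,
     [/\ forall i, 0 <= z i, \sum_i z i `^ r <= K `^ r &
         forall i : 'I_n, cmod (dot (W (e i)) (f i)) <= z i + eps]) ->
  (schatten_norm r W <= K%:E)%E.
Proof.
move=> bW r0 K0 hK; apply: schatten_norm_le => //; elim=> [|n IH].
  by rewrite big_ord0 powR_ge0.
have [sn0|sn0] := eqVneq (singular_value W n) 0.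
  by rewrite big_ord_recr /= sn0 powR0 ?gt_eqF // addr0.
have snp : 0 < singular_value W n by rewrite lt_def sn0 singular_value_ge0.
have sn_le i : (i < n.+1)%N -> singular_value W n <= singular_value W i.
  by rewrite ltnS => /singular_value_nonincreasing.
have sp i : (i < n.+1)%N -> 0 < singular_value W i.
  by move=> /sn_le; exact: lt_le_trans.
set S := \sum_(i < n.+1) _.
have S0 : 0 <= S by apply: sumr_ge0 => i _; exact: powR_ge0.
pose V := S `^ r^-1.
have V0 : 0 <= V by exact: powR_ge0.
have VS : V `^ r = S by rewrite /V -powRrM mulVf ?gt_eqF // powRr1.
rewrite -VS; apply: ler_powRl; rewrite ?(ltW r0) //.
apply: (@le_of_eps _ _ _ V) => // theta theta0.
have [theta1|theta1] := leP 1 theta.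
  by apply: le_trans (_ : theta * V <= _); rewrite ?lerDr // ler_peMl.
(* This error occurs twice, in [approx_svd] and in [hz], so [z i] is at least [s_i - theta * s_n],
   hence at least [(1 - theta) * s_i]. Summing powers gives [(1 - theta) * V <= K] for every [theta]
   below 1. *)
pose eps := theta * singular_value W n / 2.
have eps0 : 0 < eps by rewrite divr_gt0 ?mulr_gt0.
have [e [f [one onf hef _]]] := approx_svd dot_norm bW eps0 sp.
have [z [z0 zK hz]] := hK _ _ _ one onf _ eps0.
have t1 : 0 <= 1 - theta by rewrite subr_ge0 ltW.
suff : (1 - theta) * V <= K by lra.
apply: (ler_powR_inv r0) => //; first by rewrite mulr_ge0.
apply: le_trans zK; rewrite powRM // VS mulr_sumr; apply: ler_sum => i _.
rewrite -powRM ?singular_value_ge0 //; apply: ler_powRl; rewrite ?(ltW r0) //.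
  by rewrite mulr_ge0 ?singular_value_ge0.
have := hz i; have := hef i (ltn_ord i); have := sn_le i (ltn_ord i).
rewrite /eps => h1 h2 h3.
have : theta * singular_value W n <= theta * singular_value W i by rewrite ler_wpM2l // ltW.
lra.
Qed.

Definition svd_sum n (s : nat -> R) (g h : nat -> H) x :=
  \sum_(m < n) ((s m)%:C * dot x (g m)) *: h m.

Lemma bounded_svd_sum n s g h : bounded_op (svd_sum n s g h).
Proof.
apply: bounded_op_sum => m _.
under eq_fun do rewrite -scalerA; apply: bounded_opZ.
exact: bounded_op_rank1.
Qed.

Lemma svd_sum_adjoint n s g h x y :
  dot (svd_sum n s g h x) y = dot x (svd_sum n s h g y).
Proof.
rewrite dot_suml dot_sumr; apply: eq_bigr => m _.
by rewrite dotZl dotZr rmorphM /= conj_real -dot_conj; ring.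
Qed.

Lemma schatten_approx_svd (T : H -> H) (p K delta : R) : bounded_op T -> 0 < p ->
  (forall n, \sum_(i < n) singular_value T i `^ p <= K `^ p) -> 0 < delta ->
  exists n g h, [/\ orthonormal_fam dot n g, orthonormal_fam dot n h &
    opnorm (fun x => T x - svd_sum n (singular_value T) g h x) <= delta].
Proof.
move=> bT p0 hK d0; have d2 : 0 < delta / 2 by rewrite divr_gt0.
have [n [sn spos]] := schatten_singular_value_small p0 d2 hK.
have [g [h [ong onh _ Tgh]]] := approx_svd dot_norm bT d2 spos.
exists n, g, h; split=> //; apply: opnorm_le => [|x]; first exact: ltW.
by apply: le_trans (Tgh x) _; rewrite ler_wpM2r ?rnorm_ge0 //; lra.
Qed.

(* The numbers [w i l := \sum_k |dot (P k (e i)) (g l)|^2] form a matrix whose row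
   and column sums are at most [gamma^2]. *)
Lemma column_power (L : finType) (P P' : L -> H -> H) (gamma q : R) n e m g h
    (s : nat -> R) : 0 < gamma -> 2 <= q ->
  (forall k u v, dot (P k u) v = dot u (P' k v)) ->
  (forall u, \sum_k rnorm (P k u) ^+ 2 <= (gamma * rnorm u) ^+ 2) ->
  (forall u, \sum_k rnorm (P' k u) ^+ 2 <= (gamma * rnorm u) ^+ 2) ->
  orthonormal_fam dot n e -> orthonormal_fam dot m g -> orthonormal_fam dot m h ->
  (forall i, 0 <= s i) ->
  \sum_(i < n) Num.sqrt (\sum_k rnorm (svd_sum m s g h (P k (e i))) ^+ 2) `^ q <=
    gamma `^ q * \sum_(i < m) s i `^ q.
Proof.
move=> g0 q2 adj colP colP' one ong onh s0.
apply: (@substochastic_powR _ 'I_n 'I_m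
  (fun i l => \sum_k cmod (dot (P k (e i)) (g l)) ^+ 2)
  (fun i => Num.sqrt (\sum_k rnorm (svd_sum m s g h (P k (e i))) ^+ 2))
  (fun l => s l)) => // [i l|i|l|i].
- by apply: sumr_ge0 => k _; exact: sqr_ge0.
- rewrite exchange_big /=; have := colP (e i); rewrite (rnorm_fam dot_norm one) // mulr1.
  by apply: le_trans; apply: ler_sum => k _; exact: bessel.
- rewrite exchange_big /=; have := colP' (g l); rewrite (rnorm_fam dot_norm ong) // mulr1.
  apply: le_trans; apply: ler_sum => k _.
  under eq_bigr do rewrite adj dot_conj cmod_conj.
  exact: bessel.
- rewrite sqr_sqrtr; last by apply: sumr_ge0 => k _; exact: sqr_ge0.
  under [leRHS]eq_bigr do rewrite mulr_suml.
  rewrite exchange_big /=; apply: ler_sum => k _.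
  rewrite (rnorm2_comb dot_norm onh (fun l => (s l)%:C * dot (P k (e i)) (g l))).
  apply: ler_sum => l _.
  by rewrite cmodM exprMn cmod_real (ger0_norm (s0 l)) mulrC.
Qed.

End DiagonalEstimate.

Lemma vanishes_uniform (R : realType) n (F : 'I_n -> nat -> R[i]) (eps : R) :
  (forall i, vanishes (F i)) -> 0 < eps -> exists N, forall i, cmod (F i N) <= eps.
Proof.
move=> hF eps0; have [N hN] := choice (fun i => hF i eps eps0).
exists (\max_i N i)%N => i; apply: hN; exact: leq_bigmax.
Qed.

Lemma small_factor (R : realType) (c eps : R) : 0 <= c -> 0 < eps ->
  exists2 delta, 0 < delta & c * delta <= eps.
Proof.
move=> c0 eps0; have c1 : 0 < c + 1 by rewrite ltr_wpDl.
exists (eps / (c + 1)); first by rewrite divr_gt0.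
by rewrite mulrCA ger_pMr // ler_pdivrMr // mul1r lerDl.
Qed.

Section TripleEstimates.
Context {R : realType} {H : completeNormedModType R[i]}.
Context {dot : {dot H for @Num.conj R[i]}}.
Hypothesis dot_norm : forall u : H, dot u u = `|u| ^+ 2.
Local Notation C := R[i].
Context {d1 d2 d3 : measure_display}.
Context {X1 : measurableType d1} {X2 : measurableType d2} {X3 : measurableType d3}.
Variables (E1 : spectral_measure dot X1) (E2 : spectral_measure dot X2).
Variable E3 : spectral_measure dot X3.
Variable D : bounded_rep E1 E2 E3.
Local Notation alpha := (rep_alpha D).
Local Notation beta := (rep_beta D).
Local Notation gamma := (rep_gamma D).
Implicit Types (T Q : H -> H) (u v : H).

Let alpha0 : 0 <= alpha. Proof. exact/ltW/rep_alpha0. Qed.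
Let beta0 : 0 <= beta. Proof. exact/ltW/rep_beta0. Qed.
Let gamma0 : 0 <= gamma. Proof. exact/ltW/rep_gamma0. Qed.

(** Uniformity in [N] is the point: it bounds the cost of replacing [T] or [Q] by an approximant
    after [N] has been fixed. *)
Lemma rep_sum_unit_bound T Q u v N : bounded_op T -> bounded_op Q ->
  rnorm u = 1 -> rnorm v = 1 ->
  cmod (rep_sum D T Q u v N) <= opnorm T * opnorm Q * (alpha * beta * gamma).
Proof.
move=> bT bQ u1 v1; rewrite rep_sumE //.
have := rep_form_bound dot_norm D bT bQ (p := opC D ^~ u) (q := opA_adj D ^~ v) (n := N)
  gamma0 alpha0.
have := column_opC dot_norm D N u; have := column_opA_adj dot_norm D N v.
rewrite u1 v1 !mulr1 => hA hC /(_ hC hA); lra.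
Qed.

Lemma rep_sumBl T T0 Q u v N : bounded_op T -> bounded_op T0 ->
  rep_sum D T Q u v N = rep_sum D T0 Q u v N + rep_sum D (fun x => T x - T0 x) Q u v N.
Proof.
move=> bT bT0; rewrite /rep_sum -big_split; apply: eq_bigr => j _.
rewrite -big_split; apply: eq_bigr => k _ /=.
by rewrite -dotDl -(bopD (bounded_op_opA dot_norm D j)) addrC subrK.
Qed.

Lemma rep_sumBr T Q Q0 u v N : bounded_op T ->
  rep_sum D T Q u v N = rep_sum D T Q0 u v N + rep_sum D T (fun x => Q x - Q0 x) u v N.
Proof.
move=> bT; rewrite /rep_sum -big_split; apply: eq_bigr => j _.
rewrite -big_split; apply: eq_bigr => k _ /=.
rewrite -dotDl -(bopD (bounded_op_opA dot_norm D j)) -(bopD bT).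
by rewrite -(bopD (bounded_op_opB dot_norm D j k)) addrC subrK.
Qed.

Definition right_column Q u N := Num.sqrt (\sum_(k < N) rnorm (Q (opC D k u)) ^+ 2).
Definition left_column T' v N := Num.sqrt (\sum_(j < N) rnorm (T' (opA_adj D j v)) ^+ 2).

Lemma right_column_sqr Q u N :
  \sum_(k < N) rnorm (Q (opC D k u)) ^+ 2 = right_column Q u N ^+ 2.
Proof. by rewrite sqr_sqrtr // sumr_ge0 // => k _; exact: sqr_ge0. Qed.

Lemma left_column_sqr T' v N :
  \sum_(k < N) rnorm (T' (opA_adj D k v)) ^+ 2 = left_column T' v N ^+ 2.
Proof. by rewrite sqr_sqrtr // sumr_ge0 // => k _; exact: sqr_ge0. Qed.

Lemma right_column_le Q u N : bounded_op Q -> rnorm u = 1 ->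
  right_column Q u N <= opnorm Q * gamma.
Proof.
move=> bQ u1; rewrite -(@ler_pXn2r _ 2) ?nnegrE ?sqrtr_ge0 ?mulr_ge0 ?opnorm_ge0 //.
rewrite -right_column_sqr exprMn; have := column_opC dot_norm D N u.
rewrite u1 mulr1 => /(ler_wpM2l (sqr_ge0 (opnorm Q))); apply: le_trans.
rewrite mulr_sumr; apply: ler_sum => k _.
by rewrite -exprMn ler_pXn2r ?nnegrE ?mulr_ge0 ?opnorm_ge0 ?rnorm_ge0 ?opnormP.
Qed.

Lemma rep_sum_right_column T Q u v N : bounded_op T -> rnorm v = 1 ->
  cmod (rep_sum D T Q u v N) <= opnorm T * beta * alpha * right_column Q u N.
Proof.
move=> bT v1; rewrite rep_sumE // -mulrA [alpha * _]mulrC.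
apply: (opTB_form_bound dot_norm D (y := fun k => Q (opC D k u)) (z := opA_adj D ^~ v)) => //.
- exact: sqrtr_ge0.
- by rewrite right_column_sqr.
- by have := column_opA_adj dot_norm D N v; rewrite v1 mulr1.
Qed.

(** The adjoint is a parameter because it is supplied only for [svd_sum], where it is obtained by
    exchanging the two families. *)
Lemma rep_sum_columns T T' Q u v N : (forall x y, dot (T x) y = dot x (T' y)) ->
  cmod (rep_sum D T Q u v N) <= beta * (right_column Q u N * left_column T' v N).
Proof.
move=> adj; rewrite rep_sumE // /rep_form.
under eq_bigr do under eq_bigr do rewrite adj.
apply: (opB_form_bound dot_norm D (y := fun k => Q (opC D k u))
  (z := fun j => T' (opA_adj D j v))); rewrite ?sqrtr_ge0 //.
- by rewrite right_column_sqr.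
- by rewrite left_column_sqr.
Qed.

Lemma right_column_power n e m g h s q N : 2 <= q -> orthonormal_fam dot n e ->
  orthonormal_fam dot m g -> orthonormal_fam dot m h -> (forall i, 0 <= s i) ->
  \sum_(i < n) right_column (svd_sum dot m s g h) (e i) N `^ q <=
    gamma `^ q * \sum_(i < m) s i `^ q.
Proof.
move=> q2 one ong onh s0.
apply: (column_power dot_norm (P := fun k : 'I_N => opC D k)
  (P' := fun k : 'I_N => opC_adj D k) (rep_gamma0 D) q2) => //.
- by move=> k u v; exact: dot_opC.
- by move=> u; exact: column_opC.
- by move=> u; exact: column_opC_adj.
Qed.

Lemma left_column_power n e m g h s q N : 2 <= q -> orthonormal_fam dot n e ->
  orthonormal_fam dot m g -> orthonormal_fam dot m h -> (forall i, 0 <= s i) ->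
  \sum_(i < n) left_column (svd_sum dot m s g h) (e i) N `^ q <=
    alpha `^ q * \sum_(i < m) s i `^ q.
Proof.
move=> q2 one ong onh s0.
apply: (column_power dot_norm (P := fun k : 'I_N => opA_adj D k)
  (P' := fun k : 'I_N => opA D k) (rep_alpha0 D) q2) => //.
- by move=> k u v; rewrite dot_conj -(dot_opA dot_norm) -dot_conj.
- by move=> u; exact: column_opA_adj.
- by move=> u; exact: column_opA.
Qed.

Section Target.
Variables T Q W : H -> H.
Hypotheses (bT : bounded_op T) (bQ : bounded_op Q) (bW : bounded_op W).
Hypothesis W_sum : forall u v, vanishes (fun N => rep_sum D T Q u v N - dot (W u) v).

Lemma approx_target n (e f : nat -> H) (eps : R) : 0 < eps ->
  exists N, forall i : 'I_n,
    cmod (dot (W (e i)) (f i)) <= cmod (rep_sum D T Q (e i) (f i) N) + eps.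
Proof.
move=> eps0.
have [N hN] := vanishes_uniform (fun i : 'I_n => W_sum (e i) (f i)) eps0.
exists N => i; set x := rep_sum _ _ _ _ _ _.
have -> : dot (W (e i)) (f i) = x - (x - dot (W (e i)) (f i)) by rewrite opprB addrC subrK.
apply: le_trans (cmodB _ _) _; rewrite lerD2l; exact: hN.
Qed.

(** [T] is only bounded, so the left side enters through [opnorm T * alpha]; only the right column
    is summed, by [right_column_power]. *)
Lemma schatten_right (p K : R) : 2 <= p -> 0 <= K ->
  (forall n, \sum_(i < n) singular_value Q i `^ p <= K `^ p) ->
  (schatten_norm p W <= (alpha * beta * gamma * (opnorm T * K))%:E)%E.
Proof.
move=> p2 K0 hK; have p0 : 0 < p by rewrite (lt_le_trans _ p2).
have oT := opnorm_ge0 T.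
apply: (schatten_norm_le_diag dot_norm bW p0) => [|n e f one onf eps eps0].
  by rewrite !mulr_ge0.
have e2 : 0 < eps / 2 by rewrite divr_gt0.
have [N hN] := approx_target n e f e2.
have c0 : 0 <= opnorm T * (alpha * beta * gamma) by rewrite !mulr_ge0.
have [delta d0 hdelta] := small_factor c0 e2.
have [m [g [h [ong onh Qgh]]]] := schatten_approx_svd dot_norm bQ p0 hK d0.
set Q0 := svd_sum _ _ _ _ _ in Qgh.
have bQ0 : bounded_op Q0 by exact: bounded_svd_sum.
exists (fun i => opnorm T * beta * alpha * right_column Q0 (e i) N); split=> [i||i].
- by rewrite !mulr_ge0 ?sqrtr_ge0.
- under eq_bigr do rewrite powRM ?mulr_ge0 ?sqrtr_ge0 //.
  rewrite -mulr_sumr.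
  have := right_column_power N p2 one ong onh (singular_value_ge0 ^~ Q).
  move=> /le_trans /(_ (ler_wpM2l (powR_ge0 _ _) (hK m))).
  move=> /(ler_wpM2l (powR_ge0 (opnorm T * beta * alpha) p)) /le_trans; apply.
  rewrite -!powRM ?mulr_ge0 // le_eqVlt; apply/orP; left; apply/eqP.
  by congr (_ `^ _); ring.
apply: le_trans (hN i) _; rewrite (@rep_sumBr T Q Q0) //.
have h1 := rep_sum_right_column Q0 (e i) N bT (rnorm_fam dot_norm onf (ltn_ord i)).
have h2 := rep_sum_unit_bound N bT (bounded_opB bQ bQ0)
  (rnorm_fam dot_norm one (ltn_ord i)) (rnorm_fam dot_norm onf (ltn_ord i)).
have h3 := ler_wpM2l c0 Qgh.
have h4 := cmodD (rep_sum D T Q0 (e i) (f i) N)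
  (rep_sum D T (fun x => Q x - Q0 x) (e i) (f i) N).
lra.
Qed.

(** The left column is summed after replacing [T] by a finite-rank [T0] with explicit adjoint [T0'];
    the right column enters through [opnorm Q * gamma]. *)
Lemma schatten_left (p K : R) : 2 <= p -> 0 <= K ->
  (forall n, \sum_(i < n) singular_value T i `^ p <= K `^ p) ->
  (schatten_norm p W <= (alpha * beta * gamma * (K * opnorm Q))%:E)%E.
Proof.
move=> p2 K0 hK; have p0 : 0 < p by rewrite (lt_le_trans _ p2).
have oQ := opnorm_ge0 Q.
apply: (schatten_norm_le_diag dot_norm bW p0) => [|n e f one onf eps eps0].
  by rewrite !mulr_ge0.
have e2 : 0 < eps / 2 by rewrite divr_gt0.
have [N hN] := approx_target n e f e2.
have c0 : 0 <= opnorm Q * (alpha * beta * gamma) by rewrite !mulr_ge0.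
have [delta d0 hdelta] := small_factor c0 e2.
have [m [g [h [ong onh Tgh]]]] := schatten_approx_svd dot_norm bT p0 hK d0.
set T0 := svd_sum _ _ _ _ _ in Tgh.
have bT0 : bounded_op T0 by exact: bounded_svd_sum.
pose T0' := svd_sum dot m (singular_value T) h g.
exists (fun i => beta * (opnorm Q * gamma) * left_column T0' (f i) N); split=> [i||i].
- by rewrite !mulr_ge0 ?sqrtr_ge0.
- under eq_bigr do rewrite powRM ?mulr_ge0 ?sqrtr_ge0 //.
  rewrite -mulr_sumr.
  have := left_column_power N p2 onf onh ong (singular_value_ge0 ^~ T).
  move=> /le_trans /(_ (ler_wpM2l (powR_ge0 _ _) (hK m))).
  move=> /(ler_wpM2l (powR_ge0 (beta * (opnorm Q * gamma)) p)) /le_trans; apply.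
  rewrite -!powRM ?mulr_ge0 // le_eqVlt; apply/orP; left; apply/eqP.
  by congr (_ `^ _); ring.
apply: le_trans (hN i) _; rewrite (@rep_sumBl T T0 Q) //.
have u1 := rnorm_fam dot_norm one (ltn_ord i).
have v1 := rnorm_fam dot_norm onf (ltn_ord i).
have h1 := rep_sum_columns Q (e i) (f i) N (svd_sum_adjoint dot m (singular_value T) g h).
have h1' : beta * (right_column Q (e i) N * left_column T0' (f i) N) <=
    beta * (opnorm Q * gamma) * left_column T0' (f i) N.
  rewrite -[leRHS]mulrA; apply: ler_wpM2l => //.
  by apply: ler_wpM2r; [exact: sqrtr_ge0|exact: right_column_le].
have h2 := rep_sum_unit_bound N (bounded_opB bT bT0) bQ u1 v1.
have h3 := ler_wpM2l c0 Tgh.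
have h4 := cmodD (rep_sum D T0 Q (e i) (f i) N)
  (rep_sum D (fun x => T x - T0 x) Q (e i) (f i) N).
move: h1; rewrite -/T0 -/T0' => h1; lra.
Qed.

Lemma schatten_both (p q r KT KQ : R) : 2 <= p -> 2 <= q -> 0 < r ->
  r^-1 = p^-1 + q^-1 -> 0 <= KT -> 0 <= KQ ->
  (forall n, \sum_(i < n) singular_value T i `^ p <= KT `^ p) ->
  (forall n, \sum_(i < n) singular_value Q i `^ q <= KQ `^ q) ->
  (schatten_norm r W <= (alpha * beta * gamma * (KT * KQ))%:E)%E.
Proof.
move=> p2 q2 r0 rpq KT0 KQ0 hT hQ.
have p0 : 0 < p by rewrite (lt_le_trans _ p2).
have q0 : 0 < q by rewrite (lt_le_trans _ q2).
apply: (schatten_norm_le_diag dot_norm bW r0) => [|n e f one onf eps eps0].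
  by rewrite !mulr_ge0.
(* One third each for approximating [W] by a partial sum, for replacing [Q] by [Q0], and for
   replacing [T] by [T0]. The last replacement meets [Q0], so [delta'] is chosen from
   [opnorm Q0]. *)
have e3 : 0 < eps / 3 by rewrite divr_gt0.
have [N hN] := approx_target n e f e3.
have abc0 : 0 <= alpha * beta * gamma by rewrite !mulr_ge0.
have c0 : 0 <= opnorm T * (alpha * beta * gamma) by rewrite mulr_ge0 ?opnorm_ge0.
have [delta d0 hdelta] := small_factor c0 e3.
have [m [g [h [ong onh Qgh]]]] := schatten_approx_svd dot_norm bQ q0 hQ d0.
set Q0 := svd_sum _ _ _ _ _ in Qgh.
have bQ0 : bounded_op Q0 by exact: bounded_svd_sum.
have c0' : 0 <= opnorm Q0 * (alpha * beta * gamma) by rewrite mulr_ge0 ?opnorm_ge0.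
have [delta' d0' hdelta'] := small_factor c0' e3.
have [m' [g' [h' [ong' onh' Tgh]]]] := schatten_approx_svd dot_norm bT p0 hT d0'.
set T0 := svd_sum _ _ _ _ _ in Tgh.
have bT0 : bounded_op T0 by exact: bounded_svd_sum.
pose T0' := svd_sum dot m' (singular_value T) h' g'.
exists (fun i => beta * (left_column T0' (f i) N * right_column Q0 (e i) N)); split=> [i||i].
- by rewrite !mulr_ge0 ?sqrtr_ge0.
- under eq_bigr do rewrite powRM ?mulr_ge0 ?sqrtr_ge0 //.
  rewrite -mulr_sumr.
  have hQ0 := right_column_power N q2 one ong onh (singular_value_ge0 ^~ Q).
  have hT0 := left_column_power N p2 onf onh' ong' (singular_value_ge0 ^~ T).
  have := @holder_sum R 'I_n (fun i => left_column T0' (f i) N)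
    (fun i => right_column Q0 (e i) N) (alpha * KT) (gamma * KQ) p q r.
  have -> : alpha * beta * gamma * (KT * KQ) = beta * (alpha * KT * (gamma * KQ)) by ring.
  rewrite (powRM _ beta0) ?mulr_ge0 // => holder.
  apply: ler_wpM2l; first exact: powR_ge0.
  apply: holder; rewrite ?mulr_ge0 ?powRM //; try by move=> i; exact: sqrtr_ge0.
    by apply: le_trans hT0 _; apply: ler_wpM2l; [exact: powR_ge0|exact: hT].
  by apply: le_trans hQ0 _; apply: ler_wpM2l; [exact: powR_ge0|exact: hQ].
apply: le_trans (hN i) _; rewrite (@rep_sumBr T Q Q0) // (@rep_sumBl T T0 Q0) //.
have u1 := rnorm_fam dot_norm one (ltn_ord i).
have v1 := rnorm_fam dot_norm onf (ltn_ord i).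
have h1 := rep_sum_columns Q0 (e i) (f i) N (svd_sum_adjoint dot m' (singular_value T) g' h').
have h2 := rep_sum_unit_bound N (bounded_opB bT bT0) bQ0 u1 v1.
have h2' := rep_sum_unit_bound N bT (bounded_opB bQ bQ0) u1 v1.
have h3 := ler_wpM2l c0 Qgh; have h3' := ler_wpM2l c0' Tgh.
have h4 := cmodD (rep_sum D T0 Q0 (e i) (f i) N)
  (rep_sum D (fun x => T x - T0 x) Q0 (e i) (f i) N).
have h4' := cmodD (rep_sum D T0 Q0 (e i) (f i) N +
  rep_sum D (fun x => T x - T0 x) Q0 (e i) (f i) N)
  (rep_sum D T (fun x => Q x - Q0 x) (e i) (f i) N).
move: h1; rewrite -/T0 -/T0' [right_column _ _ _ * _]mulrC => h1; lra.
Qed.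

End Target.
End TripleEstimates.

(** Adding [d <= 1] to both factors raises the product by at most [d * (a + b + 1)], kept below half
    of the gap. Two uses separate the three factors of the Haagerup norm. *)
Lemma lt_prod_enlarge (R : realType) (a b t : R) : 0 <= a -> 0 <= b -> a * b < t ->
  exists a' b', [/\ a < a', b < b' & a' * b' < t].
Proof.
move=> a0 b0 abt; have e0 : 0 < (t - a * b) / 2 by rewrite divr_gt0 // subr_gt0.
have c0 : 0 <= a + b + 1 by rewrite !addr_ge0.
have [delta d0 hd] := small_factor c0 e0.
pose d := Num.min 1 delta.
have dp : 0 < d by rewrite lt_min ltr01.
have d1 : d <= 1 by rewrite ge_min lexx.
have dd : d <= delta by rewrite ge_min lexx orbT.
exists (a + d), (b + d); split; rewrite ?ltrDl //.
have : (a + b + 1) * d <= (a + b + 1) * delta by rewrite ler_wpM2l.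
nra.
Qed.

(** * Passage to the Haagerup norm *)

Section HaagerupNorm.
Context {R : realType} {H : completeNormedModType R[i]}.
Context {dot : {dot H for @Num.conj R[i]}}.
Context {d1 d2 d3 : measure_display}.
Context {X1 : measurableType d1} {X2 : measurableType d2} {X3 : measurableType d3}.
Variables (E1 : spectral_measure dot X1) (E2 : spectral_measure dot X2).
Variable E3 : spectral_measure dot X3.
Variable Psi : X1 -> X2 -> X3 -> R[i].
Hypothesis Psi_haagerup : haagerup E1 E2 E3 Psi.
Local Open Scope ereal_scope.

Lemma haagerup_norm_fin : haagerup_norm E1 E2 E3 Psi \is a fin_num.
Proof.
have h0 : 0 <= haagerup_norm E1 E2 E3 Psi.
  apply: le_ereal_inf_tmp => _ [a [b [c [_ ->]]]].
  by rewrite !mule_ge0 // spectral_ess_sup_ge0.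
rewrite ge0_fin_numE //.
have [a [b [c rep]]] := Psi_haagerup.
apply: (@le_lt_trans _ _ (Linf_l2_norm E1 a * Linf_matrix_norm E2 b * Linf_l2_norm E3 c)).
  by apply: ereal_inf_lbound; exists a, b, c.
have [[_ fa] [_ fb] [_ fc] _] := rep.
by rewrite !lte_mul_pinfty ?mule_ge0 ?spectral_ess_sup_ge0 // ?fin_numM //
  ge0_fin_numE ?spectral_ess_sup_ge0.
Qed.

(** Estimates are available for strict majorants of the three norms of a representation. A nearly
    optimal representation and slightly enlarged factors bring their product below [h + eps]. *)
Lemma le_haagerup_norm (x : \bar R) (L : R) : (0 <= L)%R ->
  (forall a b c (alpha beta gamma : R), haagerup_representation E1 E2 E3 Psi a b c ->
    Linf_l2_norm E1 a < alpha%:E -> Linf_matrix_norm E2 b < beta%:E ->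
    Linf_l2_norm E3 c < gamma%:E -> x <= (alpha * beta * gamma * L)%:E) ->
  x <= haagerup_norm E1 E2 E3 Psi * L%:E.
Proof.
move=> L0 hx.
have hE : haagerup_norm E1 E2 E3 Psi = (fine (haagerup_norm E1 E2 E3 Psi))%:E.
  by rewrite fineK // haagerup_norm_fin.
set h := fine _ in hE.
have bound (eps : R) : (0 < eps)%R -> x <= ((h + eps) * L)%:E.
  move=> eps0.
  have : haagerup_norm E1 E2 E3 Psi < (h + eps)%:E by rewrite hE lte_fin ltrDl.
  move=> /ereal_inf_lt[_ [a [b [c [rep ->]]]]].
  have [[_ fa] [_ fb] [_ fc] _] := rep.
  have real (y : \bar R) : 0 <= y -> y < +oo -> exists2 r : R, (0 <= r)%R & y = r%:E.
    by move=> y0 yoo; exists (fine y); rewrite ?fine_ge0 // fineK // ge0_fin_numE.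
  have [ra ra0 ea] := real _ (spectral_ess_sup_ge0 _ _) fa.
  have [rb rb0 eb] := real _ (spectral_ess_sup_ge0 _ _) fb.
  have [rc rc0 ec] := real _ (spectral_ess_sup_ge0 _ _) fc.
  rewrite /Linf_l2_norm /Linf_matrix_norm ea eb ec -!EFinM lte_fin.
  move=> /(lt_prod_enlarge (mulr_ge0 ra0 rb0) rc0)[ab [gamma [hab hc hlt]]].
  have [alpha [beta [ha hb hab']]] := lt_prod_enlarge ra0 rb0 hab.
  apply: le_trans (hx a b c alpha beta gamma rep _ _ _) _.
  - by rewrite /Linf_l2_norm ea lte_fin.
  - by rewrite /Linf_matrix_norm eb lte_fin.
  - by rewrite /Linf_l2_norm ec lte_fin.
  rewrite lee_fin ler_wpM2r //; apply: le_trans (ltW hlt).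
  by rewrite ler_wpM2r ?(ltW hab') // (le_trans rc0) // ltW.
rewrite hE -EFinM; case: x hx bound => [x| |] _ bound.
- rewrite lee_fin; apply: (@le_of_eps _ _ _ L) => // eps /bound.
  by rewrite lee_fin mulrDl.
- by have := bound 1%R ltr01.
- exact: leNye.
Qed.

End HaagerupNorm.

Unset Implicit Arguments.

Theorem theorem4p3 (R : realType) (H : completeNormedModType R[i])
    (dot : {dot H for @Num.conj R[i]})
    (dot_norm : forall u : H, dot u u = `|u| ^+ 2)
    (d1 d2 d3 : measure_display)
    (X1 : measurableType d1) (X2 : measurableType d2) (X3 : measurableType d3)
    (E1 : spectral_measure dot X1) (E2 : spectral_measure dot X2)
    (E3 : spectral_measure dot X3)
    (Psi : X1 -> X2 -> X3 -> R[i]) (Psi_haagerup : haagerup E1 E2 E3 Psi) :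
  [/\ forall (p : R) (T Q W : H -> H), 2 <= p ->
        bounded_op T -> schatten p Q ->
        triple_operator_integral E1 E2 E3 Psi T Q W ->
        schatten p W /\
        (schatten_norm p W <=
          haagerup_norm E1 E2 E3 Psi * (opnorm T)%:E * schatten_norm p Q)%E,
      forall (p : R) (T Q W : H -> H), 2 <= p ->
        schatten p T -> bounded_op Q ->
        triple_operator_integral E1 E2 E3 Psi T Q W ->
        schatten p W /\
        (schatten_norm p W <=
          haagerup_norm E1 E2 E3 Psi * schatten_norm p T * (opnorm Q)%:E)%E
    & forall (p q r : R) (T Q W : H -> H), 0 < p -> 0 < q ->
        1 / p + 1 / q <= 1 / 2 -> 1 / r = 1 / p + 1 / q ->
        schatten p T -> schatten q Q ->
        triple_operator_integral E1 E2 E3 Psi T Q W ->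
        schatten r W /\
        (schatten_norm r W <=
          haagerup_norm E1 E2 E3 Psi * schatten_norm p T * schatten_norm q Q)%E].
Proof.
(* The same [W] is the limit of the partial sums of every representation, so the bound can be taken
   over all of them. *)
have reps a b c (alpha beta gamma : R) T Q W :
    haagerup_representation E1 E2 E3 Psi a b c ->
    (Linf_l2_norm E1 a < alpha%:E)%E -> (Linf_matrix_norm E2 b < beta%:E)%E ->
    (Linf_l2_norm E3 c < gamma%:E)%E -> bounded_op T -> bounded_op Q ->
    triple_operator_integral E1 E2 E3 Psi T Q W ->
    exists D : bounded_rep E1 E2 E3,
      [/\ rep_alpha D = alpha, rep_beta D = beta & rep_gamma D = gamma] /\
      forall u v, vanishes (fun N => rep_sum D T Q u v N - dot (W u) v).
  move=> rep ha hb hc bT bQ hW.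
  have [D [Dabc Dr]] := bounded_rep_of rep ha hb hc; exists D; split=> //.
  exact: (triple_operator_integral_rep_sum dot_norm bT bQ hW rep Dabc).
have hfin := haagerup_norm_fin Psi_haagerup.
have schattenP (p : R) (W : H -> H) (L : R) : bounded_op W ->
    (schatten_norm p W <= haagerup_norm E1 E2 E3 Psi * L%:E)%E ->
    schatten p W /\ (schatten_norm p W <= haagerup_norm E1 E2 E3 Psi * L%:E)%E.
  move=> bW h; split=> //; split=> //; apply: le_lt_trans h _.
  by rewrite -(fineK hfin) -EFinM ltry.
split=> [p T Q W p2 bT sQ hW|p T Q W p2 sT bQ hW|p q r T Q W p0 q0 pq2 rpq sT sQ hW].
- have p0 : 0 < p by rewrite (lt_le_trans _ p2).
  have [bQ _] := sQ; have [bW _] := hW; have [K [K0 -> hK]] := schatten_normP p0 sQ.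
  rewrite -muleA -EFinM; apply: schattenP => //.
  apply: (le_haagerup_norm Psi_haagerup); first by rewrite mulr_ge0 ?opnorm_ge0.
  move=> a b c alpha beta gamma rep ha hb hc.
  have [D [[<- <- <-] hD]] := reps _ _ _ _ _ _ _ _ _ rep ha hb hc bT bQ hW.
  exact: (schatten_right dot_norm bT bQ bW hD p2 K0 hK).
- have p0 : 0 < p by rewrite (lt_le_trans _ p2).
  have [bT _] := sT; have [bW _] := hW; have [K [K0 -> hK]] := schatten_normP p0 sT.
  rewrite -muleA -EFinM; apply: schattenP => //.
  apply: (le_haagerup_norm Psi_haagerup); first by rewrite mulr_ge0 ?opnorm_ge0.
  move=> a b c alpha beta gamma rep ha hb hc.
  have [D [[<- <- <-] hD]] := reps _ _ _ _ _ _ _ _ _ rep ha hb hc bT bQ hW.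
  exact: (schatten_left dot_norm bT bQ bW hD p2 K0 hK).
have [bT _] := sT; have [bQ _] := sQ; have [bW _] := hW.
have [KT [KT0 -> hT]] := schatten_normP p0 sT.
have [KQ [KQ0 -> hQ]] := schatten_normP q0 sQ.
rewrite !div1r in pq2 rpq.
have ip : 0 < p^-1 by rewrite invr_gt0.
have iq : 0 < q^-1 by rewrite invr_gt0.
(* As both inverses are positive and their sum is at most one half, each is at most one half; this
   gives the exponents at least 2 that Jensen's inequality requires. *)
have ge2 (x : R) : 0 < x -> x^-1 <= 2^-1 -> 2 <= x.
  by move=> x0; rewrite lef_pV2 ?posrE.
have p2 : 2 <= p by apply: ge2 => //; lra.
have q2 : 2 <= q by apply: ge2 => //; lra.
have r0 : 0 < r by rewrite -invr_gt0 rpq addr_gt0.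
rewrite -muleA -EFinM; apply: schattenP => //.
apply: (le_haagerup_norm Psi_haagerup); first by rewrite mulr_ge0.
move=> a b c alpha beta gamma rep ha hb hc.
have [D [[<- <- <-] hD]] := reps _ _ _ _ _ _ _ _ _ rep ha hb hc bT bQ hW.
exact: (schatten_both dot_norm bT bQ bW hD p2 q2 r0 rpq).
Qed.
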